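(* Let $(X,d)$ be a metric space and $n \geq 0$ be an integer. If $T \in \mathbf F_{\gamma,\delta}(X)$ for some $\gamma \in \,]n,n+1[$ and $\delta \in \,]n-1,n[$, then $T$ has a unique continuous extension to a Hölder current \[\bar T : \mathrm{Lip}^{\alpha_1}(X) \times \dots \times \mathrm{Lip}^{\alpha_{n+1}}(X) \to \mathbb R\] whenever $\alpha_1,\dots,\alpha_{n+1}\in\,]0,1]$ satisfy $\alpha_1 + \dots + \alpha_{n+1} \geq \gamma$ and $\alpha_2 + \dots + \alpha_{n+1} \geq \delta$ (the latter in case $n \geq 1$). Moreover, if $(R_k)_{k\ge0}$ and $(S_k)_{k\ge0}$ are approximating sequences for $T$ as in the definition of a fractal current, with parameters $\rho$ and $\sigma$, then for all $f = (f^1,\dots,f^{n+1}) \in \mathrm{Lip}^{\alpha_1}(X) \times \dots \times \mathrm{Lip}^{\alpha_{n+1}}(X)$, \[\biggl|\sum_{k \geq 0} R_k(f)\biggr| \leq C\|f^1\|_{\alpha_1}H_{n}\sum_{k \geq 0} \Bigl(\mathbf M(R_k)\rho^{k(n - \delta)} + \mathbf M(\partial R_k) \rho^{k((n-1) - \delta)}\Bigr),\] \[\biggl|\sum_{k \geq 0} \partial S_k(f)\biggr| \leq CH_{n+1}\sum_{k \geq 0} \Bigl(\mathbf M(S_k)\sigma^{k((n+1) - \gamma)} + \mathbf M(\partial S_k) \sigma^{k(n - \gamma)}\Bigr),\] where $C = C(n,\gamma,\delta) \geq 0$, $H_n := \prod_{i=2}^{n+1} \mathrm{Lip}^{\alpha_i}(f^i)$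 ($H_n=1$ in case $n=0$), $H_{n+1} := H_n \mathrm{Lip}^{\alpha_1}(f^1)$ and $\|f^1\|_{\alpha_1} := \|f^1\|_\infty + \mathrm{Lip}^{\alpha_1}(f^1)$.
   Context: For a metric space $X$, $\mathrm{Lip}^\alpha(f)=\sup_{x\ne y}|f(x)-f(y)|/d(x,y)^\alpha$, $\mathrm{Lip}^\alpha(X)$ is the set of real functions for which this is finite, $\mathrm{Lip}=\mathrm{Lip}^1$. Metric currents (with compact support). For an integer $n\ge0$, $\mathscr D_n(X)$ is the space of multilinear maps $T:\mathrm{Lip}(X)^{n+1}\to\mathbb R$ such that (i) $T(f,g^1,\dots,g^n)=0$ whenever some $g^i$ is constant in a neighbourhood of $\operatorname{spt}(f)$; (ii) there is a compact $K\subset X$ with $T(f,g)=0$ whenever $\operatorname{spt}(f)\cap K=\emptyset$; (iii) $T(f_k,g_k)\to T(f,g)$ whenever $f_k\to f$, $g^i_k\to g^i$ uniformly and $\sup_{i,k}\{\mathrm{Lip}(f_k),\mathrm{Lip}(g_k^i)\}<\infty$. $\operatorname{spt}(T)$ is the smallest closed set $A$ such that $T(f,g)=0$ whenever $\operatorname{spt}(f)\cap A=\emptyset$. $\partial T(f,g^1,\dots,g^{n-1})=T(1,f,g^1,\dots,g^{n-1})$ for $n\ge1$, and $\partial T=0$ for $n=0$. The mass $\mathbf M(T)$ is the supremum of $\sum_{\lambda\in\Lambda}T(f_\lambda,g^1_\lambda,\dots,g_\lambda^n)$ over finite families with $\sum_\lambda|f_\lambda|\le1$ and $\mathrm{Lip}(g^i_\lambda)\le1$.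 $\mathbf N_n(X)$ is the space of $T\in\mathscr D_n(X)$ with $\mathbf M(T)+\mathbf M(\partial T)<\infty$. Weak convergence: supports contained in one compact set and pointwise convergence on $\mathrm{Lip}(X)^{n+1}$. Hölder currents. A multilinear $\bar T:\mathrm{Lip}^{\alpha_1}(X)\times\dots\times\mathrm{Lip}^{\alpha_{n+1}}(X)\to\mathbb R$ is a Hölder current if it satisfies (i)–(iii) with $\mathrm{Lip}$ replaced by $\mathrm{Lip}^{\alpha_i}$ in the $i$th slot. Since the functionals depend only on restrictions to a compact set $K$ containing the support, and $\mathrm{Lip}(K)\subset\mathrm{Lip}^{\alpha}(K)$, ''extension'' of $T\in\mathscr D_n(X)$ is understood after restriction to such a $K$. Every $N\in\mathbf N_n(X)$ has a unique continuous extension to a Hölder current if $\alpha_1+\dots+\alpha_{n+1}>n$ (known); $R_k(f)$ and $\partial S_k(f)$ denote the values of these extensions. Fractal currents. For $\gamma\in[n,n+1[$ and $\delta\in[n-1,n[$, $T\in\mathscr D_n(X)$ is in $\mathbf F_{\gamma,\delta}(X)$ if there are a compact $K\subset X$, sequences $(R_k)_{k\ge0}$ in $\mathbf N_n(X)$ and $(S_k)_{k\ge0}$ in $\mathbf N_{n+1}(X)$, and parameters $\sigma,\rho>1$ such that all $\operatorname{spt}(R_k),\operatorname{spt}(S_k)$ lie in $K$; the partial sums of $\sum_k (R_k+\partial S_k)$ converge weakly to $T$; and the four series $\sum_k\mathbf M(S_k)\sigma^{k((n+1)-\gamma)}$, $\sum_k\mathbf M(\partial S_k)\sigma^{k(n-\gamma)}$,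 $\sum_k\mathbf M(R_k)\rho^{k(n-\delta)}$, $\sum_k\mathbf M(\partial R_k)\rho^{k((n-1)-\delta)}$ are finite. For $n=0$ the convention is that $R_k=0$ for $k\ge1$ (and $\delta$ may be taken to be $-1$). *)

(* Defs.v *)
From HB Require Import structures.
From mathcomp Require Export all_boot all_order all_algebra.
From mathcomp Require Export all_classical all_reals all_analysis.
Export numFieldNormedType.Exports.
Export Order.TTheory GRing.Theory Num.Theory.

Set Implicit Arguments.
Unset Strict Implicit.
Unset Printing Implicit Defensive.

Local Open Scope classical_set_scope.
Local Open Scope ring_scope.

Section Currents.
Context {R : realType} {X : metricType R}.
Implicit Types (a : R) (f g : X -> R) (A K : set X).

(* The supremum is over a set containing 0, so that it is 0 (and not -oo) when
   X has at most one point. *)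
Definition holder_const a f : \bar R :=
  ereal_sup (0%E |` [set r | exists x y : X,
    x <> y /\ r = (`|f x - f y| / mdist x y `^ a)%:E]).

Definition holder a f : Prop := (holder_const a f < +oo)%E.

Definition sup_norm f : \bar R :=
  ereal_sup (0%E |` [set (`|f x|)%:E | x in [set: X]]).

Definition holder_norm a f : \bar R := (sup_norm f + holder_const a f)%E.

Definition fun_spt f : set X := closure [set x | f x != 0].

(* A functional of dimension n takes n+1 arguments: index ord0 carries f and
   index lift ord0 i carries g^{i+1}. It is a total function, but its values
   are only meaningful on a product of Hoelder classes (all conditions below
   are restricted to such a product). *)
Definition functional (n : nat) : Type := ('I_n.+1 -> X -> R) -> R.

Definition holder_tuple n (alpha : 'I_n -> R) (F : 'I_n -> X -> R) : Prop :=
  forall i, holder (alpha i) (F i).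

Definition lip_exp (n : nat) : 'I_n -> R := fun=> 1.

Definition multilinear n (alpha : 'I_n.+1 -> R) (T : functional n) : Prop :=
  forall (F : 'I_n.+1 -> X -> R) (i : 'I_n.+1) (g h : X -> R) (c : R),
    holder_tuple alpha F -> holder (alpha i) g -> holder (alpha i) h ->
    T (dfwith F i (fun x => c * g x + h x)) =
    c * T (dfwith F i g) + T (dfwith F i h).

Definition local n (alpha : 'I_n.+1 -> R) (T : functional n) : Prop :=
  forall F : 'I_n.+1 -> X -> R, holder_tuple alpha F ->
    (exists (i : 'I_n) (c : R),
       set_nbhs (fun_spt (F ord0)) [set x | F (lift ord0 i) x = c]) ->
    T F = 0.

Definition vanishes_off n (alpha : 'I_n.+1 -> R) (T : functional n) A : Prop :=
  forall F : 'I_n.+1 -> X -> R, holder_tuple alpha F ->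
    fun_spt (F ord0) `&` A = set0 -> T F = 0.

Definition seq_continuous n (alpha : 'I_n.+1 -> R) (T : functional n) : Prop :=
  forall (Fk : nat -> 'I_n.+1 -> X -> R) (F : 'I_n.+1 -> X -> R),
    holder_tuple alpha F ->
    (forall i, {uniform, (fun k => Fk k i) @ \oo --> F i}) ->
    (exists L : R, forall k i, (holder_const (alpha i) (Fk k i) <= L%:E)%E) ->
    (fun k => T (Fk k)) @ \oo --> T F.

Definition holder_current n (alpha : 'I_n.+1 -> R) (T : functional n) : Prop :=
  [/\ multilinear alpha T,
      local alpha T,
      (exists2 K, compact K & vanishes_off alpha T K) &
      seq_continuous alpha T].

Definition metric_current n (T : functional n) : Prop :=
  holder_current (@lip_exp n.+1) T.

Definition current_spt n (alpha : 'I_n.+1 -> R) (T : functional n) : set X :=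
  \bigcap_(A in [set A | closed A /\ vanishes_off alpha T A]) A.

Definition spt n (T : functional n) : set X := current_spt (@lip_exp n.+1) T.

Definition boundary n (T : functional n.+1) : functional n := fun F =>
  T (fun i => if unlift ord0 i is Some j then F j else cst 1).

Definition mass n (T : functional n) : \bar R :=
  ereal_sup [set r | exists (m : nat) (F : 'I_m -> 'I_n.+1 -> X -> R),
    [/\ forall l, holder_tuple (@lip_exp n.+1) (F l),
        forall x, \sum_(l < m) `|F l ord0 x| <= 1,
        forall l (i : 'I_n), (holder_const 1 (F l (lift ord0 i)) <= 1)%E &
        r = (\sum_(l < m) T (F l))%:E]].

(* The mass of the boundary, the boundary of a 0-dimensional current being 0. *)
Definition boundary_mass n : functional n -> \bar R :=
  match n with
  | 0 => fun=> 0%E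
  | _.+1 => fun T => mass (boundary T)
  end.

Definition normal_current n (T : functional n) : Prop :=
  metric_current T /\ (mass T + boundary_mass T < +oo)%E.

Definition weak_cvg n (Tk : nat -> functional n) (T : functional n) : Prop :=
  (exists2 K, compact K & forall k, spt (Tk k) `<=` K) /\
  (forall F, holder_tuple (@lip_exp n.+1) F ->
     (fun k => Tk k F) @ \oo --> T F).

(* In general Lip(X) is not contained in Lip^a(X), so a Hoelder current Tbar
   extends a metric current T when both induce the same functional on tuples of
   Lipschitz functions on a compact K containing the supports: F and G below
   are arbitrary Lipschitz and Hoelder representatives on X of such a tuple. *)
Definition holder_extension n (alpha : 'I_n.+1 -> R)
    (T Tbar : functional n) : Prop :=
  holder_current alpha Tbar /\
  exists K, [/\ compact K, spt T `<=` K, current_spt alpha Tbar `<=` K &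
    forall F G : 'I_n.+1 -> X -> R,
      holder_tuple (@lip_exp n.+1) F -> holder_tuple alpha G ->
      (forall i x, K x -> F i x = G i x) -> Tbar G = T F].

Definition unique_holder_extension n (alpha : 'I_n.+1 -> R)
    (T : functional n) : Prop :=
  exists Tbar, holder_extension alpha T Tbar /\
    forall Tbar', holder_extension alpha T Tbar' ->
      forall F, holder_tuple alpha F -> Tbar' F = Tbar F.

(* The value of the extension of T, denoted by T itself in the mathematics; only
   the values on holder_tuple alpha are determined. *)
Definition hext n (alpha : 'I_n.+1 -> R) (T : functional n) : functional n :=
  get (holder_extension alpha T).

Definition fractal_R_sum n (delta rho : R) (Rk : nat -> functional n) :
    \bar R :=
  (\sum_(0 <= k <oo)
     (mass (Rk k) * (rho `^ (k%:R * (n%:R - delta)))%:E +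
      boundary_mass (Rk k) * (rho `^ (k%:R * (n%:R - 1 - delta)))%:E))%E.

Definition fractal_S_sum n (gamma sigma : R) (Sk : nat -> functional n.+1) :
    \bar R :=
  (\sum_(0 <= k <oo)
     (mass (Sk k) * (sigma `^ (k%:R * (n.+1%:R - gamma)))%:E +
      mass (boundary (Sk k)) * (sigma `^ (k%:R * (n%:R - gamma)))%:E))%E.

(* The exponents are meant to satisfy n <= gamma < n+1 and n-1 <= delta < n; the
   last clause is the convention on (Rk) in dimension 0. *)
Definition fractal_approx n (gamma delta : R) (T : functional n)
    (Rk : nat -> functional n) (Sk : nat -> functional n.+1)
    (sigma rho : R) : Prop :=
  [/\ [/\ 1 < sigma, 1 < rho,
          forall k, normal_current (Rk k) & forall k, normal_current (Sk k)],
      (exists2 K, compact K & forall k, spt (Rk k) `<=` K /\ spt (Sk k) `<=` K),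
      weak_cvg
        (fun m F => \sum_(0 <= k < m) (Rk k F + boundary (Sk k) F)) T,
      [/\ (\sum_(0 <= k <oo)
             mass (Sk k) * (sigma `^ (k%:R * (n.+1%:R - gamma)))%:E < +oo)%E,
          (\sum_(0 <= k <oo)
             mass (boundary (Sk k)) *
             (sigma `^ (k%:R * (n%:R - gamma)))%:E < +oo)%E,
          (\sum_(0 <= k <oo)
             mass (Rk k) * (rho `^ (k%:R * (n%:R - delta)))%:E < +oo)%E &
          (\sum_(0 <= k <oo)
             boundary_mass (Rk k) *
             (rho `^ (k%:R * (n%:R - 1 - delta)))%:E < +oo)%E] &
      (n = 0)%N -> forall k F, (0 < k)%N ->
        holder_tuple (@lip_exp n.+1) F -> Rk k F = 0].

Definition fractal_current n (gamma delta : R) (T : functional n) : Prop :=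
  metric_current T /\
  exists Rk Sk sigma rho, fractal_approx gamma delta T Rk Sk sigma rho.

Definition holder_prod n (alpha : 'I_n.+1 -> R) (F : 'I_n.+1 -> X -> R) :
    \bar R :=
  (\prod_(i < n) holder_const (alpha (lift ord0 i)) (F (lift ord0 i)))%E.

End Currents.

Arguments functional {R} X n.

(* Main.v *)
Require Import Defs.
From mathcomp Require Import lra ring.

(* A Hoelder function f with constant L is approximated by the inf-convolution
   [inf_y (f y + L e^(a-1) d(x,y))], which is within [L e^a] of f and has
   Lipschitz constant [L e^(a-1)].  For a normal current N, the product rule
   [N(1,fh,..) = N(f,h,..) + N(h,f,..)] and the alternation in the last slots
   bound the change of N, when one slot changes by little in the sup norm, by
   M(N) and M(dN).  Hence the values of N on the approximations at the scales
   [e 2^-j] form a sequence whose increments decay geometrically, because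
   [n < gamma <= \sum alpha_i]; their limit is the extension of N.  Starting at
   the scale [e = rho^-k] for R_k, and [e = sigma^-k] for dS_k (where the value
   at the starting scale is controlled by M(S_k)), gives the two stated bounds
   term by term, and the extension of T is the sum of the dominated series of
   the extensions of R_k and dS_k. *)

Set Implicit Arguments.
Unset Strict Implicit.
Unset Printing Implicit Defensive.

Local Open Scope classical_set_scope.
Local Open Scope ring_scope.

(** * Hoelder functions *)

(** The axioms give only multilinearity, locality near supports and continuity under uniform
    Lipschitz bounds; the product rule and the alternation have to be derived. Both come from one
    device: a function [u] is replaced by two shifted staircases of it, one of which is constant on
    every short range of values, so that after cutting the first slot along the level sets of [u]
    only multilinearity and locality are left. A second obstacle is that [X] may be unbounded:
    Lipschitz functions need be neither bounded nor Hoelder, and products leave the class. Hence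
    locality is first sharpened until values depend only on restrictions to a compact carrier, and
    functions may then be clamped at their bounds there. The constant is uniform in [alpha] because
    halving the scale shrinks the error at least by the factor [2^-(gamma - n)]. The two bounds
    differ in form because dS_k has no boundary, which removes the sup norm of the first slot,
    whereas for R_k the starting value uses that sup norm and the slopes of the other n slots only;
    this is where [delta] meets the tail sum. *)

Section RealTools.
Context {R : realType}.
Implicit Types (a d e s t : R).

Lemma powRB1 a d : 0 < d -> d `^ a = d `^ (a - 1) * d.
Proof.
move=> d0; rewrite -[in X in _ * X](powRr1 (ltW d0)) -powRD ?subrK//.
by rewrite (gt_eqF d0) implybT.
Qed.

(** The exponent [a - 1] is nonpositive, so the line through the origin and the point of the graph
    over [e] lies above the power beyond [e] and below it before [e]. Its slope is the one used in
    the inf-convolution. *)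
Lemma powR_le_chord a d e : a <= 1 -> 0 < e -> e <= d ->
  d `^ a <= e `^ (a - 1) * d.
Proof.
move=> a1 e0 ed; have d0 : 0 < d := lt_le_trans e0 ed.
rewrite (powRB1 _ d0).
rewrite ler_pM2r// -(opprB 1 a) !powRN lef_pV2 ?posrE ?powR_gt0//.
by apply: ge0_ler_powR => //; rewrite ?nnegrE; lra.
Qed.

Lemma chord_le_powR a d e : a <= 1 -> 0 <= d -> d <= e ->
  e `^ (a - 1) * d <= d `^ a.
Proof.
move=> a1; rewrite le_eqVlt => /orP[/eqP<- _|d0 de]; first by rewrite mulr0 powR_ge0.
have e0 : 0 < e := lt_le_trans d0 de.
rewrite (powRB1 _ d0).
rewrite ler_pM2r// -(opprB 1 a) !powRN lef_pV2 ?posrE ?powR_gt0//.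
by apply: ge0_ler_powR => //; rewrite ?nnegrE; lra.
Qed.

Definition clamp e t : R := Num.max (- e) (Num.min e t).

(** Shrinkage towards 0: a perturbation of size at most [e] that keeps Lipschitz and Hoelder
    constants. It turns vanishing at a point into vanishing near that point. *)
Definition soft_thr e t : R := t - clamp e t.

Lemma clampP e t : 0 <= e ->
  [\/ e < t /\ clamp e t = e, t < - e /\ clamp e t = - e |
      - e <= t <= e /\ clamp e t = t].
Proof.
move=> e0; rewrite /clamp minEle maxEle.
case: (leP e t) => et; first case: (leP (-e) e) => ee.
- by case: (eqVneq e t) => [<-|ne]; [apply: Or33 | apply: Or31]; split=> //; lra.
- lra.
- case: (leP (-e) t) => ?; [apply: Or33 | apply: Or32]; split=> //; lra.
Qed.

Lemma clamp_norm e t : 0 <= e -> `|clamp e t| <= e.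
Proof. by move=> e0; rewrite ler_norml; case: (clampP t e0) => -[? ->]; lra. Qed.

Lemma clamp0 t : clamp 0 t = 0.
Proof. by apply/eqP; rewrite -normr_le0 clamp_norm. Qed.

Lemma clamp_id e t : `|t| <= e -> clamp e t = t.
Proof.
move=> te; have e0 : 0 <= e by apply: le_trans te.
by move: te; rewrite ler_norml; case: (clampP t e0) => -[? ->]; lra.
Qed.

Lemma clamp_lip e s t : 0 <= e -> `|clamp e s - clamp e t| <= 1 * `|s - t|.
Proof.
move=> e0; rewrite mul1r; case: (clampP s e0) => -[? ->]; case: (clampP t e0) => -[? ->];
by rewrite ler_norml; case: (ger0P (s - t)) => ?; lra.
Qed.

Lemma soft_thr_lip e s t : 0 <= e -> `|soft_thr e s - soft_thr e t| <= 1 * `|s - t|.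
Proof.
move=> e0; rewrite mul1r /soft_thr; case: (clampP s e0) => -[? ->]; case: (clampP t e0) => -[? ->];
by rewrite ler_norml; case: (ger0P (s - t)) => ?; lra.
Qed.

Lemma soft_thr_near e t : 0 <= e -> `|soft_thr e t - t| <= e.
Proof. by move=> e0; rewrite /soft_thr addrAC subrr add0r normrN clamp_norm. Qed.

Lemma soft_thr_eq0 e t : `|t| <= e -> soft_thr e t = 0.
Proof. by move=> te; rewrite /soft_thr clamp_id// subrr. Qed.

Lemma soft_thr_neq0 e t : 0 <= e -> soft_thr e t != 0 -> e < `|t|.
Proof. by move=> e0; rewrite ltNge; apply: contra => /soft_thr_eq0 ->. Qed.

End RealTools.

Section HolderTools.
Context {R : realType} {X : metricType R}.
Implicit Types (a d e s t L : R) (f g h : X -> R) (x y : X).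

Definition hold a L f := forall x y, `|f x - f y| <= L * mdist x y `^ a.

Lemma hold_const_le a L f : 0 < a -> 0 <= L ->
  (holder_const a f <= L%:E)%E <-> hold a L f.
Proof.
move=> a0 L0; split=> [H x y|H].
  have [->|xy] := pselect (x = y).
    by rewrite subrr normr0 mulr_ge0 ?powR_ge0.
  have d0 : 0 < mdist x y by rewrite mdist_gt0; apply/eqP.
  rewrite -ler_pdivrMr ?powR_gt0// -lee_fin; apply: le_trans H.
  by apply: ereal_sup_ubound; right; exists x, y.
apply: ge_ereal_sup => _ [->|[x [y [xy ->]]]]; first by rewrite lee_fin.
have d0 : 0 < mdist x y by rewrite mdist_gt0; apply/eqP.
by rewrite lee_fin ler_pdivrMr ?powR_gt0.
Qed.

Lemma holder_const_ge0 a f : (0 <= holder_const a f)%E.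
Proof. by apply: ereal_sup_ubound; left. Qed.

Lemma holder_constK a f : holder a f ->
  holder_const a f = (fine (holder_const a f))%:E.
Proof. by move=> H; rewrite fineK// ge0_fin_numE ?holder_const_ge0. Qed.

Lemma holder_hold a f : 0 < a -> holder a f -> hold a (fine (holder_const a f)) f.
Proof.
move=> a0 H; apply/hold_const_le => //; last by rewrite -holder_constK.
by rewrite fine_ge0 ?holder_const_ge0.
Qed.

Lemma holderP a f : 0 < a -> holder a f <-> exists2 L, 0 <= L & hold a L f.
Proof.
move=> a0; split=> [H|[L L0 /(hold_const_le _ a0 L0) H]]; last first.
  by apply: le_lt_trans H _; rewrite ltry.
by exists (fine (holder_const a f)); rewrite ?fine_ge0 ?holder_const_ge0//; apply: holder_hold.
Qed.

Lemma hold_holder a L f : 0 < a -> 0 <= L -> hold a L f -> holder a f.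
Proof. by move=> a0 L0 H; apply/holderP => //; exists L. Qed.

Lemma hold_le a L L' f : L <= L' -> hold a L f -> hold a L' f.
Proof. by move=> LL H x y; apply: le_trans (H x y) _; rewrite ler_wpM2r ?powR_ge0. Qed.

Lemma hold_cst a c : hold a 0 (fun=> c).
Proof. by move=> x y; rewrite subrr normr0 mul0r. Qed.

Lemma hold_add a L L' f g : hold a L f -> hold a L' g ->
  hold a (L + L') (fun x => f x + g x).
Proof.
move=> Hf Hg x y; rewrite mulrDl.
have -> : f x + g x - (f y + g y) = (f x - f y) + (g x - g y) by ring.
by rewrite (le_trans (ler_normD _ _))// lerD.
Qed.

Lemma hold_scale a L c f : hold a L f -> hold a (`|c| * L) (fun x => c * f x).
Proof. by move=> Hf x y; rewrite -mulrBr normrM -mulrA ler_wpM2l. Qed.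

Lemma hold_sub a L L' f g : hold a L f -> hold a L' g ->
  hold a (L + L') (fun x => f x - g x).
Proof.
move=> Hf Hg x y; rewrite mulrDl.
have -> : f x - g x - (f y - g y) = (f x - f y) - (g x - g y) by ring.
by rewrite (le_trans (ler_normB _ _))// lerD.
Qed.

Lemma hold_comp a L k (p : R -> R) f :
  0 <= k -> (forall s t, `|p s - p t| <= k * `|s - t|) -> hold a L f ->
  hold a (k * L) (fun x => p (f x)).
Proof. by move=> k0 Hp Hf x y; rewrite (le_trans (Hp _ _))// -mulrA ler_wpM2l. Qed.

Lemma hold_max a L f g : hold a L f -> hold a L g ->
  hold a L (fun x => Num.max (f x) (g x)).
Proof.
move=> Hf Hg x y; move: (Hf x y) (Hg x y).
rewrite !ler_norml !maxEle => /andP[? ?] /andP[? ?].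
by case: ifPn; case: ifPn; rewrite -?ltNge => *; lra.
Qed.

Lemma hold_min a L f g : hold a L f -> hold a L g ->
  hold a L (fun x => Num.min (f x) (g x)).
Proof.
move=> Hf Hg x y; move: (Hf x y) (Hg x y).
rewrite !ler_norml !minEle => /andP[? ?] /andP[? ?].
by case: ifPn; case: ifPn; rewrite -?ltNge => *; lra.
Qed.

Lemma hold_mul a L L' B B' f g : 0 <= B -> 0 <= B' ->
  (forall x, `|f x| <= B) -> (forall x, `|g x| <= B') ->
  hold a L f -> hold a L' g -> hold a (B' * L + B * L') (fun x => f x * g x).
Proof.
move=> B0 B'0 fB gB Hf Hg x y.
have -> : f x * g x - f y * g y = g x * (f x - f y) + f y * (g x - g y) by ring.
rewrite mulrDl -!mulrA (le_trans (ler_normD _ _))// !normrM lerD//.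
  by rewrite ler_pM.
by rewrite ler_pM.
Qed.

(** Below distance 1 the Lipschitz bound is the stronger one, beyond it boundedness suffices.
    Clamped Lipschitz functions enter the Hoelder classes in this way. *)
Lemma hold_bounded a L B f : 0 < a <= 1 -> 0 <= L -> 0 <= B ->
  (forall x, `|f x| <= B) -> hold 1 L f -> hold a (Num.max L (2 * B)) f.
Proof.
move=> /andP[a0 a1] L0 B0 fB Hf x y; have [d1|d1] := leP (mdist x y) 1.
  apply: le_trans (Hf x y) _; rewrite powRr1 ?mdist_ge0//.
  rewrite ler_pM ?mdist_ge0 ?le_max ?lexx//.
  by have := chord_le_powR a1 (mdist_ge0 x y) d1; rewrite powR1 mul1r.
have -> : `|f x - f y| <= 2 * B -> `|f x - f y| <= Num.max L (2 * B) * mdist x y `^ a => //.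
  move=> /le_trans; apply; rewrite -[leLHS]mulr1 ler_pM ?mulr_ge0 ?le_max ?lexx ?orbT//.
  by rewrite -[leLHS](powRr0 (mdist x y)) ler_powR// ltW.
by rewrite (le_trans (ler_normB _ _))// mulr2n mulrDl !mul1r lerD.
Qed.


Lemma hold_le_near a L e f : 0 < a -> 0 <= L -> 0 < e -> hold a L f ->
  exists2 r, 0 < r & forall x y, mdist x y <= r -> `|f x - f y| <= e.
Proof.
(* The radius solves [(L + 1) r^a = e]; the added 1 allows [L = 0]. *)
move=> a0 L0 e0 H; exists ((e / (L + 1)) `^ a^-1).
  by rewrite powR_gt0// divr_gt0//; lra.
move=> x y xy; apply: le_trans (H x y) _.
apply: (@le_trans _ _ ((L + 1) * ((e / (L + 1)) `^ a^-1) `^ a)).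
  rewrite ler_pM ?powR_ge0//; first lra.
  by rewrite ge0_ler_powR ?nnegrE ?powR_ge0 ?mdist_ge0// ltW.
rewrite -powRrM mulVf ?gt_eqF// powRr1 ?divr_ge0//; try lra.
by rewrite mulrCA divff ?mulr1//; lra.
Qed.

Lemma hold_continuous a L f : 0 < a -> 0 <= L -> hold a L f -> continuous f.
Proof.
move=> a0 L0 H x; apply/cvgrPdist_le => /= e e0.
have [r r0 Hr] := hold_le_near a0 L0 e0 H.
apply/nbhs_ballP; exists r => //= y; rewrite ballEmdist/= => xy.
by apply: Hr; apply: ltW.
Qed.

Definition uconv (fk : nat -> X -> R) f :=
  forall e, 0 < e -> \forall k \near \oo, forall x, `|fk k x - f x| <= e.

Lemma uconv_cst f : uconv (fun=> f) f.
Proof. by move=> e e0; near=> k => x; rewrite subrr normr0 ltW. Unshelve. all: by end_near. Qed.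

Lemma uconvP (fk : nat -> X -> R) f :
  uconv fk f <-> {uniform, fk @ \oo --> f}.
Proof.
split=> [H P /uniform_nbhs [E [/= entE EsubP]]|H e e0].
  have [/= e e0 eE] : exists2 e : R, 0 < e & forall s t, `|s - t| <= e -> E (s, t).
    case: entE => e/= e0 eE; exists (e / 2); first by rewrite divr_gt0.
    move=> s t st; apply: eE => /=; rewrite /ball/= (le_lt_trans st)//.
    by rewrite ltr_pdivrMr// ltr_pMr// ltr1n.
  apply: filterS (H e e0) => k Hk; apply: EsubP => x _; apply: eE.
  by rewrite distrC; apply: Hk.
have := H [set g : X -> R | forall x, `|g x - f x| <= e]; apply.
apply/uniform_nbhs; exists [set st | `|st.2 - st.1| <= e]; split=> /=.
  exists e => //= -[s t]/=; rewrite /ball/= distrC; exact: ltW.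
by move=> g gE x; apply: gE.
Qed.


Lemma uconv_le (fk : nat -> X -> R) f (b : nat -> R) :
  (forall k x, `|fk k x - f x| <= b k) -> b @ \oo --> 0 -> uconv fk f.
Proof.
move=> H /cvgr0_norm_le b0 e e0; near=> k => x; apply: le_trans (H k x) _.
by apply: le_trans (ler_norm _) _; near: k; apply: b0.
Unshelve. all: by end_near. Qed.


(** * Lipschitz approximation by inf-convolution *)

Definition appr s f x := inf [set f y + s * mdist x y | y in [set: X]].

Section Appr.
Variables (a L e : R) (f : X -> R).
Hypotheses (a01 : 0 < a <= 1) (L0 : 0 <= L) (e0 : 0 < e) (fH : hold a L f).
Let s := L * e `^ (a - 1).

Let s0 : 0 <= s. Proof. by rewrite mulr_ge0 ?powR_ge0. Qed.

(** Either d(x,y) is at most [e] and [L e^a] alone absorbs [L d(x,y)^a], or the chord bound lets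
    [s d(x,y)] absorb it. This gives both the finiteness of the infimum and its distance to [f]. *)
Let appr_lb x y : f x - L * e `^ a <= f y + s * mdist x y.
Proof.
have /andP[a0 a1] := a01.
have : L * mdist x y `^ a <= L * e `^ a + s * mdist x y.
  rewrite /s -mulrA -mulrDr ler_wpM2l//; have [xe|xe] := leP (mdist x y) e.
    apply: ler_wpDr; first by rewrite mulr_ge0 ?powR_ge0 ?mdist_ge0.
    by apply: ge0_ler_powR; rewrite ?nnegrE ?mdist_ge0// ltW.
  by apply: ler_wpDl; [exact: powR_ge0|apply: powR_le_chord => //; exact: ltW].
have := fH x y; rewrite ler_norml => /andP[_ ?] ?; lra.
Qed.

Let appr_inf x : has_inf [set f y + s * mdist x y | y in [set: X]].
Proof.
split; first by exists (f x + s * mdist x x), x.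
by exists (f x - L * e `^ a) => _ [y _ <-]; apply: appr_lb.
Qed.

Lemma appr_le x y : appr s f x <= f y + s * mdist x y.
Proof. by apply: ge_inf; [have [] := appr_inf x|exists y]. Qed.

Lemma appr_near x : `|appr s f x - f x| <= L * e `^ a.
Proof.
have H : f x - L * e `^ a <= appr s f x.
  by apply: lb_le_inf; [have [] := appr_inf x|move=> _ [y _ <-]; apply: appr_lb].
have := appr_le x x; rewrite mdistxx mulr0 addr0 => H'.
rewrite ler_norml; have := mulr_ge0 L0 (powR_ge0 e a); lra.
Qed.

Lemma appr_lip : hold 1 s (appr s f).
Proof.
have H x y : appr s f x - s * mdist x y <= appr s f y.
  apply: lb_le_inf; first by have [] := appr_inf y.
  move=> _ [z _ <-]; rewrite lerBlDr (le_trans (appr_le x z))//.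
  by rewrite -addrA lerD2l -mulrDr ler_wpM2l// addrC metric_triangle.
move=> x y; rewrite powRr1 ?mdist_ge0// ler_norml.
by have := H x y; have := H y x; rewrite (metric_sym y x); lra.
Qed.

(** The factor 3 comes from distances above [e]: one [L] for [f] and one for the error at each end
    point. The constant must not depend on [e], as continuity of Hoelder currents asks for uniform
    Hoelder bounds. *)
Lemma appr_hold : hold a (3 * L) (appr s f).
Proof.
have /andP[a0 a1] := a01.
move=> x y; have [xe|xe] := leP (mdist x y) e.
  apply: le_trans (appr_lip x y) _; rewrite powRr1 ?mdist_ge0// /s -!mulrA.
  apply: (@le_trans _ _ (L * mdist x y `^ a)).
    by rewrite ler_wpM2l// chord_le_powR ?mdist_ge0.
  rewrite ler_peMl// ?mulr_ge0 ?powR_ge0//; lra.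
have H : L * e `^ a <= L * mdist x y `^ a.
  rewrite ler_wpM2l//; apply: ge0_ler_powR; rewrite ?nnegrE ?mdist_ge0//; exact: ltW.
have := fH x y; have := appr_near x; have := appr_near y.
rewrite !ler_norml => /andP[? ?] /andP[? ?] /andP[? ?]; lra.
Qed.

(** For a function less steep than the cone of slope [s] the infimum is attained at the vertex.
    Small scales therefore never make a Lipschitz function steeper than it was. *)
Lemma appr_id L' : hold 1 L' f -> L' <= s -> appr s f = f.
Proof.
move=> fL Ls; apply/funext => x; apply/eqP; rewrite eq_le.
have := appr_le x x; rewrite mdistxx mulr0 addr0 => -> /=.
apply: lb_le_inf; first by have [] := appr_inf x.
move=> _ [y _ <-]; have := fL x y; rewrite powRr1 ?mdist_ge0// ler_norml.
have := ler_wpM2r (mdist_ge0 x y) Ls; lra.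
Qed.


End Appr.

(** At a fixed slope the infimum is nonexpansive for the sup norm. *)
Lemma appr_dist a L e n f g : 0 < a <= 1 -> 0 <= L -> 0 < e ->
  hold a L f -> hold a L g -> (forall x, `|g x - f x| <= n) ->
  forall x, `|appr (L * e `^ (a - 1)) g x - appr (L * e `^ (a - 1)) f x| <= n.
Proof.
move=> a01 L0 e0 fH gH fg x.
suff H u v : hold a L u -> hold a L v -> (forall x, `|u x - v x| <= n) ->
    appr (L * e `^ (a - 1)) u x - n <= appr (L * e `^ (a - 1)) v x.
  have := H _ _ gH fH fg; have := H _ _ fH gH.
  move=> /(_ (fun x => ltac:(rewrite distrC; exact: fg x))).
  rewrite ler_norml; lra.
move=> uH vH uv; apply: lb_le_inf.
  by exists (v x + L * e `^ (a - 1) * mdist x x), x.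
move=> _ [y _ <-]; have := appr_le a01 L0 e0 uH x y.
have := uv y; rewrite ler_norml; lra.
Qed.

(** This is [max(0, 1 - s dist(x, C))]; joining 0 to the set also covers an empty [C]. *)
Definition bump (C : set X) s x :=
  sup ([set 0] `|` [set 1 - s * mdist x y | y in C]).

Section Bump.
Variables (C : set X) (s : R).
Hypothesis s0 : 0 < s.

Let bump_sup x : has_sup ([set 0] `|` [set 1 - s * mdist x y | y in C]).
Proof.
split; first by exists 0; left.
exists 1 => _ [->|[y _ <-]]; first exact: ler01.
by rewrite lerBlDr lerDl mulr_ge0 ?mdist_ge0 ?ltW.
Qed.

Lemma bump_ge0 x : 0 <= bump C s x.
Proof. by apply: ub_le_sup; [have [] := bump_sup x|left]. Qed.

Lemma bump_le1 x : bump C s x <= 1.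
Proof.
apply: ge_sup; first by have [] := bump_sup x.
move=> _ [->|[y _ <-]]; first exact: ler01.
by rewrite lerBlDr lerDl mulr_ge0 ?mdist_ge0 ?ltW.
Qed.

Lemma bump1 x : C x -> bump C s x = 1.
Proof.
move=> Cx; apply/eqP; rewrite eq_le bump_le1/=.
apply: ub_le_sup; first by have [] := bump_sup x.
by right; exists x => //; rewrite mdistxx mulr0 subr0.
Qed.

Lemma bump_neq0 x : bump C s x != 0 -> exists2 y, C y & mdist x y < s^-1.
Proof.
move=> b0; apply: contrapT => H; move/negP: b0; apply; rewrite eq_le bump_ge0 andbT.
apply: ge_sup; first by have [] := bump_sup x.
move=> _ [->//|[y Cy <-]]; rewrite subr_le0 mulrC -ler_pdivrMr// div1r leNgt.
by apply/negP => xy; apply: H; exists y.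
Qed.

Lemma bump_lip : hold 1 s (bump C s).
Proof.
have H x y : bump C s x - s * mdist x y <= bump C s y.
  rewrite lerBlDr; apply: ge_sup; first by have [] := bump_sup x.
  move=> _ [->|[z Cz <-]].
    by rewrite addr_ge0 ?bump_ge0// mulr_ge0 ?mdist_ge0// ltW.
  have : 1 - s * mdist y z <= bump C s y.
    by apply: ub_le_sup; [have [] := bump_sup y|right; exists z].
  have := ler_wpM2l (ltW s0) (metric_triangle y x z).
  rewrite (metric_sym y x); lra.
move=> x y; rewrite powRr1 ?mdist_ge0// ler_norml.
by have := H x y; have := H y x; rewrite (metric_sym y x); lra.
Qed.

End Bump.

Lemma hold_bounded_compact a L f (K : set X) : 0 < a -> 0 <= L -> hold a L f ->
  compact K -> exists2 B, 0 <= B & forall x, K x -> `|f x| <= B.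
Proof.
move=> a0 L0 fH cK.
have : bounded_set (f @` K).
  apply: compact_bounded; apply: continuous_compact => //.
  exact: continuous_subspaceT (hold_continuous a0 L0 fH).
move=> [M [Mr HM]]; exists (Num.max 0 (M + 1)); first by rewrite le_max lexx.
move=> x Kx; apply: (@le_trans _ _ (M + 1)); last by rewrite le_max lexx orbT.
by apply: (HM (M + 1)); [rewrite ltrDl|exists x].
Qed.

End HolderTools.

(** * Locality and support of Hoelder currents *)

Section Hybrid.
Context {R : realType} {Y : Type}.

Lemma dfwith_id m (F : 'I_m -> Y) i : dfwith F i (F i) = F.
Proof. by apply/funext => j; case: dfwithP. Qed.

Lemma dfwithK m (F : 'I_m -> Y) i g h : dfwith (dfwith F i g) i h = dfwith F i h.
Proof.
apply/funext => j; have [<-|ij] := eqVneq i j; first by rewrite !dfwithin.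
by rewrite !dfwithout.
Qed.

Lemma dfwithC m (F : 'I_m -> Y) i j g h : i != j ->
  dfwith (dfwith F i g) j h = dfwith (dfwith F j h) i g.
Proof.
move=> ij; apply/funext => k; have [<-|ik] := eqVneq i k.
  by rewrite dfwithout 1?eq_sym// !dfwithin.
rewrite (dfwithout _ _ ik); have [<-|jk] := eqVneq j k; first by rewrite !dfwithin.
by rewrite !dfwithout.
Qed.

(* F is changed into G one slot at a time; H is an intermediate tuple. *)
Lemma hybrid_dist m (P : ('I_m -> Y) -> R) (F G : 'I_m -> Y) (D : R) :
  (forall H i, (forall j, H j = F j \/ H j = G j) ->
     `|P (dfwith H i (G i)) - P (dfwith H i (F i))| <= D) ->
  `|P G - P F| <= m%:R * D.
Proof.
move=> HD; pose H k : 'I_m -> Y := fun i => if (i < k)%N then G i else F i.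
have H0 : H 0%N = F by apply/funext.
have Hm : H m = G by apply/funext => i; rewrite /H ltn_ord.
suff K k : (k <= m)%N -> `|P (H k) - P F| <= k%:R * D by rewrite -[in P G]Hm K.
elim: k => [|k IH] km; first by rewrite H0 subrr normr0 mul0r.
pose i := Ordinal km.
have E1 : H k.+1 = dfwith (H k) i (G i).
  apply/funext => j; have [<-|ij] := eqVneq i j; first by rewrite dfwithin /H /= ltnSn.
  rewrite dfwithout// /H ltnS leq_eqVlt; case: eqP => //= jk.
  by move: ij; rewrite -val_eqE /= jk eqxx.
have E2 : H k = dfwith (H k) i (F i).
  by rewrite -[LHS](dfwith_id _ i) {2}/H /= ltnn.
rewrite -natr1 mulrDl mul1r.
have -> : P (H k.+1) - P F = (P (H k) - P F) + (P (H k.+1) - P (H k)) by ring.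
rewrite (le_trans (ler_normD _ _))// lerD ?IH 1?ltnW//.
rewrite E1 [in X in _ - P X]E2; apply: HD => j.
by rewrite /H; case: ifP; [right|left].
Qed.

End Hybrid.

Section Currents.
Context {R : realType} {X : metricType R}.
Implicit Types (f g h : X -> R).

Lemma fun_sptP f x : fun_spt f x <->
  forall r, 0 < r -> exists2 y, f y != 0 & mdist x y < r.
Proof.
split=> [H r r0|H B /nbhs_ballP[r/= r0 rB]].
  have [|y [fy xy]] := H (ball x r); first exact: nbhsx_ballx.
  by exists y => //; move: xy; rewrite ballEmdist.
have [y fy xy] := H r r0; exists y; split=> //; apply: rB.
by rewrite ballEmdist.
Qed.

(** Around a zero of [f] the modulus of continuity keeps the values below [e], so the thresholded
    function vanishes on a whole ball. *)
Lemma fun_spt_thr a L e f x : 0 < a -> 0 <= L -> 0 < e -> hold a L f ->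
  fun_spt (fun x => soft_thr e (f x)) x -> f x != 0.
Proof.
move=> a0 L0 e0 fH /fun_sptP S; apply/eqP => fx0.
have [r r0 Hr] := hold_le_near a0 L0 e0 fH.
have [y ty xy] := S _ r0; have := soft_thr_neq0 (ltW e0) ty.
have := Hr x y (ltW xy); rewrite fx0 sub0r normrN => H1 H2.
by move: (le_lt_trans H1 H2); rewrite ltxx.
Qed.

Lemma hold_clamp a L L' f (u : X -> R) : hold a L f -> hold a L' u ->
  hold a (Num.max L L') (fun x => clamp (u x) (f x)).
Proof.
move=> fH uH; rewrite /clamp; apply: hold_max.
  apply: (@hold_le _ _ _ (`|-1| * L')); first by rewrite normrN1 mul1r le_max lexx orbT.
  by under eq_fun do rewrite -mulN1r; apply: hold_scale.
by apply: hold_min; [apply: hold_le uH|apply: hold_le fH]; rewrite le_max lexx ?orbT.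
Qed.

Lemma closed_compact_dist (C B : set X) : compact C -> closed B ->
  C `&` B = set0 -> exists2 r, 0 < r & forall x y, C x -> B y -> r <= mdist x y.
Proof.
move=> cC clB CB.
(* Compactness in its near-covering form, against the filter of small positive radii, yields one
   radius for all of [C]. *)
have [|e/= e0 He] := (compact_near_coveringP C).1 cC R (0^'+)
    (fun r x => forall y, B y -> r <= mdist x y) _ _.
  move=> x Cx; have Bx : ~ B x by move=> Bx; have : (C `&` B) x by []; rewrite CB.
  have /nbhs_ballP[r/= r0 rB] : nbhs x (~` B).
    by apply: open_nbhs_nbhs; split=> //; apply: closed_openC.
  near=> x' r' => y By.
  have xx' : mdist x x' < r / 2.
    have : ball x (r / 2) x' by near: x'; apply: nbhsx_ballx; rewrite divr_gt0.
    by rewrite ballEmdist.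
  have r'r : r' <= r / 2.
    by near: r'; apply: nbhs_right_le; rewrite divr_gt0.
  rewrite leNgt; apply/negP => x'y; apply: (rB y) => //; rewrite ballEmdist /=.
  by rewrite (le_lt_trans (metric_triangle x x' y))// (splitr r) ltrD// (lt_le_trans x'y).
exists (e / 2); first by rewrite divr_gt0.
move=> x y Cx By; apply: He => //=; last by rewrite divr_gt0.
by rewrite sub0r normrN gtr0_norm ?divr_gt0// ltr_pdivrMr// ltr_pMr// ltr1n.
Unshelve. all: by end_near. Qed.

Section HolderCurrent.
Variables (n : nat) (alpha : 'I_n.+1 -> R) (T : functional X n).
Hypotheses (halpha : forall i, 0 < alpha i <= 1) (hT : holder_current alpha T).
Implicit Types (F G : 'I_n.+1 -> X -> R).

Let alpha0 i : 0 < alpha i. Proof. by have /andP[] := halpha i. Qed.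

Lemma holder_tuple_with F i g : holder_tuple alpha F -> holder (alpha i) g ->
  holder_tuple alpha (dfwith F i g).
Proof. by move=> HF Hg j; case: dfwithP. Qed.

Lemma holder_tupleP F : holder_tuple alpha F <->
  exists2 L, 0 <= L & forall i, hold (alpha i) L (F i).
Proof.
split=> [H|[L L0 H] i]; last exact: (hold_holder _ _ (H i)).
exists (\sum_i fine (holder_const (alpha i) (F i))).
  by apply: sumr_ge0 => i _; rewrite fine_ge0 ?holder_const_ge0.
move=> i; apply: hold_le (holder_hold (alpha0 i) (H i)).
rewrite (bigD1 i)//= lerDl; apply: sumr_ge0 => j _.
by rewrite fine_ge0 ?holder_const_ge0.
Qed.

Lemma holder_cst (c : R) a : 0 < a -> holder a ((fun=> c) : X -> R).
Proof. by move=> a0; apply: (hold_holder a0 _ (@hold_cst _ X a c)). Qed.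

Lemma holderB a f g : 0 < a -> holder a f -> holder a g -> holder a (fun x => f x - g x).
Proof.
move=> a0 /(holderP _ a0)[L L0 fH] /(holderP _ a0)[L' L'0 gH].
by apply: (hold_holder a0 _ (hold_sub fH gH)); apply: addr_ge0.
Qed.

Lemma currentB F i g h : holder_tuple alpha F -> holder (alpha i) g -> holder (alpha i) h ->
  T (dfwith F i (fun x => g x - h x)) = T (dfwith F i g) - T (dfwith F i h).
Proof.
move=> HF Hg Hh; have [ml _ _ _] := hT.
have := ml F i h g (-1) HF Hh Hg.
have -> : (fun x => -1 * h x + g x) = (fun x => g x - h x) by apply/funext => x; ring.
by move=> ->; rewrite mulN1r addrC.
Qed.

Lemma currentD F i g h : holder_tuple alpha F -> holder (alpha i) g -> holder (alpha i) h ->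
  T (dfwith F i (fun x => g x + h x)) = T (dfwith F i g) + T (dfwith F i h).
Proof.
move=> HF Hg Hh; have [ml _ _ _] := hT.
have := ml F i g h 1 HF Hg Hh.
have -> : (fun x => 1 * g x + h x) = (fun x => g x + h x) by apply/funext => x; ring.
by move=> ->; rewrite mul1r.
Qed.

Lemma current0 F i : holder_tuple alpha F -> T (dfwith F i (fun=> 0)) = 0.
Proof.
move=> HF; have [ml _ _ _] := hT.
have H0 := holder_cst 0 (alpha0 i).
have := ml F i (fun=> 0) (fun=> 0) 1 HF H0 H0.
have -> : (fun x => 1 * 0 + 0) = (fun=> 0) :> (X -> R) by apply/funext => x; ring.
by lra.
Qed.

Lemma currentZ F i c g : holder_tuple alpha F -> holder (alpha i) g ->
  T (dfwith F i (fun x => c * g x)) = c * T (dfwith F i g).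
Proof.
move=> HF Hg; have [ml _ _ _] := hT.
have H0 := holder_cst 0 (alpha0 i).
have := ml F i g (fun=> 0) c HF Hg H0.
have -> : (fun x => c * g x + 0) = (fun x => c * g x) by apply/funext => x; ring.
by move=> ->; rewrite current0// addr0.
Qed.

Lemma current_cvg (Fk : nat -> 'I_n.+1 -> X -> R) F L : 0 <= L ->
  holder_tuple alpha F -> (forall i, uconv (fun k => Fk k i) (F i)) ->
  (forall k i, hold (alpha i) L (Fk k i)) -> (fun k => T (Fk k)) @ \oo --> T F.
Proof.
move=> L0 HF Fu FL; have [_ _ _ sc] := hT; apply: sc => //.
  by move=> i; apply/uconvP.
by exists L => k i; apply/hold_const_le.
Qed.

Lemma current_cvg_eq0 (Fk : nat -> 'I_n.+1 -> X -> R) F L : 0 <= L ->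
  holder_tuple alpha F -> (forall i, uconv (fun k => Fk k i) (F i)) ->
  (forall k i, hold (alpha i) L (Fk k i)) -> (forall k, T (Fk k) = 0) -> T F = 0.
Proof.
move=> L0 HF Fu FL F0; have := current_cvg L0 HF Fu FL.
under eq_fun do rewrite F0.
by move=> /cvg_lim <- //; apply: lim_cst.
Qed.

Lemma uconv_thr f (c : R) : uconv (fun k x => soft_thr k.+1%:R^-1 (f x - c) + c) f.
Proof.
apply: (@uconv_le _ _ _ _ (fun k => k.+1%:R^-1)); last exact: cvg_harmonic.
move=> k x; have := soft_thr_near (f x - c) (_ : 0 <= k.+1%:R^-1).
rewrite invr_ge0 ler0n => /(_ isT).
by congr (`|_| <= _); ring.
Qed.

Lemma uconv_dfwith (Fk : nat -> 'I_n.+1 -> X -> R) F i gk g :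
  (forall j, uconv (fun k => Fk k j) (F j)) -> uconv gk g ->
  forall j, uconv (fun k => dfwith (Fk k) i (gk k) j) (dfwith F i g j).
Proof.
move=> FF gg j; have [<-|ij] := eqVneq i j.
  rewrite dfwithin; have -> // : (fun k => dfwith (Fk k) i (gk k) i) = gk.
  by apply/funext => k; rewrite dfwithin.
rewrite dfwithout//; have -> // : (fun k => dfwith (Fk k) i (gk k) j) = fun k => Fk k j.
by apply/funext => k; rewrite dfwithout.
Qed.

Lemma hold_thr a L f e c : 0 <= e -> hold a L f ->
  hold a L (fun x => soft_thr e (f x - c) + c).
Proof.
move=> e0 fH x y; have -> : soft_thr e (f x - c) + c - (soft_thr e (f y - c) + c) =
  soft_thr e (f x - c) - soft_thr e (f y - c) by ring.
apply: le_trans (soft_thr_lip _ _ e0) _; rewrite mul1r.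
by apply: le_trans (fH x y); rewrite opprB addrA subrK.
Qed.

Section Support.
Variable K : set X.
Hypothesis voff : vanishes_off alpha T K.

Lemma current_slot0_eq0 F : holder_tuple alpha F -> (forall x, K x -> F ord0 x = 0) -> T F = 0.
Proof.
move=> HF F0; have [L L0 FL] := (holder_tupleP F).1 HF.
apply: (@current_cvg_eq0 (fun k => dfwith F ord0 (fun x => soft_thr k.+1%:R^-1 (F ord0 x - 0) + 0)) _ L) => //.
- move=> i; have := uconv_dfwith ord0 (fun i => uconv_cst (F i)) (uconv_thr (F ord0) 0).
  by move=> /(_ i); rewrite dfwith_id.
- by move=> k i; case: dfwithP => [|j _]; [apply: hold_thr|apply: FL].
move=> k; apply: voff.
  apply: holder_tuple_with => //; apply: (@hold_holder _ _ _ L) => //; exact: hold_thr.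
apply/seteqP; split=> x //= [+ Kx]; rewrite dfwithin.
under eq_fun do rewrite subr0 addr0.
move=> /(fun_spt_thr (alpha0 ord0) L0 _ (FL ord0)).
by rewrite F0// eqxx invr_gt0 ltr0n => /(_ isT).
Qed.

Lemma current_slot0_eq F g h : holder_tuple alpha F -> holder (alpha ord0) g ->
  holder (alpha ord0) h -> (forall x, K x -> g x = h x) ->
  T (dfwith F ord0 g) = T (dfwith F ord0 h).
Proof.
move=> HF Hg Hh gh; apply/eqP; rewrite -subr_eq0 -currentB//; apply/eqP.
apply: current_slot0_eq0; first by apply: holder_tuple_with => //; apply: holderB.
by move=> x Kx; rewrite dfwithin gh// subrr.
Qed.

Hypothesis cK : compact K.

(* In contrast with [local], neither a neighbourhood nor the points outside of K
   matter: both slots are soft-thresholded, and the first one is cut off by a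
   bump around the points of K where it does not vanish. *)
Lemma current_strict_local F (i : 'I_n) (c : R) : holder_tuple alpha F ->
  (forall x, K x -> F ord0 x != 0 -> F (lift ord0 i) x = c) -> T F = 0.
Proof.
move=> HF Fc; have [L L0 FL] := (holder_tupleP F).1 HF.
have [M M0 FM] := hold_bounded_compact (alpha0 ord0) L0 (FL ord0) cK.
pose j := lift ord0 i; have j0 : ord0 != j by rewrite /j neq_lift.
pose G k := dfwith (dfwith F ord0 (fun x => soft_thr k.+1%:R^-1 (F ord0 x - 0) + 0)) j
   (fun x => soft_thr k.+1%:R^-1 (F j x - c) + c).
have GL k l : hold (alpha l) L (G k l).
  rewrite /G; case: dfwithP => [|l' _]; first exact: hold_thr.
  by case: dfwithP => [|l'' _]; [apply: hold_thr|apply: FL].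
have HG k : holder_tuple alpha (G k) by apply/holder_tupleP; exists L.
apply: (@current_cvg_eq0 G _ L) => //.
  move=> l; have := uconv_dfwith ord0 (fun i => uconv_cst (F i)) (uconv_thr (F ord0) 0).
  by move=> H0; have := uconv_dfwith j H0 (uconv_thr (F j) c) l; rewrite !dfwith_id.
move=> k; set e : R := k.+1%:R^-1; have e0 : 0 < e by rewrite invr_gt0.
have G0 : G k ord0 = (fun x => soft_thr e (F ord0 x)).
  rewrite /G dfwithout 1?eq_sym// dfwithin.
  by apply/funext => x; rewrite subr0 addr0.
(* Within [r] of a point where the other slot equals [c], that slot is thresholded to [c] exactly.
   The radius is spent in three hops of length [r / 3]: inside the neighbourhood, to a point where
   the cut-off slot is nonzero, and on to [C]. *)
have [r r0 Hr] := hold_le_near (alpha0 j) L0 e0 (FL j).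
pose C := [set x | K x /\ soft_thr e (F ord0 x) != 0].
have s0 : 0 < (r / 3)^-1 by rewrite invr_gt0 divr_gt0.
pose phi := bump C (r / 3)^-1.
(* The first slot may be unbounded off [K], so its product with [phi] could leave the Hoelder class.
   Clamping at [M * phi] stays in the class and changes nothing on [K]. *)
pose f' x := clamp (M * phi x) (G k ord0 x).
have phiM x : 0 <= M * phi x by rewrite mulr_ge0// bump_ge0.
have phiH : holder (alpha ord0) (fun x => M * phi x).
  apply: (hold_holder _ _ (hold_scale _ (hold_bounded (B := 1) (halpha ord0) (ltW s0) ler01 _ (bump_lip C s0)))) => //.
    by rewrite mulr_ge0// le_max (ltW s0).
  by move=> x; rewrite ger0_norm ?bump_ge0// bump_le1.
have Hf' : holder (alpha ord0) f'.
  have /(holderP _ (alpha0 _))[L' L'0 H'] := phiH.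
  apply: (hold_holder _ _ (hold_clamp (GL k ord0) H')) => //.
  by rewrite le_max L0.
have f'E x : K x -> G k ord0 x = f' x.
  move=> Kx; rewrite /f' G0 clamp_id//.
  have [->|t0] := eqVneq (soft_thr e (F ord0 x)) 0; first by rewrite normr0.
  rewrite /phi bump1// mulr1; apply: le_trans (FM x Kx).
  have := soft_thr_lip (F ord0 x) 0 (ltW e0).
  have -> : soft_thr e 0 = 0 by rewrite soft_thr_eq0// normr0 ltW.
  by rewrite !subr0 mul1r.
rewrite -(dfwith_id (G k) ord0) (current_slot0_eq (HG k) (HG k ord0) Hf' f'E).
have [_ lo _ _] := hT; apply: lo; first exact: holder_tuple_with.
exists i, c => x; rewrite dfwithin => /fun_sptP /(_ (r / 3)).
rewrite divr_gt0// => /(_ isT)[y f'y xy].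
have /(bump_neq0 s0)[z [Kz tz] yz] : phi y != 0.
  by apply: contra f'y => /eqP py; rewrite /f' py mulr0 clamp0 eqxx.
apply: (@filterS _ _ _ (ball x (r / 3))); last by apply: nbhsx_ballx; rewrite divr_gt0.
move=> w; rewrite ballEmdist /= => xw; rewrite dfwithout// /G dfwithin soft_thr_eq0 ?add0r//.
have <- : F j z = c.
  apply: Fc => //; apply: contra tz => /eqP ->; rewrite soft_thr_eq0// normr0; exact: ltW.
apply: Hr; apply: le_trans (metric_triangle w x z) _.
have := metric_triangle x y z; rewrite (metric_sym w x).
by move: yz; rewrite invrK; lra.
Qed.

(** One slot at a time, the difference of the entries vanishes on [K]: in the first slot the carrier
    property applies, in the others strict locality with constant 0. This is what permits truncation
    of unbounded functions. *)
Lemma current_eq_on_compact F G : holder_tuple alpha F -> holder_tuple alpha G ->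
  (forall i x, K x -> F i x = G i x) -> T F = T G.
Proof.
move=> HF HG FG; apply/eqP; rewrite eq_sym -subr_eq0 -normr_le0.
have := @hybrid_dist _ _ _ T F G 0; rewrite mulr0; apply => H i HH.
have Hh : holder_tuple alpha H by move=> j; case: (HH j) => ->.
rewrite normr_le0 -currentB//; apply/eqP.
have HB : holder_tuple alpha (dfwith H i (fun x => G i x - F i x)).
  by apply: holder_tuple_with => //; apply: holderB.
case: (unliftP ord0 i) => [j|] ij.
  apply: (@current_strict_local _ j 0) => // x Kx _.
  by rewrite -ij dfwithin FG// subrr.
apply: current_slot0_eq0 => // x Kx.
by rewrite -ij dfwithin FG// subrr.
Qed.

End Support.

(* [current_spt] is an intersection of closed sets; stability under finite
   intersections and compactness show that it carries the current. *)
Lemma vanishes_offI A B : compact A -> vanishes_off alpha T A -> closed B ->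
  vanishes_off alpha T B -> vanishes_off alpha T (A `&` B).
Proof.
move=> cA vA clB vB F HF FAB; have [L L0 FL] := (holder_tupleP F).1 HF.
have [M M0 FM] := hold_bounded_compact (alpha0 ord0) L0 (FL ord0) cA.
pose C := A `&` fun_spt (F ord0).
have cC : compact C by apply: compact_closedI => //; apply: closed_closure.
have [|r r0 Hr] := closed_compact_dist cC clB.
  by apply/seteqP; split=> x // [[Ax Sx] Bx]; rewrite -FAB.
have s0 : 0 < (r / 2)^-1 by rewrite invr_gt0 divr_gt0.
pose phi := bump C (r / 2)^-1.
pose f' x := clamp (M * phi x) (F ord0 x).
have phiM x : 0 <= M * phi x by rewrite mulr_ge0// bump_ge0.
have phiH : holder (alpha ord0) (fun x => M * phi x).
  apply: (hold_holder _ _ (hold_scale _ (hold_bounded (B := 1) (halpha ord0) (ltW s0) ler01 _ (bump_lip C s0)))) => //.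
    by rewrite mulr_ge0// le_max (ltW s0).
  by move=> x; rewrite ger0_norm ?bump_ge0// bump_le1.
have Hf' : holder (alpha ord0) f'.
  have /(holderP _ (alpha0 _))[L' L'0 H'] := phiH.
  apply: (hold_holder _ _ (hold_clamp (FL ord0) H')) => //.
  by rewrite le_max L0.
have f'E x : A x -> F ord0 x = f' x.
  move=> Ax; rewrite /f' clamp_id//.
  have [->|t0] := eqVneq (F ord0 x) 0; first by rewrite normr0.
  by rewrite /phi bump1// ?mulr1; [apply: FM|split=> //; apply: subset_closure].
rewrite -(dfwith_id F ord0) (current_slot0_eq vA HF (HF ord0) Hf' f'E).
apply: vB; first exact: holder_tuple_with.
apply/seteqP; split=> x //= [+ Bx]; rewrite dfwithin => /fun_sptP /(_ (r / 2)).
rewrite divr_gt0// => /(_ isT)[y f'y xy].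
have /(bump_neq0 s0)[z Cz yz] : phi y != 0.
  by apply: contra f'y => /eqP py; rewrite /f' py mulr0 clamp0 eqxx.
have := Hr z x Cz Bx; have := metric_triangle x y z.
by move: yz; rewrite invrK (metric_sym z x); lra.
Qed.

Lemma spt_vanishes_off K : compact K -> current_spt alpha T `<=` K ->
  vanishes_off alpha T K.
Proof.
move=> cK TK F HF FK; have [_ _ [K0 cK0 vK0] _] := hT.
pose D := [set A | compact A /\ vanishes_off alpha T A].
have clD A : D A -> closed A by move=> [cA _]; apply: compact_closed => //; apply: metric_hausdorff.
have [[A [DA AF]]|H] := pselect (exists A, D A /\ fun_spt (F ord0) `&` A = set0).
  by apply: DA.2.
(* The traces of the compact carriers on the support of the first slot form a proper filter base of
   closed sets; a cluster point in [K0] lies in all of them. *)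
exfalso; pose B A := A `&` fun_spt (F ord0).
have FF : ProperFilter (filter_from D B).
  apply: filter_from_proper.
    apply: filter_from_filter; first by exists K0.
    move=> A1 A2 D1 D2; exists (A1 `&` A2).
      split; first by apply: compact_closedI; [exact: D1.1|exact: clD].
      by apply: vanishes_offI; [exact: D1.1|exact: D1.2|exact: clD|exact: D2.2].
    by move=> x [[? ?] ?]; split; split.
  move=> A DA; apply/set0P/eqP => B0; apply: H; exists A; split=> //.
  by rewrite setIC.
have [|p [K0p clp]] := cK0 _ FF; first by exists K0 => // x [].
have pA A : D A -> B A p.
  move=> DA; have cl : closed (B A) by apply: closedI; [exact: clD|exact: closed_closure].
  by apply: cl => U pU; apply: clp => //; exists A.
have Kp : K p.
  (* A closed carrier need not be compact, but its intersection with [K0] is a compact carrier and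
     so contains [p]. *)
  apply: TK => A [clA vA]; have [|[]//] := pA (K0 `&` A).
  by split; [exact: compact_closedI|exact: vanishes_offI].
have [_ Sp] := pA K0 (conj cK0 vK0).
by have : (fun_spt (F ord0) `&` K) p by []; rewrite FK.
Qed.

End HolderCurrent.
End Currents.

(** * Product rule and alternation for metric currents *)

Section Stairs.
Context {R : realType}.
Implicit Types (s t d : R).

(** Constant on the first three quarters of each unit interval and climbing by 1 on the last
    quarter, hence of slope 4. As the flat parts exceed half a period, they overlap those of the
    copy shifted by 1/2. *)
Definition stair s : R := (Num.floor s)%:~R + Num.max 0 (4 * (s - (Num.floor s)%:~R) - 3).

Let floorP s : exists2 k : int, Num.floor s = k & k%:~R <= s < k%:~R + 1.
Proof.
exists (Num.floor s) => //; have := floor_itv s.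
by rewrite intrD.
Qed.

Lemma stair_flat (k : int) s : k%:~R <= s <= k%:~R + 3 / 4 -> stair s = k%:~R.
Proof.
move=> ks; have kE : Num.floor s = k by apply: floor_def; rewrite intrD; lra.
by rewrite /stair kE maxEle; case: ifP => // ?; lra.
Qed.

Lemma stair_near s : `|stair s - s| <= 1.
Proof.
rewrite /stair; have [k -> ks] := floorP s.
by rewrite ler_norml maxEle; case: ifP => [?|/negbT]; rewrite -?ltNge; lra.
Qed.

Lemma stair_lip s t : `|stair s - stair t| <= 4 * `|s - t|.
Proof.
wlog st : s t / s <= t => [H|].
  by have [/H//|/ltW/H] := leP s t; rewrite distrC [in leRHS]distrC.
rewrite distrC [in leRHS]distrC (ger0_norm (_ : 0 <= t - s)) ?subr_ge0//.
rewrite /stair; have [k kE ks] := floorP s; have [l lE lt] := floorP t.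
rewrite kE lE; have kl : k <= l by rewrite -kE -lE; apply: Num.Theory.le_floor.
have [kl'|kl'] := eqVneq k l.
  rewrite -kl' in lt *; rewrite ler_norml !maxEle.
  by case: ifP => [?|/negbT]; case: ifP => [?|/negbT]; rewrite -?ltNge; lra.
have : (k + 1)%:~R <= l%:~R :> R by rewrite ler_int lezD1 lt_neqAle kl' kl.
rewrite intrD => kl1; rewrite ler_norml !maxEle.
by case: ifP => [?|/negbT]; case: ifP => [?|/negbT]; rewrite -?ltNge; lra.
Qed.

(* Two staircase approximations of the identity such that at least one of them
   is constant on every short interval: for [p (u x)] and [q (u x)] in place of
   u, products can be taken out of a current by strict locality alone. *)
Lemma stairs d : 0 < d -> exists p q : R -> R,
  [/\ forall s t, `|p s - p t| <= 4 * `|s - t|,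
      forall s t, `|q s - q t| <= 4 * `|s - t|,
      forall s, `|p s - s| <= d, forall s, `|q s - s| <= d &
      forall t, exists c, (forall s, t <= s <= t + d / 4 -> p s = c) \/
                          (forall s, t <= s <= t + d / 4 -> q s = c)].
Proof.
move=> d0; have dN : d != 0 by rewrite gt_eqF.
have sc s t : d * `|s / d - t / d| = `|s - t|.
  by rewrite -mulrBl normrM normfV (gtr0_norm d0) mulrCA divff ?mulr1.
exists (fun s => d * stair (s / d)), (fun s => d * (stair (s / d + 2^-1) - 2^-1)); split.
- move=> s t; rewrite -mulrBr normrM (gtr0_norm d0) -sc mulrCA ler_pM2l//.
  exact: stair_lip.
- move=> s t; rewrite -mulrBr normrM (gtr0_norm d0) -sc mulrCA ler_pM2l//.
  have -> : stair (s / d + 2^-1) - 2^-1 - (stair (t / d + 2^-1) - 2^-1) =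
    stair (s / d + 2^-1) - stair (t / d + 2^-1) by ring.
  apply: le_trans (stair_lip _ _) _.
  by have -> : s / d + 2^-1 - (t / d + 2^-1) = s / d - t / d by ring.
- move=> s; have -> : d * stair (s / d) - s = d * (stair (s / d) - s / d) by field.
  by rewrite normrM (gtr0_norm d0) -[leRHS]mulr1 ler_pM2l// stair_near.
- move=> s; have -> : d * (stair (s / d + 2^-1) - 2^-1) - s =
    d * (stair (s / d + 2^-1) - (s / d + 2^-1)) by field.
  by rewrite normrM (gtr0_norm d0) -[leRHS]mulr1 ler_pM2l// stair_near.
move=> t; have [k kE kt] := floorP (t / d).
have Es s : t <= s <= t + d / 4 -> t / d <= s / d <= t / d + 4^-1.
  move=> /andP[ts st]; rewrite ler_pM2r ?invr_gt0// ts/= -(@ler_pM2r _ d)//.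
  by rewrite mulrDl !divfK// mulrC.
(* In units of [d]: an interval of length 1/4 that starts in the first half of a period stays in its
   flat part; if it starts in the second half, the shift by 1/2 carries it into the flat part of the
   next period. *)
have [kt2|kt2] := leP (t / d) (k%:~R + 2^-1).
  exists (d * k%:~R); left=> s /Es ?; congr (_ * _); apply: stair_flat; lra.
exists (d * ((k + 1)%:~R - 2^-1)); right=> s /Es ?; congr (_ * (_ - _)).
by apply: stair_flat; rewrite intrD; lra.
Qed.

Lemma stairs_seq : exists pk qk : nat -> R -> R, forall k,
  [/\ forall s t, `|pk k s - pk k t| <= 4 * `|s - t|,
      forall s t, `|qk k s - qk k t| <= 4 * `|s - t|,
      forall s, `|pk k s - s| <= k.+1%:R^-1, forall s, `|qk k s - s| <= k.+1%:R^-1 &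
      forall t, exists c, (forall s, t <= s <= t + k.+1%:R^-1 / 4 -> pk k s = c) \/
                          (forall s, t <= s <= t + k.+1%:R^-1 / 4 -> qk k s = c)].
Proof.
have H (k : nat) : exists pq : (R -> R) * (R -> R),
  [/\ forall s t, `|pq.1 s - pq.1 t| <= 4 * `|s - t|,
      forall s t, `|pq.2 s - pq.2 t| <= 4 * `|s - t|,
      forall s, `|pq.1 s - s| <= k.+1%:R^-1, forall s, `|pq.2 s - s| <= k.+1%:R^-1 &
      forall t, exists c, (forall s, t <= s <= t + k.+1%:R^-1 / 4 -> pq.1 s = c) \/
                          (forall s, t <= s <= t + k.+1%:R^-1 / 4 -> pq.2 s = c)].
  have [|p [q pq]] := @stairs (k.+1%:R^-1); first by rewrite invr_gt0.
  by exists (p, q).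
have [pq Hpq] := choice H.
by exists (fun k => (pq k).1), (fun k => (pq k).2).
Qed.

(** The projection of the line onto [0, 1], written through [clamp] so that the Lipschitz bound is
    inherited. *)
Definition ramp s : R := clamp 2^-1 (s - 2^-1) + 2^-1.

Let half0 : 0 <= 2^-1 :> R. Proof. by rewrite invr_ge0. Qed.

Lemma ramp_lip s t : `|ramp s - ramp t| <= 1 * `|s - t|.
Proof.
rewrite /ramp opprD addrACA subrr addr0; apply: le_trans (clamp_lip _ _ half0) _.
by rewrite opprD addrACA subrr addr0.
Qed.

Lemma ramp0 s : s <= 0 -> ramp s = 0.
Proof. by move=> s0; rewrite /ramp; case: (clampP (s - 2^-1) half0) => -[? ->]; lra. Qed.

Lemma ramp1 s : 1 <= s -> ramp s = 1.
Proof. by move=> s0; rewrite /ramp; case: (clampP (s - 2^-1) half0) => -[? ->]; lra. Qed.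

End Stairs.

Section BoundedLipschitz.
Context {R : realType} {X : metricType R}.
Implicit Types (f g h a u : X -> R).

(** Products of Lipschitz functions are Lipschitz when the factors are bounded; this class is an
    algebra, as the product rule requires. *)
Definition blip f := exists2 L, 0 <= L & (forall x, `|f x| <= L) /\ hold 1 L f.

Lemma blipP B L f : 0 <= B -> 0 <= L -> (forall x, `|f x| <= B) -> hold 1 L f -> blip f.
Proof.
move=> B0 L0 fB fL; exists (B + L); first exact: addr_ge0.
split=> [x|]; first by apply: le_trans (fB x) _; rewrite lerDl.
by apply: hold_le fL; rewrite lerDr.
Qed.

Lemma blip_lip f : blip f -> holder 1 f.
Proof. by move=> [L L0 [_ fL]]; apply: hold_holder fL. Qed.

Lemma blip_cst (c : R) : blip (fun=> c).
Proof. by apply: (@blipP `|c| 0) => // x; rewrite ?hold_cst//; apply: hold_cst. Qed.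

Lemma blip_add f g : blip f -> blip g -> blip (fun x => f x + g x).
Proof.
move=> [L L0 [fB fL]] [M M0 [gB gL]]; apply: (@blipP (L + M) (L + M)); rewrite ?addr_ge0//.
  by move=> x; rewrite (le_trans (ler_normD _ _))// lerD.
exact: hold_add.
Qed.

Lemma blip_scale c f : blip f -> blip (fun x => c * f x).
Proof.
move=> [L L0 [fB fL]]; apply: (@blipP (`|c| * L) (`|c| * L)); rewrite ?mulr_ge0//.
  by move=> x; rewrite normrM ler_wpM2l.
exact: hold_scale.
Qed.

Lemma blip_sub f g : blip f -> blip g -> blip (fun x => f x - g x).
Proof.
move=> Hf Hg; have := blip_add Hf (blip_scale (-1) Hg).
by congr blip; apply/funext => x; rewrite mulN1r.
Qed.

Lemma blip_mul f g : blip f -> blip g -> blip (fun x => f x * g x).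
Proof.
move=> [L L0 [fB fL]] [M M0 [gB gL]]; apply: (@blipP (L * M) (M * L + L * M)).
- exact: mulr_ge0.
- by rewrite addr_ge0// mulr_ge0.
- by move=> x; rewrite normrM ler_pM.
exact: hold_mul.
Qed.

Lemma blip_comp k (p : R -> R) f : 0 <= k ->
  (forall s t, `|p s - p t| <= k * `|s - t|) -> blip f -> blip (fun x => p (f x)).
Proof.
move=> k0 pk [L L0 [fB fL]]; apply: (@blipP (`|p 0| + k * L) (k * L)).
- by rewrite addr_ge0// mulr_ge0.
- exact: mulr_ge0.
- move=> x; rewrite -[p (f x)](subrK (p 0)) addrC (le_trans (ler_normD _ _))// lerD2l.
  by rewrite (le_trans (pk _ _))// subr0 ler_wpM2l.
exact: hold_comp.
Qed.

Lemma uconv_near (fk : nat -> X -> R) f (c : R) : 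
  (forall k x, `|fk k x - f x| <= k.+1%:R^-1 * c) -> uconv fk f.
Proof.
move=> H; apply: uconv_le H _; rewrite -[X in _ --> X](mul0r c).
by apply: cvgMl; exact: cvg_harmonic.
Qed.

(* Partition of unity along u: the first slot is cut into pieces on which u
   oscillates by at most d. *)
Lemma additive_local_eq0 (P : (X -> R) -> R) u d : 0 < d -> blip u ->
  (forall f g, blip f -> blip g -> P (fun x => f x + g x) = P f + P g) ->
  (forall f t, blip f -> (forall x, f x != 0 -> t <= u x <= t + d) -> P f = 0) ->
  forall f, blip f -> P f = 0.
Proof.
move=> d0 Hu PD Ploc f Hf; have [U U0 [uB uL]] := Hu.
(* The difference of two consecutive ramps lives on [t m - h <= u <= t m + h], an interval of length
   [d]. *)
pose h := d / 2; have h0 : 0 < h by rewrite divr_gt0.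
pose t m : R := - U + m%:R * h.
pose th m x := ramp ((t m - u x) / h).
have Hth m : blip (th m).
  apply: (@blip_comp h^-1 (fun s => ramp ((t m - s) / h))) => //; first by rewrite invr_ge0 ltW.
  move=> r s; apply: le_trans (ramp_lip _ _) _.
  rewrite mul1r -mulrBl normrM normfV (gtr0_norm h0) mulrC ler_pM2l ?invr_gt0//.
  by rewrite distrC; have -> : t m - s - (t m - r) = r - s by ring.
(* Telescoping: as [t 0 = - U], the ramp of index 0 vanishes, each further one adds a local piece,
   and for large [m] the ramp is 1 everywhere. *)
have P0 m : P (fun x => f x * th m x) = 0.
  elim: m => [|m IH].
    apply: (Ploc _ 0) => [|x]; first exact: blip_mul.
    rewrite /th ramp0 ?mulr0 ?eqxx// mulr_le0_ge0 ?invr_ge0 ?(ltW h0)//.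
    by rewrite /t mul0r; have := uB x; rewrite ler_norml; lra.
  have -> : (fun x => f x * th m.+1 x) =
      (fun x => f x * th m x + f x * (th m.+1 x - th m x)).
    by apply/funext => x; ring.
  rewrite PD ?IH ?add0r; [|exact: blip_mul|by apply: blip_mul => //; apply: blip_sub].
  apply: (Ploc _ (t m - h)); first by apply: blip_mul => //; apply: blip_sub.
  have tS : t m.+1 = t m + h by rewrite /t -natr1; ring.
  move=> x /eqP H; apply/andP; split; rewrite leNgt; apply/negP => ux; apply: H.
    rewrite /th !ramp1 ?subrr ?mulr0// ler_pdivlMr// ?tS; lra.
  by rewrite /th !ramp0 ?subrr ?mulr0// mulr_le0_ge0 ?invr_ge0 ?(ltW h0)// ?tS /h; rewrite /h in tS ux *; lra.
have [m mU] : exists m : nat, 2 * U / h + 1 <= m%:R.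
  exists (Num.truncn (2 * U / h + 1)).+1; apply: ltW; exact: truncnS_gt.
rewrite -(P0 m); congr P; apply/funext => x; rewrite /th ramp1 ?mulr1//.
rewrite ler_pdivlMr// mul1r /t.
have : (2 * U / h + 1) * h <= m%:R * h by rewrite ler_pM2r.
rewrite mulrDl divfK ?gt_eqF// mul1r.
by have := uB x; rewrite ler_norml; lra.
Qed.

Lemma lip_exp01 n (i : 'I_n) : 0 < (@lip_exp R n i) <= 1.
Proof. by rewrite /lip_exp ltr01 lexx. Qed.

Section MetricCurrent.
Variables (n : nat) (T : functional X n) (K : set X).
Hypotheses (hT : metric_current T) (cK : compact K) (voff : vanishes_off (@lip_exp R n.+1) T K).
Implicit Types (F G : 'I_n.+1 -> X -> R) (i j : 'I_n).

Local Notation lips := (holder_tuple (@lip_exp R n.+1)).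
Local Notation l01 := (@lip_exp01 n.+1).

Let lip_with F (i : 'I_n.+1) f : lips F -> holder 1 f -> lips (dfwith F i f).
Proof. by move=> HF Hf; apply: holder_tuple_with. Qed.

Let upd F f i g := dfwith (dfwith F ord0 f) (lift ord0 i) g.

Let updC F f i g : upd F f i g = dfwith (dfwith F (lift ord0 i) g) ord0 f.
Proof. by rewrite /upd dfwithC// neq_lift. Qed.

Let upd0 F f i g : upd F f i g ord0 = f.
Proof. by rewrite updC dfwithin. Qed.

Let updS F f i g : upd F f i g (lift ord0 i) = g.
Proof. by rewrite /upd dfwithin. Qed.

Let lip_upd F f i g : lips F -> holder 1 f -> holder 1 g -> lips (upd F f i g).
Proof. by move=> HF Hf Hg; do !apply: lip_with. Qed.

Let updD0 F f f' i g : lips F -> holder 1 f -> holder 1 f' -> holder 1 g ->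
  T (upd F (fun x => f x + f' x) i g) = T (upd F f i g) + T (upd F f' i g).
Proof. by move=> HF Hf Hf' Hg; rewrite !updC (currentD hT)//; apply: lip_with. Qed.

Let updD1 F f i g g' : lips F -> holder 1 f -> holder 1 g -> holder 1 g' ->
  T (upd F f i (fun x => g x + g' x)) = T (upd F f i g) + T (upd F f i g').
Proof. by move=> HF Hf Hg Hg'; rewrite /upd (currentD hT)//; apply: lip_with. Qed.

Let updB1 F f i g g' : lips F -> holder 1 f -> holder 1 g -> holder 1 g' ->
  T (upd F f i (fun x => g x - g' x)) = T (upd F f i g) - T (upd F f i g').
Proof. by move=> HF Hf Hg Hg'; rewrite /upd (currentB hT)//; apply: lip_with. Qed.

Let updZ0 F f i g c : lips F -> holder 1 f -> holder 1 g ->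
  T (upd F (fun x => c * f x) i g) = c * T (upd F f i g).
Proof. by move=> HF Hf Hg; rewrite !updC (currentZ l01 hT)//; apply: lip_with. Qed.

Let updZ1 F f i g c : lips F -> holder 1 f -> holder 1 g ->
  T (upd F f i (fun x => c * g x)) = c * T (upd F f i g).
Proof. by move=> HF Hf Hg; rewrite /upd (currentZ l01 hT)//; apply: lip_with. Qed.

Let upd_local F f i g c : lips F -> holder 1 f -> holder 1 g ->
  (forall x, f x != 0 -> g x = c) -> T (upd F f i g) = 0.
Proof.
move=> HF Hf Hg fg; apply: (current_strict_local l01 hT voff cK (i := i) (c := c)).
  exact: lip_upd.
by move=> x _; rewrite upd0 updS; apply: fg.
Qed.

Let upd_local_eq F f i g g' : lips F -> holder 1 f -> holder 1 g -> holder 1 g' ->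
  (forall x, f x != 0 -> g x = g' x) -> T (upd F f i g) = T (upd F f i g').
Proof.
move=> HF Hf Hg Hg' fg; apply/eqP; rewrite -subr_eq0 -updB1//; apply/eqP.
apply: (@upd_local _ _ _ _ 0) => //; first exact: holderB.
by move=> x /fg ->; rewrite subrr.
Qed.

(* By polarization it is enough that the defect vanishes on the diagonal. *)
Let prod_defect F i f h :=
  T (upd F (fun=> 1) i (fun x => f x * h x)) - T (upd F f i h) - T (upd F h i f).

Let prod_defectC F i f h : prod_defect F i f h = prod_defect F i h f.
Proof.
rewrite /prod_defect addrAC.
by have -> : (fun x => f x * h x) = (fun x => h x * f x) by apply/funext => x; rewrite mulrC.
Qed.

Let prod_defectD F i f f' h : lips F -> blip f -> blip f' -> blip h ->
  prod_defect F i (fun x => f x + f' x) h = prod_defect F i f h + prod_defect F i f' h.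
Proof.
move=> HF Hf Hf' Hh; rewrite /prod_defect.
have -> : (fun x => (f x + f' x) * h x) = (fun x => f x * h x + f' x * h x).
  by apply/funext => x; rewrite mulrDl.
rewrite updD0 ?updD1 ?updD1; try (exact: blip_lip || exact: (blip_lip (blip_cst 1)) || (apply: blip_lip; exact: blip_mul) || done).
by ring.
Qed.

(** With an extra factor [a] in the first slot the defect is additive in [a] and can be cut along
    [u]. On a piece where, say, p(u) = c, multilinearity and locality leave
    [c T(a, q) - c T(a, q) - 0]. *)
Let prod_defect_stair F i u p q k d : 0 <= k -> 0 < d -> lips F -> blip u ->
  (forall s t, `|p s - p t| <= k * `|s - t|) ->
  (forall s t, `|q s - q t| <= k * `|s - t|) ->
  (forall t, exists c, (forall s, t <= s <= t + d -> p s = c) \/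
                       (forall s, t <= s <= t + d -> q s = c)) ->
  prod_defect F i (fun x => p (u x)) (fun x => q (u x)) = 0.
Proof.
move=> k0 d0 HF Hu pk qk pq.
have Hp := blip_comp k0 pk Hu; have Hq := blip_comp k0 qk Hu.
have Lp := blip_lip Hp; have Lq := blip_lip Hq; have Lpq := blip_lip (blip_mul Hp Hq).
pose P a := T (upd F a i (fun x => p (u x) * q (u x)))
  - T (upd F (fun x => a x * p (u x)) i (fun x => q (u x)))
  - T (upd F (fun x => a x * q (u x)) i (fun x => p (u x))).
have <- : P (fun=> 1) = prod_defect F i (fun x => p (u x)) (fun x => q (u x)).
  by rewrite /P; under [fun x => 1 * p _]eq_fun do rewrite mul1r; under [fun x => 1 * q _]eq_fun do rewrite mul1r.
apply: (additive_local_eq0 d0 Hu) (blip_cst 1) => [f g Hf Hg|a t Ha at_].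
  rewrite /P.
  have -> : (fun x => (f x + g x) * p (u x)) = (fun x => f x * p (u x) + g x * p (u x)).
    by apply/funext => x; rewrite mulrDl.
  have -> : (fun x => (f x + g x) * q (u x)) = (fun x => f x * q (u x) + g x * q (u x)).
    by apply/funext => x; rewrite mulrDl.
  rewrite !updD0 //; try (exact: blip_lip || (apply: blip_lip; exact: blip_mul)).
  by ring.
have La := blip_lip Ha; have Lap := blip_lip (blip_mul Ha Hp); have Laq := blip_lip (blip_mul Ha Hq).
have [c [pc|qc]] := pq t.
  have pE x : a x != 0 -> p (u x) = c by move=> /at_ ?; apply: pc.
  rewrite /P (@upd_local _ (fun x => a x * q (u x)) _ (fun x => p (u x)) c)//; last first.
    by move=> x; rewrite mulf_eq0 negb_or => /andP[/pE].
  rewrite (@upd_local_eq _ _ _ _ (fun x => c * q (u x)))//; last first.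
  - by move=> x /pE ->.
  - exact: (blip_lip (blip_scale c Hq)).
  have -> : (fun x => a x * p (u x)) = (fun x => c * a x).
    apply/funext => x; have [->|/pE ->] := eqVneq (a x) 0; first by rewrite mul0r mulr0.
    by rewrite mulrC.
  by rewrite updZ0// updZ1// !subrr.
have qE x : a x != 0 -> q (u x) = c by move=> /at_ ?; apply: qc.
rewrite /P (@upd_local _ (fun x => a x * p (u x)) _ (fun x => q (u x)) c)//; last first.
  by move=> x; rewrite mulf_eq0 negb_or => /andP[/qE].
rewrite (@upd_local_eq _ _ _ _ (fun x => c * p (u x)))//; last first.
- by move=> x /qE ->; rewrite mulrC.
- exact: (blip_lip (blip_scale c Hp)).
have -> : (fun x => a x * q (u x)) = (fun x => c * a x).
  apply/funext => x; have [->|/qE ->] := eqVneq (a x) 0; first by rewrite mul0r mulr0.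
  by rewrite mulrC.
by rewrite updZ0// updZ1// subr0 subrr.
Qed.

Let upd_cvg F i (fk gk : nat -> X -> R) f g L : 0 <= L -> lips F ->
  holder 1 f -> holder 1 g ->
  (forall k, hold 1 L (fk k)) -> (forall k, hold 1 L (gk k)) ->
  uconv fk f -> uconv gk g ->
  (fun k => T (upd F (fk k) i (gk k))) @ \oo --> T (upd F f i g).
Proof.
move=> L0 HF Hf Hg fL gL ff gg; have [M M0 FM] := (holder_tupleP l01 F).1 HF.
apply: (current_cvg l01 hT (L := L + M)); first exact: addr_ge0.
- exact: lip_upd.
- by move=> j; do 2!apply: uconv_dfwith => //; move=> j'; apply: uconv_cst.
move=> k j; rewrite /upd; case: dfwithP => [|j' _]; first by apply: hold_le (gL k); rewrite lerDl.
case: dfwithP => [|j'' _]; first by apply: hold_le (fL k); rewrite lerDl.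
by apply: hold_le (FM _); rewrite lerDr.
Qed.

(** Both staircases of [u] tend to [u] with Lipschitz constants at most [4 * U] and bounded values,
    so the vanishing of the mixed defect passes to the limit. *)
Let prod_defect_diag F i u : lips F -> blip u -> prod_defect F i u u = 0.
Proof.
move=> HF Hu; have [U U0 [uB uL]] := Hu.
have dk (k : nat) : 0 < k.+1%:R^-1 :> R by rewrite invr_gt0.
have [pk [qk H]] := @stairs_seq R.
have near_le k : k.+1%:R^-1 <= 1 :> R by rewrite invf_le1// ler1n.
have bnd (r : nat -> R -> R) k x : (forall s, `|r k s - s| <= k.+1%:R^-1) -> `|r k (u x)| <= U + 1.
  move=> rk; rewrite -[r k (u x)](subrK (u x)) addrC (le_trans (ler_normD _ _))// lerD//.
  by rewrite (le_trans (rk _)).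
have E k : prod_defect F i (fun x => pk k (u x)) (fun x => qk k (u x)) = 0.
  have [Hp Hq _ _ Hpq] := H k.
  exact: (prod_defect_stair _ (ler0n _ 4) (divr_gt0 (dk k) (ltr0n _ 4)) HF Hu Hp Hq Hpq).
have cv : (fun k => prod_defect F i (fun x => pk k (u x)) (fun x => qk k (u x))) @ \oo
    --> prod_defect F i u u.
  have Hp k : hold 1 (4 * U) (fun x => pk k (u x)).
    by have [? _ _ _ _] := H k; apply: hold_comp.
  have Hq k : hold 1 (4 * U) (fun x => qk k (u x)).
    by have [_ ? _ _ _] := H k; apply: hold_comp.
  have up : uconv (fun k x => pk k (u x)) u.
    by apply: (@uconv_near _ _ 1) => k x; rewrite mulr1; have [_ _ ? _ _] := H k.
  have uq : uconv (fun k x => qk k (u x)) u.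
    by apply: (@uconv_near _ _ 1) => k x; rewrite mulr1; have [_ _ _ ? _] := H k.
  have L1 := blip_lip (blip_cst 1); have Lu := blip_lip Hu.
  apply: cvgB; first apply: cvgB.
  - apply: (@upd_cvg _ _ _ _ _ _ ((U + 1) * (4 * U) + (U + 1) * (4 * U))) => //.
    + by rewrite addr_ge0// !mulr_ge0// addr_ge0.
    + exact: (blip_lip (blip_mul Hu Hu)).
    + move=> k; apply: hold_le (hold_cst _ _); by rewrite addr_ge0// !mulr_ge0// addr_ge0.
    + move=> k; have [_ _ ? ? _] := H k; apply: hold_mul => //; rewrite ?addr_ge0// => x.
        exact: bnd.
      exact: bnd.
    + exact: uconv_cst.
    apply: (@uconv_near _ _ (U + 1 + U)) => k x.
    have -> : pk k (u x) * qk k (u x) - u x * u x =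
      (pk k (u x) - u x) * qk k (u x) + (qk k (u x) - u x) * u x by ring.
    have [_ _ Hpk Hqk _] := H k.
    rewrite (le_trans (ler_normD _ _))// mulrDr !normrM lerD//; apply: ler_pM => //.
    exact: bnd.
  - by apply: (@upd_cvg _ _ _ _ _ _ (4 * U)) => //; rewrite mulr_ge0.
  - by apply: (@upd_cvg _ _ _ _ _ _ (4 * U)) => //; rewrite mulr_ge0.
move: cv; under eq_fun do rewrite E.
by move=> /cvg_lim <- //; apply: lim_cst.
Qed.

Lemma product_rule F i f h : lips F -> blip f -> blip h ->
  T (dfwith (dfwith F ord0 (fun=> 1)) (lift ord0 i) (fun x => f x * h x)) =
  T (dfwith (dfwith F ord0 f) (lift ord0 i) h) +
  T (dfwith (dfwith F ord0 h) (lift ord0 i) f).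
Proof.
move=> HF Hf Hh; rewrite -!/(upd _ _ _ _).
have fh := blip_add Hf Hh.
have : prod_defect F i f h = 0.
  have := prod_defect_diag i HF fh; rewrite prod_defectD// prod_defectC.
  rewrite [in X in _ + X]prod_defectC !prod_defectD// !prod_defect_diag//.
  by rewrite (prod_defectC _ _ h f) add0r addr0; lra.
by rewrite /prod_defect; lra.
Qed.

(** Cutting along a slot needs that slot to be bounded. The level is the same for all slots, so that
    equal slots stay equal. *)
Let truncation F : lips F -> exists2 M, 0 <= M &
  T F = T (fun k x => clamp M (F k x)) /\ lips (fun k x => clamp M (F k x)).
Proof.
move=> HF; have [L L0 FL] := (holder_tupleP l01 F).1 HF.
have H (i : 'I_n.+1) := @hold_bounded_compact _ _ 1 L (F i) K ltr01 L0 (FL i) cK.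
pose M (k : 'I_n.+1) := projT1 (cid2 (H k)).
have M0 k : 0 <= M k by rewrite /M; case: cid2.
have FM k x : K x -> `|F k x| <= M k by rewrite /M; case: cid2 => /= ? _; apply.
pose S := \sum_k M k; have S0 : 0 <= S by apply: sumr_ge0.
have HL : lips (fun k x => clamp S (F k x)).
  apply/(holder_tupleP l01); exists (1 * L); first by rewrite mul1r.
  by move=> k; apply: hold_comp => // s t; apply: clamp_lip.
exists S => //; split=> //.
apply: (current_eq_on_compact l01 hT voff cK) => // k x Kx.
rewrite clamp_id// (le_trans (FM k x Kx))// /S (bigD1 k)//= lerDl.
by apply: sumr_ge0.
Qed.

(** The two copies of [u] are replaced by its two staircases. After the first slot is cut along [u],
    one of the two is constant on each piece and strict locality applies. *)
Lemma current_alternating F i j : lips F -> i != j ->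
  F (lift ord0 i) = F (lift ord0 j) -> T F = 0.
Proof.
move=> HF ij; have [M M0 [-> HF' Fij]] := truncation HF.
pose G k x := clamp M (F k x); rewrite -/G in HF' *.
have {Fij} Gij : G (lift ord0 i) = G (lift ord0 j) by rewrite /G Fij.
have {HF' HF} HG : lips G by [].
have [L L0 GL] := (holder_tupleP l01 G).1 HG.
have GB k : blip (G k) by apply: (@blipP M L (G k) M0 L0 _ (GL k)) => x; apply: clamp_norm.
pose u := G (lift ord0 i); have Hu : blip u := GB _.
have dk (k : nat) : 0 < k.+1%:R^-1 :> R by rewrite invr_gt0.
have [pk [qk H]] := @stairs_seq R.
have lij : lift ord0 i != lift ord0 j by rewrite (inj_eq lift_inj).
pose Gk k := dfwith (dfwith G (lift ord0 i) (fun x => pk k (u x))) (lift ord0 j) (fun x => qk k (u x)).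
apply: (@current_cvg_eq0 _ _ _ _ _ l01 hT Gk _ (L + 4 * L)) => //.
- by rewrite addr_ge0// mulr_ge0.
- have -> : G = dfwith (dfwith G (lift ord0 i) u) (lift ord0 j) u.
    by rewrite dfwith_id /u Gij dfwith_id.
  rewrite /Gk => l; apply: uconv_dfwith => [l'|]; first apply: uconv_dfwith => [l''|].
  + exact: uconv_cst.
  + by apply: (@uconv_near _ _ 1) => k x; rewrite mulr1; have [_ _ ? _ _] := H k.
  + by apply: (@uconv_near _ _ 1) => k x; rewrite mulr1; have [_ _ _ ? _] := H k.
- move=> k l; have [Hp Hq _ _ _] := H k; rewrite /Gk; case: dfwithP => [|l' _].
    by apply: hold_le (hold_comp _ Hq (GL _)) => //; rewrite lerDr.
  case: dfwithP => [|l'' _].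
    by apply: hold_le (hold_comp _ Hp (GL _)) => //; rewrite lerDr.
  by apply: hold_le (GL _); rewrite lerDl mulr_ge0.
move=> k; have [Hp Hq _ _ Hpq] := H k.
have E0 : Gk k = dfwith (Gk k) ord0 (G ord0).
  rewrite -[LHS](dfwith_id _ ord0); congr dfwith.
  by rewrite /Gk !dfwithout// eq_sym neq_lift.
have HGk : lips (Gk k).
  apply: lip_with; last exact: (blip_lip (blip_comp (ler0n _ 4) Hq Hu)).
  by apply: lip_with => //; exact: (blip_lip (blip_comp (ler0n _ 4) Hp Hu)).
rewrite E0; pose P a := T (dfwith (Gk k) ord0 a).
apply: (additive_local_eq0 (P := P) (divr_gt0 (dk k) (ltr0n _ 4)) Hu) (GB ord0) => [f g Hf Hg|a t Ha at_].
  by rewrite /P (currentD hT)//; apply: blip_lip.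
have La := blip_lip Ha.
have [c [pc|qc]] := Hpq t.
  apply: (current_strict_local l01 hT voff cK (i := i) (c := c)); first exact: lip_with.
  move=> x _; rewrite dfwithin => /at_ ?; rewrite dfwithout ?neq_lift//.
  by rewrite /Gk dfwithout 1?eq_sym// dfwithin; apply: pc.
apply: (current_strict_local l01 hT voff cK (i := j) (c := c)); first exact: lip_with.
move=> x _; rewrite dfwithin => /at_ ?; rewrite dfwithout ?neq_lift//.
by rewrite /Gk dfwithin; apply: qc.
Qed.

(** Polarization: alternation for [g + h] in both slots, expanded. *)
Lemma current_swap F i j g h : lips F -> holder 1 g -> holder 1 h -> i != j ->
  T (dfwith (dfwith F (lift ord0 i) g) (lift ord0 j) h) =
  - T (dfwith (dfwith F (lift ord0 i) h) (lift ord0 j) g).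
Proof.
move=> HF Hg Hh ij.
have lij : lift ord0 i != lift ord0 j by rewrite (inj_eq lift_inj).
have Z u : holder 1 u -> T (dfwith (dfwith F (lift ord0 i) u) (lift ord0 j) u) = 0.
  move=> Hu; apply: (@current_alternating _ i j) => //; first by do !apply: lip_with.
  by rewrite dfwithin dfwithout 1?eq_sym// dfwithin.
have Hgh : holder 1 (fun x => g x + h x).
  have [L L0 gL] := (holderP _ ltr01).1 Hg; have [L' L'0 hL] := (holderP _ ltr01).1 Hh.
  by apply: (hold_holder ltr01 _ (hold_add gL hL)); apply: addr_ge0.
have D v w w' : holder 1 v -> holder 1 w -> holder 1 w' ->
    T (dfwith (dfwith F (lift ord0 i) (fun x => w x + w' x)) (lift ord0 j) v) =
    T (dfwith (dfwith F (lift ord0 i) w) (lift ord0 j) v) +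
    T (dfwith (dfwith F (lift ord0 i) w') (lift ord0 j) v).
  move=> Hv Hw Hw'; rewrite (dfwithC _ _ _ lij) (currentD hT)//; last exact: lip_with.
  by rewrite !(dfwithC _ _ _ lij).
have := Z _ Hgh.
rewrite (currentD hT)//; last exact: lip_with.
by rewrite !D// !Z// add0r addr0; lra.
Qed.

End MetricCurrent.
Lemma seq_continuousP n (alpha : 'I_n.+1 -> R) (T : functional X n) :
  (forall i, 0 < alpha i) ->
  (forall (Fk : nat -> 'I_n.+1 -> X -> R) F L, 0 <= L -> holder_tuple alpha F ->
    (forall i, uconv (fun k => Fk k i) (F i)) ->
    (forall k i, hold (alpha i) L (Fk k i)) -> (fun k => T (Fk k)) @ \oo --> T F) ->
  seq_continuous alpha T.
Proof.
move=> a0 H Fk F HF Fu [L FL].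
have L0 : 0 <= L by rewrite -lee_fin (le_trans (holder_const_ge0 _ _) (FL 0%N ord0)).
by apply: (H _ _ L) => // [i|k i]; [apply/uconvP|apply/hold_const_le].
Qed.

(** * The boundary of a metric current *)

Definition cone n (F : 'I_n -> X -> R) : 'I_n.+1 -> X -> R :=
  fun i => if unlift ord0 i is Some j then F j else cst 1.

Lemma boundaryE n (T : functional X n.+1) F : boundary T F = T (cone F).
Proof. by []. Qed.

Lemma coneS n (F : 'I_n -> X -> R) i : cone F (lift ord0 i) = F i.
Proof. by rewrite /cone liftK. Qed.

Lemma cone0 n (F : 'I_n -> X -> R) : cone F ord0 = cst 1.
Proof. by rewrite /cone unlift_none. Qed.

Lemma cone_with n (F : 'I_n -> X -> R) i g :
  cone (dfwith F i g) = dfwith (cone F) (lift ord0 i) g.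
Proof.
apply/funext => k; case: (unliftP ord0 k) => [j|] ->; last first.
  by rewrite dfwithout 1?eq_sym ?neq_lift// !cone0.
rewrite coneS; have [<-|ij] := eqVneq i j; first by rewrite !dfwithin.
by rewrite !dfwithout ?coneS// (inj_eq lift_inj).
Qed.

Lemma cone_lip n (F : 'I_n -> X -> R) :
  holder_tuple (@lip_exp R n) F -> holder_tuple (@lip_exp R n.+1) (cone F).
Proof.
move=> HF k; case: (unliftP ord0 k) => [j|] ->; first by rewrite coneS; apply: HF.
by rewrite cone0; apply: blip_lip; apply: blip_cst.
Qed.

Lemma boundary_boundary n (S : functional X n.+2) F : metric_current S ->
  holder_tuple (@lip_exp R n.+1) F -> boundary (boundary S) F = 0.
Proof.
move=> [_ lo _ _] HF; rewrite !boundaryE; apply: lo; first by do 2!apply: cone_lip.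
exists ord0, 1 => x _; apply: filterS filterT => y _ /=.
by rewrite coneS cone0.
Qed.

Section Boundary.
Variables (n : nat) (T : functional X n.+1) (K : set X).
Hypotheses (hT : metric_current T) (cK : compact K) (voff : vanishes_off (@lip_exp R n.+2) T K).

Local Notation l01 := (@lip_exp01 n.+2).

(** The first slot of the cone is the constant 1, whose support is everything, so the carrier
    property of [T] does not apply directly. The next slot vanishes on [K], however, and strict
    locality looks only at [K]. *)
Lemma boundary_vanishes_off : vanishes_off (@lip_exp R n.+1) (boundary T) K.
Proof.
move=> F HF FK; rewrite boundaryE; apply: (current_strict_local l01 hT voff cK (i := ord0) (c := 0)).
  exact: cone_lip.
move=> x Kx _; rewrite coneS; apply/eqP/negPn/negP => F0.
have : (fun_spt (F ord0) `&` K) x by split=> //; apply: subset_closure.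
by rewrite FK.
Qed.

Lemma boundary_current : metric_current (boundary T).
Proof.
have [ml _ _ _] := hT; split.
- move=> F i g h c HF Hg Hh; rewrite !boundaryE !cone_with.
  by apply: ml => //; apply: cone_lip.
- move=> F HF [i [c Fc]]; rewrite boundaryE.
  have [L L0 FL] := (holder_tupleP (@lip_exp01 n.+1) F).1 HF.
  have {}Fc x : F ord0 x != 0 -> F (lift ord0 i) x = c.
    by move=> F0; apply: (nbhs_singleton (Fc x _)); apply: subset_closure.
  have HC := cone_lip HF.
  have CL k : hold 1 L (cone F k).
    case: (unliftP ord0 k) => [j|] ->; first by rewrite coneS; apply: FL.
    by rewrite cone0; apply: hold_le (hold_cst _ _).
  pose o : 'I_n.+2 := lift ord0 ord0.
  have Co : cone F o = F ord0 by rewrite coneS.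
  apply: (@current_cvg_eq0 _ _ _ _ _ l01 hT
    (fun k => dfwith (cone F) o (fun x => soft_thr k.+1%:R^-1 (cone F o x - 0) + 0)) _ L) => //.
  + move=> j; have := uconv_dfwith o (fun i => uconv_cst (cone F i)) (uconv_thr (cone F o) 0).
    by move=> /(_ j); rewrite dfwith_id.
  + by move=> k j; case: dfwithP => [|j' _]; [apply: hold_thr|apply: CL].
  move=> k; set e : R := k.+1%:R^-1; have e0 : 0 < e by rewrite invr_gt0.
  set G := dfwith _ _ _.
  have HG : holder_tuple (@lip_exp R n.+2) G.
    apply: holder_tuple_with => //; apply: (hold_holder ltr01 L0); apply: hold_thr (CL o).
    exact: ltW.
  (* The leading 1 is split into [phi] and [1 - phi]. Where [phi] is nonzero so is [F ord0], hence
     the slot of index [i] equals [c]; where [1 - phi] is nonzero, [F ord0] is at most [e] in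
     absolute value and its thresholded version is 0. Strict locality kills both terms. *)
  pose phi x := ramp (`|F ord0 x| / e).
  have Hphi : holder 1 phi.
    apply: (hold_holder ltr01 _ (hold_comp (k := e^-1) (p := fun s => ramp (`|s| / e)) _ _ (FL ord0))).
    - by rewrite mulr_ge0// invr_ge0 ltW.
    - by rewrite invr_ge0 ltW.
    move=> s t; apply: le_trans (ramp_lip _ _) _; rewrite mul1r -mulrBl normrM normfV.
    by rewrite (gtr0_norm e0) mulrC ler_pM2l ?invr_gt0// ler_dist_dist.
  have Hphi' : holder 1 (fun x => 1 - phi x).
    by apply: holderB => //; apply: holder_cst.
  have -> : G = dfwith G ord0 (fun x => phi x + (1 - phi x)).
    rewrite -[LHS](dfwith_id _ ord0); congr dfwith; rewrite /G dfwithout 1?eq_sym ?neq_lift// cone0.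
    by apply/funext => x; rewrite addrC subrK.
  rewrite (currentD hT HG Hphi Hphi').
  rewrite (current_strict_local l01 hT voff cK (i := lift ord0 i) (c := c)); first last.
  + move=> x _; rewrite dfwithin => p0; rewrite dfwithout ?neq_lift//.
    rewrite /G dfwithout ?(inj_eq lift_inj) ?neq_lift// coneS; apply: Fc.
    by apply: contra p0 => /eqP p0; rewrite /phi p0 normr0 mul0r ramp0.
  + exact: holder_tuple_with.
  rewrite (current_strict_local l01 hT voff cK (i := ord0) (c := 0)) ?addr0//.
    exact: holder_tuple_with.
  move=> x _; rewrite dfwithin => p0; rewrite dfwithout ?neq_lift// /G dfwithin Co.
  rewrite subr0 addr0 soft_thr_eq0// leNgt; apply/negP => eF; move/eqP: p0; apply.
  by rewrite /phi ramp1 ?subrr// ler_pdivlMr// mul1r ltW.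
- by exists K => //; apply: boundary_vanishes_off.
apply: seq_continuousP => [i|Fk F L L0 HF Fu FL]; first exact: ltr01.
apply: (@current_cvg _ _ _ _ _ l01 hT (fun k => cone (Fk k)) (cone F) L) => //.
- exact: cone_lip.
- move=> k; case: (unliftP ord0 k) => [j|] ->.
    by rewrite coneS; under eq_fun do rewrite coneS; apply: Fu.
  by rewrite cone0; under eq_fun do rewrite cone0; apply: uconv_cst.
move=> k j; case: (unliftP ord0 j) => [j'|] ->; first by rewrite coneS; apply: FL.
by rewrite cone0; apply: hold_le (hold_cst _ _).
Qed.

End Boundary.

End BoundedLipschitz.

(** * Mass estimates for normal currents *)

Section MassBounds.
Context {R : realType} {X : metricType R}.
Implicit Types (f g h a u : X -> R).

Lemma mass_ge0 n (T : functional X n) : (0 <= mass T)%E.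
Proof.
apply: ereal_sup_ubound; exists 0%N, (fun _ _ _ => 0); split=> //.
- by move=> [].
- by move=> x; rewrite big_ord0.
- by move=> [].
- by rewrite big_ord0.
Qed.

Lemma boundary_mass_ge0 n (T : functional X n) : (0 <= boundary_mass T)%E.
Proof. by case: n T => [|n] T //=; apply: mass_ge0. Qed.

Section Metric.
Variables (n : nat) (T : functional X n) (K : set X).
Hypotheses (hT : metric_current T) (cK : compact K) (voff : vanishes_off (@lip_exp R n.+1) T K).
Implicit Types (F G : 'I_n.+1 -> X -> R).

Local Notation lips := (holder_tuple (@lip_exp R n.+1)).
Local Notation l01 := (@lip_exp01 R n.+1).

Lemma current_scale_all (c : 'I_n.+1 -> R) F : lips F ->
  T (fun i x => c i * F i x) = (\prod_i c i) * T F.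
Proof.
move=> HF; pose H k : 'I_n.+1 -> X -> R :=
  fun i => if (i < k)%N then fun x => c i * F i x else F i.
have lipc i : holder 1 (fun x => c i * F i x).
  have [L L0 FL] := (holderP _ ltr01).1 (HF i).
  by apply: (hold_holder ltr01 _ (hold_scale (c i) FL)); apply: mulr_ge0.
have HL k : lips (H k) by move=> i; rewrite /H; case: ifP.
suff E k : (k <= n.+1)%N -> T (H k) = (\prod_(i < n.+1 | (i < k)%N) c i) * T F.
  have := E n.+1 (leqnn _); have -> : H n.+1 = fun i x => c i * F i x.
    by apply/funext => i; rewrite /H ltn_ord.
  by move=> ->; congr (_ * _); apply: eq_bigl => i; rewrite ltn_ord.
elim: k => [|k IH] kn.
  by rewrite big_pred0// mul1r; congr T; apply/funext.
pose i := Ordinal kn.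
have E1 : H k.+1 = dfwith (H k) i (fun x => c i * F i x).
  apply/funext => j; have [<-|ij] := eqVneq i j; first by rewrite dfwithin /H /= ltnSn.
  rewrite dfwithout// /H ltnS leq_eqVlt; case: eqP => //= jk.
  by move: ij; rewrite -val_eqE /= jk eqxx.
have E2 : H k = dfwith (H k) i (F i).
  by rewrite -[LHS](dfwith_id _ i) {2}/H /= ltnn.
rewrite E1 (currentZ l01 hT _ (HL k) (HF i)) -E2 IH 1?ltnW// mulrA; congr (_ * _).
rewrite [RHS](bigD1 i)//=; congr (_ * _); apply: eq_bigl => j.
by rewrite -val_eqE /= ltnS; case: ltngtP.
Qed.

(** The tuple is rescaled to a one-element competitor for the mass, with a sign [s] to reach the
    absolute value. A zero [B] or [l i] cannot be divided by; then the first slot is zero or another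
    slot is constant, and the value is 0. *)
Lemma mass_bound M B (l : 'I_n -> R) F : (mass T <= M%:E)%E -> lips F ->
  0 <= B -> (forall x, `|F ord0 x| <= B) -> (forall i, 0 <= l i) ->
  (forall i, hold 1 (l i) (F (lift ord0 i))) ->
  `|T F| <= M * B * \prod_i l i.
Proof.
move=> TM HF B0 FB l0 Fl; have M0 : 0 <= M by rewrite -lee_fin (le_trans (mass_ge0 T)).
have [BE|BN] := eqVneq B 0.
  rewrite (current_slot0_eq0 l01 hT voff HF) ?normr0 ?mulr_ge0 ?prodr_ge0// => x _.
  by apply/eqP; rewrite -normr_le0 -BE.
have Bp : 0 < B by rewrite lt_neqAle eq_sym BN.
have [/existsP[i /eqP li]|/existsPn lN] := boolP [exists i, l i == 0].
  suff -> : T F = 0 by rewrite normr0 !mulr_ge0 ?prodr_ge0.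
  have [[x0 _]|NX] := pselect (exists x : X, True); last first.
    by apply: (current_slot0_eq0 l01 hT voff HF) => x; case: NX; exists x.
  apply: (current_strict_local l01 hT voff cK (i := i) (c := F (lift ord0 i) x0)) => // x _ _.
  by apply/eqP; rewrite -subr_eq0 -normr_le0; have := Fl i x x0; rewrite li mul0r.
have lp i : 0 < l i by rewrite lt_neqAle eq_sym lN l0.
pose c (s : R) := fun i : 'I_n.+1 => if unlift ord0 i is Some j then (l j)^-1 else s * B^-1.
have cS s : \prod_i c s i = s * B^-1 * (\prod_i l i)^-1.
  rewrite big_ord_recl /c unlift_none; congr (_ * _).
  by rewrite -prodfV; apply: eq_bigr => i _; rewrite liftK.
have H s : `|s| = 1 -> s * T F <= M * B * \prod_i l i.
  move=> s1; have Pp : 0 < B * \prod_i l i by rewrite mulr_gt0// prodr_gt0.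
  rewrite -mulrA -ler_pdivrMr// -lee_fin; apply: le_trans TM.
  apply: ereal_sup_ubound; exists 1%N, (fun _ i x => c s i * F i x); split.
  - move=> _ i; have [L L0 FL] := (holderP _ ltr01).1 (HF i).
    by apply: (hold_holder ltr01 _ (hold_scale (c s i) FL)); apply: mulr_ge0.
  - move=> x; rewrite big_ord1 /c unlift_none normrM normrM s1 mul1r normfV (gtr0_norm Bp).
    by rewrite mulrC ler_pdivrMr// mul1r.
  - move=> _ i; apply/hold_const_le => //.
    apply: hold_le (hold_scale _ (Fl i)).
    by rewrite /c liftK normfV gtr0_norm// mulVf// gt_eqF.
  by rewrite big_ord1 current_scale_all// cS invfM; congr _%:E; ring.
rewrite ler_norml; apply/andP; split.
  by rewrite lerNl -mulN1r H// normrN1.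
by rewrite -[T F]mul1r H// normr1.
Qed.

End Metric.

(** Bookkeeping for exchanging slots 0 and [j]: [l j] moves into the sup bound, and the constant of
    slot 0 takes its place. *)
Lemma prod_swap m (l : 'I_m.+1 -> R) j :
  l j * \prod_(k < m) dfwith l j (l ord0) (lift ord0 k) = \prod_k l k.
Proof.
rewrite big_ord_recl; case: (unliftP ord0 j) => [i|] ->; last by rewrite dfwith_id.
rewrite (bigD1 i)//= (bigD1 i (F := fun k => l (lift ord0 k)))//= dfwithin mulrCA.
congr (_ * (_ * _)); apply: eq_bigr => k ki.
by rewrite dfwithout// (inj_eq lift_inj) eq_sym.
Qed.

(** Moving [f] next to the leading 1 costs at most a sign, by alternation, and exhibits a value of
    the boundary with [f] in its first slot; the function displaced by [f] goes to slot [i]. *)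
Lemma boundary_slot n (T : functional X n.+1) K (i : 'I_n.+1) M B f
    (F : 'I_n.+2 -> X -> R) (l : 'I_n.+1 -> R) :
  metric_current T -> compact K -> vanishes_off (@lip_exp R n.+2) T K ->
  (mass (boundary T) <= M%:E)%E ->
  holder_tuple (@lip_exp R n.+2) F -> 0 <= B -> (forall x, `|f x| <= B * l i) -> holder 1 f ->
  (forall i, 0 <= l i) -> (forall i, hold 1 (l i) (F (lift ord0 i))) ->
  `|T (dfwith (dfwith F ord0 (fun=> 1)) (lift ord0 i) f)| <= M * B * \prod_i l i.
Proof.
move=> hT cK voff TM HF B0 fB fl l0 Fl.
have hB := boundary_current hT cK voff; have voffB := boundary_vanishes_off hT cK voff.
pose G := dfwith (dfwith (fun j : 'I_n.+1 => F (lift ord0 j)) i (F (lift ord0 ord0))) ord0 f.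
have lip1 : holder 1 ((fun=> 1) : X -> R) by apply: holder_cst.
have E : `|T (dfwith (dfwith F ord0 (fun=> 1)) (lift ord0 i) f)| = `|boundary T G|.
  have bE : boundary T G = T (dfwith (dfwith (dfwith F ord0 (fun=> 1)) (lift ord0 i) (F (lift ord0 ord0))) (lift ord0 ord0) f).
    rewrite /boundary; congr T; apply/funext => k; case: unliftP => [j|] ->.
      rewrite /G; have [->|j0] := eqVneq j ord0; first by rewrite !dfwithin.
      rewrite dfwithout 1?eq_sym// [RHS]dfwithout; last by rewrite (inj_eq lift_inj) eq_sym.
      have [->|ji] := eqVneq j i; first by rewrite !dfwithin.
      rewrite dfwithout 1?eq_sym// dfwithout; last by rewrite (inj_eq lift_inj) eq_sym.
      by rewrite dfwithout// neq_lift.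
    rewrite dfwithout 1?eq_sym ?neq_lift// dfwithout 1?eq_sym ?neq_lift//.
    by rewrite dfwithin.
  have [i0|i0] := eqVneq i ord0; first by rewrite bE i0 dfwithK.
  have lF1 : holder_tuple (@lip_exp R n.+2) (dfwith F ord0 (fun=> 1)) by exact: holder_tuple_with.
  rewrite bE (current_swap hT cK voff lF1 (HF _) fl i0) normrN.
  congr (`|T _|); apply/funext => k; have [->|k1] := eqVneq k (lift ord0 ord0).
    rewrite dfwithin dfwithout; last by rewrite (inj_eq lift_inj).
    by rewrite dfwithout.
  by rewrite [RHS]dfwithout// eq_sym.
rewrite E; have lipG : holder_tuple (@lip_exp R n.+1) G.
  by rewrite /G; apply: holder_tuple_with => //; apply: holder_tuple_with => [j|]; exact: HF.
have G0 : G ord0 = f by rewrite /G dfwithin.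
have Gl j : hold 1 (dfwith l i (l ord0) (lift ord0 j)) (G (lift ord0 j)).
  have -> : G (lift ord0 j) = dfwith (fun k : 'I_n.+1 => F (lift ord0 k)) i (F (lift ord0 ord0)) (lift ord0 j).
    by rewrite /G dfwithout ?neq_lift.
  have [<-|ij] := eqVneq i (lift ord0 j); first by rewrite !dfwithin.
  by rewrite !dfwithout.
have l'0 j : 0 <= dfwith l i (l ord0) j by case: dfwithP.
have G0B x : `|G ord0 x| <= B * l i by rewrite G0.
have := mass_bound hB cK voffB TM lipG (mulr_ge0 B0 (l0 i)) G0B (fun j => l'0 _) Gl.
by rewrite mulrA -[_ * l i * _]mulrA prod_swap.
Qed.

Lemma boundary_mass_slot n (T : functional X n) K (i : 'I_n) M B f
    (F : 'I_n.+1 -> X -> R) (l : 'I_n -> R) :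
  metric_current T -> compact K -> vanishes_off (@lip_exp R n.+1) T K ->
  (boundary_mass T <= M%:E)%E ->
  holder_tuple (@lip_exp R n.+1) F -> 0 <= B -> (forall x, `|f x| <= B * l i) -> holder 1 f ->
  (forall i, 0 <= l i) -> (forall i, hold 1 (l i) (F (lift ord0 i))) ->
  `|T (dfwith (dfwith F ord0 (fun=> 1)) (lift ord0 i) f)| <= M * B * \prod_i l i.
Proof. by case: n T i F l => [T []//|n T i F l]; apply: boundary_slot. Qed.

Section Normal.
Variables (n : nat) (T : functional X n) (K : set X) (M M' : R).
Hypotheses (hT : metric_current T) (cK : compact K) (voff : vanishes_off (@lip_exp R n.+1) T K).
Hypotheses (TM : (mass T <= M%:E)%E) (TM' : (boundary_mass T <= M'%:E)%E).
Implicit Types (F G : 'I_n.+1 -> X -> R).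

Local Notation lips := (holder_tuple (@lip_exp R n.+1)).
Local Notation l01 := (@lip_exp01 R n.+1).

Let M0 : 0 <= M. Proof. by rewrite -lee_fin (le_trans (mass_ge0 T)). Qed.
Let M'0 : 0 <= M'. Proof. by rewrite -lee_fin (le_trans (boundary_mass_ge0 T)). Qed.

(** The change of a normal current per unit of displacement, displacements being measured in
    multiples of the Lipschitz constants: the mass meets all constants, the boundary mass a sup
    bound of the first slot and the other constants. *)
Definition prod_weight (B : R) (l : 'I_n.+1 -> R) :=
  M * \prod_i l i + M' * B * \prod_(i < n) l (lift ord0 i).

(** In slot 0 this is the mass. In another slot the product rule trades T(f,..,h,..) for
    T(1,..,fh,..) - T(h,..,f,..), bounded by the boundary mass and by the mass. Only the size of [h]
    enters the bound, not its slope. *)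
Lemma slot_bound F (i : 'I_n.+1) h B e (l : 'I_n.+1 -> R) : 0 <= B -> 0 <= e ->
  lips F -> holder 1 h -> (forall i, 0 <= l i) -> (forall i, hold 1 (l i) (F i)) ->
  (forall x, `|F ord0 x| <= B) -> (forall x, `|h x| <= e * l i) ->
  `|T (dfwith F i h)| <= e * prod_weight B l.
Proof.
move=> B0 e0 HF Hh l0 Fl FB hB; rewrite /prod_weight mulrDr.
have P0 : 0 <= e * (M * \prod_i l i) by rewrite !mulr_ge0 ?prodr_ge0.
have P'0 : 0 <= e * (M' * B * \prod_(i < n) l (lift ord0 i)) by rewrite !mulr_ge0 ?prodr_ge0.
case: (unliftP ord0 i) => [j|] ij; last first.
  apply: ler_wpDr => //; rewrite ij in hB *.
  have := @mass_bound _ T K hT cK voff M (e * l ord0) (fun j => l (lift ord0 j)) (dfwith F ord0 h) TM.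
  rewrite big_ord_recl => H; apply: le_trans (H _ _ _ _ _) _ => //.
  - exact: holder_tuple_with.
  - exact: mulr_ge0.
  - by rewrite dfwithin.
  - by move=> k; rewrite dfwithout ?neq_lift.
  by rewrite le_eqVlt; apply/orP; left; apply/eqP; ring.
have bF : blip (F ord0) by apply: (blipP B0 (l0 ord0)).
have bh : blip h.
  have [L L0 hL] := (holderP _ ltr01).1 Hh.
  by apply: (blipP (B := e * l i) _ L0) => //; apply: mulr_ge0.
have := product_rule hT cK voff j HF bF bh.
rewrite dfwith_id -ij => E.
have -> : T (dfwith F i h) = T (dfwith (dfwith F ord0 (fun=> 1)) i (fun x => F ord0 x * h x)) -
  T (dfwith (dfwith F ord0 h) i (F ord0)) by rewrite E addrK.
rewrite (le_trans (ler_normB _ _))// addrC lerD//.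
  have Hl k : 0 <= dfwith l i (l ord0) k by case: dfwithP.
  have := @mass_bound _ T K hT cK voff M (e * l i) (fun j => dfwith l i (l ord0) (lift ord0 j))
    (dfwith (dfwith F ord0 h) i (F ord0)) TM.
  move=> H; apply: le_trans (H _ _ _ _ _) _ => //.
  - by apply: holder_tuple_with; [exact: holder_tuple_with|exact: HF].
  - exact: mulr_ge0.
  - by rewrite ij dfwithout 1?eq_sym ?neq_lift// dfwithin -ij.
  - move=> k; have [<-|ik] := eqVneq i (lift ord0 k); first by rewrite !dfwithin.
    by rewrite !dfwithout ?neq_lift.
  by rewrite mulrA -[_ * l i * _]mulrA prod_swap mulrA -!mulrA mulrCA.
have := @boundary_mass_slot _ T K j M' (B * e) (fun x => F ord0 x * h x) F (fun j => l (lift ord0 j)) hT cK voff TM' HF.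
rewrite -ij => H; apply: le_trans (H _ _ _ _ _) _ => //.
- exact: mulr_ge0.
- by move=> x; rewrite normrM -mulrA; apply: ler_pM.
- by apply: blip_lip; apply: blip_mul.
by rewrite le_eqVlt; apply/orP; left; apply/eqP; ring.
Qed.

Lemma normal_dist F G B e (l : 'I_n.+1 -> R) : 0 <= B -> 0 <= e -> (forall i, 0 <= l i) ->
  (forall i, hold 1 (l i) (F i)) -> (forall i, hold 1 (l i) (G i)) ->
  (forall x, K x -> `|F ord0 x| <= B) -> (forall x, K x -> `|G ord0 x| <= B) ->
  (forall i x, `|F i x - G i x| <= e * l i) ->
  `|T F - T G| <= n.+1%:R * (e * prod_weight B l).
Proof.
move=> B0 e0 l0 Fl Gl FB GB FG.
(* The sup bounds are given on [K] only. Clamping the first slot makes them global, leaves both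
   values of [T] unchanged, and preserves the remaining estimates because [clamp] is 1-Lipschitz. *)
wlog [FB' GB'] : F G Fl Gl FB GB FG / (forall x, `|F ord0 x| <= B) /\ (forall x, `|G ord0 x| <= B).
  have lc (H : 'I_n.+1 -> X -> R) : (forall i, hold 1 (l i) (H i)) ->
      forall i, hold 1 (l i) (dfwith H ord0 (fun x => clamp B (H ord0 x)) i).
    move=> Hl i; case: dfwithP => [|//]; rewrite -[l ord0]mul1r; apply: hold_comp => // s t.
    exact: clamp_lip.
  have HH (H : 'I_n.+1 -> X -> R) : (forall i, hold 1 (l i) (H i)) -> lips H.
    by move=> Hl i; apply: (hold_holder ltr01 (l0 i)).
  have Kc H : (forall i, hold 1 (l i) (H i)) -> (forall x, K x -> `|H ord0 x| <= B) ->
      T H = T (dfwith H ord0 (fun x => clamp B (H ord0 x))).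
    move=> Hl HB; apply: (current_eq_on_compact l01 hT voff cK) => [||i x Kx].
    - exact: HH.
    - exact: (HH _ (lc _ Hl)).
    by case: dfwithP => [|//]; rewrite clamp_id// HB.
  move=> W; rewrite (Kc F)// (Kc G)//; apply: W.
  - exact: lc.
  - exact: lc.
  - by move=> x _; rewrite dfwithin clamp_norm.
  - by move=> x _; rewrite dfwithin clamp_norm.
  - move=> i x; have [<-|i0] := eqVneq ord0 i; last by rewrite !dfwithout.
    by rewrite !dfwithin (le_trans (clamp_lip _ _ B0))// mul1r.
  by split=> x; rewrite dfwithin clamp_norm.
apply: hybrid_dist => H i HFG.
have Hl k : hold 1 (l k) (H k) by case: (HFG k) => ->.
have HH : lips H by move=> k; apply: (hold_holder ltr01 (l0 k)).
have HF k : holder 1 (F k) by apply: (hold_holder ltr01 (l0 k)).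
have HG k : holder 1 (G k) by apply: (hold_holder ltr01 (l0 k)).
rewrite -(currentB hT)//; apply: slot_bound => //; first exact: holderB.
by case: (HFG ord0) => ->.
Qed.

End Normal.

End MassBounds.

(** * Extension of normal currents *)

Section RealLimits.
Context {R : realType}.
Implicit Types (a e d : R).

Lemma powR_small a L d : 0 < a -> 0 <= L -> 0 < d ->
  \forall e \near 0^'+, L * e `^ a <= d.
Proof.
move=> a0 L0 d0; near=> e.
have e0 : 0 < e by near: e; apply: nbhs_right_gt.
apply: (@le_trans _ _ ((L + 1) * ((d / (L + 1)) `^ a^-1) `^ a)).
  rewrite ler_pM ?powR_ge0//; first lra.
  rewrite ge0_ler_powR ?nnegrE ?powR_ge0 ?ltW//.
  by near: e; apply: nbhs_right_lt; rewrite powR_gt0// divr_gt0//; lra.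
rewrite -powRrM mulVf ?gt_eqF// powRr1 ?divr_ge0//; try lra.
by rewrite mulrCA divff ?mulr1//; lra.
Unshelve. all: by end_near. Qed.

Lemma halving_near e (P : set R) : 0 < e -> (\forall d \near 0^'+, P d) ->
  \forall j \near \oo, P (e / 2 ^+ j).
Proof.
move=> e0 [r/= r0 rP].
have /cvgrPdist_lt/(_ _ r0) : (fun j => e / 2 ^+ j) @ \oo --> 0.
  under eq_fun do rewrite -exprVn.
  by apply: cvg_geometric; rewrite ger0_norm ?invr_ge0// invf_lt1// ltr1n.
by apply: filterS => j ?; apply: rP => //; rewrite divr_gt0 ?exprn_gt0.
Qed.

Lemma cvg_dist_le (u : nat -> R) l c b :
  u @ \oo --> l -> (forall k, `|u k - c| <= b) -> `|l - c| <= b.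
Proof.
move=> ul ub; have H : (fun k => `|u k - c|) @ \oo --> `|l - c|.
  by apply: cvg_norm; apply: cvgB => //; apply: cvg_cst.
rewrite -(cvg_lim _ H)//; apply: limr_le; first by apply/cvg_ex; exists `|l - c|.
by apply: nearW.
Qed.

Lemma prod_powR m e (b : 'I_m -> R) : 0 < e ->
  \prod_i e `^ (b i) = e `^ (\sum_i b i).
Proof.
move=> e0; elim/big_ind2: _ => [|x1 x2 y1 y2 -> ->|//]; first by rewrite powRr0.
by rewrite powRD// (gt_eqF e0) implybT.
Qed.

Lemma powR_le_base a d e : 0 <= a -> 0 <= d -> d <= e -> d `^ a <= e `^ a.
Proof.
by move=> a0 d0 de; apply: ge0_ler_powR; rewrite ?nnegrE//; apply: le_trans de.
Qed.

Lemma powR_le1 a e : 0 <= a -> 0 <= e -> e <= 1 -> e `^ a <= 1.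
Proof. by move=> a0 e0 /(powR_le_base a0 e0); rewrite powR1. Qed.

Lemma powR_le_exp e p q : 0 < e -> e <= 1 -> p <= q -> e `^ q <= e `^ p.
Proof.
move=> e0 e1 pq; rewrite -[q](subrK p) powRD ?(gt_eqF e0) ?implybT//.
by rewrite ler_piMl ?powR_ge0// powR_le1 ?subr_ge0// ltW.
Qed.

End RealLimits.

Section Extension.
Context {R : realType} {X : metricType R}.
Variables (n : nat) (gamma : R) (alpha : 'I_n.+1 -> R).
Hypotheses (hgamma : n%:R < gamma) (halpha : forall i, 0 < alpha i <= 1)
  (hsum : gamma <= \sum_(i < n.+1) alpha i).
Implicit Types (F G : 'I_n.+1 -> X -> R) (L : 'I_n.+1 -> R).

Local Notation lips := (holder_tuple (@lip_exp R n.+1)).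
Local Notation l01 := (@lip_exp01 R n.+1).

Let alpha0 i : 0 < alpha i. Proof. by have /andP[] := halpha i. Qed.
Let alpha1 i : alpha i <= 1. Proof. by have /andP[] := halpha i. Qed.

Definition tail_sum := \sum_(i < n) alpha (lift ord0 i).

Definition appr_tuple L e F : 'I_n.+1 -> X -> R :=
  fun i => appr (L i * e `^ (alpha i - 1)) (F i).

Definition tuple_hold L F := forall i, hold (alpha i) (L i) (F i).

(** At scale [e] the slopes are [L i e^(alpha i - 1)] and the displacements [e] times the slopes. So
    [e] times all n+1 slopes gives the exponent [sum - n], and [e] times the last n slopes gives
    [tail - (n - 1)]. For [e <= 1] the first approximant is bounded by [B + L ord0]. *)
Definition appr_error (M M' B : R) L e :=
  M * \prod_i L i * e `^ (\sum_i alpha i - n%:R) +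
  M' * (B + L ord0) * \prod_(i < n) L (lift ord0 i) * e `^ (tail_sum - (n%:R - 1)).

(** The number of slots, times a factor 2 for each slope, times the sum of a geometric series of
    ratio [2^-(gamma - n)]. *)
Definition ext_const := n.+1%:R * 2 ^+ n.+1 / (1 - 2^-1 `^ (gamma - n%:R)).

Let ratio_lt1 : 2^-1 `^ (gamma - n%:R) < 1 :> R.
Proof.
have E : 1 `^ (gamma - n%:R) = 1 :> R by rewrite powR1.
by rewrite -[ltRHS]E; apply: gt0_ltr_powR; rewrite ?nnegrE ?subr_gt0 ?invf_lt1 ?ltr1n.
Qed.

Lemma ext_const_ge0 : 0 <= ext_const.
Proof.
apply: divr_ge0; first by apply: mulr_ge0 => //; apply: exprn_ge0.
by rewrite subr_ge0 ltW.
Qed.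

(** Dropping the first exponent loses at most 1, so both terms of the error decay at least at the
    rate [gamma - n]. *)
Lemma tail_sum_ge : gamma - n%:R <= tail_sum - (n%:R - 1).
Proof.
have := hsum; rewrite big_ord_recl -/tail_sum; have := alpha1 ord0; lra.
Qed.

Lemma appr_error_ge0 M M' B L e : 0 <= M -> 0 <= M' -> 0 <= B -> (forall i, 0 <= L i) ->
  0 <= appr_error M M' B L e.
Proof.
move=> M0 M'0 B0 L0.
by rewrite addr_ge0 ?mulr_ge0 ?powR_ge0 ?prodr_ge0 ?addr_ge0.
Qed.

Lemma appr_error_half M M' B L e : 0 <= M -> 0 <= M' -> 0 <= B -> (forall i, 0 <= L i) ->
  0 < e ->
  appr_error M M' B L (e / 2) <= 2^-1 `^ (gamma - n%:R) * appr_error M M' B L e.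
Proof.
move=> M0 M'0 B0 L0 e0; rewrite /appr_error [leRHS]mulrDr.
have H p : gamma - n%:R <= p -> (e / 2) `^ p <= 2^-1 `^ (gamma - n%:R) * e `^ p.
  move=> hp; rewrite powRM ?invr_ge0 ?(ltW e0)// mulrC ler_wpM2r ?powR_ge0//.
  by apply: powR_le_exp => //; rewrite ?invr_gt0// invf_le1// ler1n.
apply: lerD; rewrite mulrCA ler_wpM2l ?mulr_ge0 ?prodr_ge0 ?addr_ge0 ?H ?tail_sum_ge//.
exact: lerB.
Qed.

Lemma appr_error_small M M' B L d : 0 <= M -> 0 <= M' -> 0 <= B -> (forall i, 0 <= L i) ->
  0 < d -> \forall e \near 0^'+, appr_error M M' B L e <= d.
Proof.
move=> M0 M'0 B0 L0 d0; have p0 : 0 < gamma - n%:R by rewrite subr_gt0.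
near=> e; rewrite (splitr d) lerD//; near: e; apply: powR_small;
  rewrite ?divr_gt0 ?mulr_ge0 ?prodr_ge0 ?addr_ge0//.
- by apply: lt_le_trans p0 _; exact: lerB.
- exact: lt_le_trans p0 tail_sum_ge.
Unshelve. all: by end_near. Qed.

Section ApprTuple.
Variables (L : 'I_n.+1 -> R) (F : 'I_n.+1 -> X -> R).
Hypotheses (L0 : forall i, 0 <= L i) (FL : tuple_hold L F).

Lemma appr_tuple_lip e : 0 < e -> lips (appr_tuple L e F).
Proof.
move=> e0 i; apply: (hold_holder ltr01 _ (appr_lip (halpha i) (L0 i) e0 (FL i))).
by rewrite mulr_ge0 ?powR_ge0.
Qed.

Lemma appr_tuple_hold e : 0 < e -> tuple_hold (fun i => 3 * L i) (appr_tuple L e F).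
Proof. by move=> e0 i; apply: (appr_hold (halpha i) (L0 i) e0 (FL i)). Qed.

Lemma appr_tuple_near d : 0 < d ->
  \forall e \near 0^'+, forall i x, `|appr_tuple L e F i x - F i x| <= d.
Proof.
move=> d0; apply: filter_forall => i; near=> e => x.
have e0 : 0 < e by near: e; apply: nbhs_right_gt.
apply: le_trans (appr_near (halpha i) (L0 i) e0 (FL i) x) _.
by near: e; apply: powR_small.
Unshelve. all: by end_near. Qed.

End ApprTuple.

Section Normal.
Variables (T : functional X n) (K : set X) (M M' : R).
Hypotheses (hT : metric_current T) (cK : compact K) (voff : vanishes_off (@lip_exp R n.+1) T K).
Hypotheses (TM : (mass T <= M%:E)%E) (TM' : (boundary_mass T <= M'%:E)%E).

Let M0 : 0 <= M. Proof. by rewrite -lee_fin (le_trans (mass_ge0 T)). Qed.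
Let M'0 : 0 <= M'. Proof. by rewrite -lee_fin (le_trans (boundary_mass_ge0 T)). Qed.

Section Estimates.
Variables (L : 'I_n.+1 -> R) (F : 'I_n.+1 -> X -> R) (B : R).
Hypotheses (L0 : forall i, 0 <= L i) (FL : tuple_hold L F) (B0 : 0 <= B)
  (FB : forall x, K x -> `|F ord0 x| <= B).

Lemma appr_tuple_bound e x : 0 < e <= 1 -> K x ->
  `|appr_tuple L e F ord0 x| <= B + L ord0.
Proof.
move=> /andP[e0 e1] Kx; rewrite -[appr_tuple _ _ _ _ x](subrK (F ord0 x)) addrC.
rewrite (le_trans (ler_normD _ _))// lerD ?FB//.
apply: le_trans (appr_near (halpha ord0) (L0 ord0) e0 (FL ord0) x) _.
by rewrite -[leRHS]mulr1 ler_wpM2l// powR_le1// ltW.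
Qed.

Let halving e : 0 < e <= 1 ->
  `|T (appr_tuple L (e / 2) F) - T (appr_tuple L e F)| <=
    n.+1%:R * 2 ^+ n.+1 * appr_error M M' B L e.
Proof.
(* The factor 2 serves twice: halving the scale at most doubles the slopes, and two approximants,
   each within [L i e^(alpha i)] of [F i], are within [e * l i] of each other. *)
move=> /andP[e0 e1]; pose l i := 2 * (L i * e `^ (alpha i - 1)).
have e20 : 0 < e / 2 by rewrite divr_gt0.
have e2e : e / 2 <= e by rewrite ler_pdivrMr// ler_peMr ?ler1n// ltW.
have l0 i : 0 <= l i by rewrite !mulr_ge0 ?powR_ge0.
have ele i : e * l i = 2 * (L i * e `^ alpha i).
  by rewrite /l (powRB1 (alpha i) e0); ring.
have half_pow i : (e / 2) `^ (alpha i - 1) <= 2 * e `^ (alpha i - 1).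
  have : (e / 2) `^ alpha i <= e `^ alpha i.
    by apply: powR_le_base => //; exact: ltW.
  rewrite (powRB1 (alpha i) e0) (powRB1 (alpha i) e20).
  move=> H; rewrite -(ler_pM2r e20); apply: le_trans H _.
  by rewrite le_eqVlt; apply/orP; left; apply/eqP; field.
have := @normal_dist _ _ _ T K M M' hT cK voff TM TM'
   (appr_tuple L (e / 2) F) (appr_tuple L e F) (B + L ord0) e l.
move=> H; apply: le_trans (H _ _ _ _ _ _ _ _) _.
- exact: addr_ge0.
- exact: ltW.
- exact: l0.
- move=> i; apply: hold_le (appr_lip (halpha i) (L0 i) e20 (FL i)).
  by rewrite /l mulrCA ler_wpM2l.
- move=> i; apply: hold_le (appr_lip (halpha i) (L0 i) e0 (FL i)).
  by rewrite /l ler_peMl ?ler1n// mulr_ge0 ?powR_ge0.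
- by move=> x Kx; apply: appr_tuple_bound => //; rewrite e20 (le_trans e2e).
- by move=> x Kx; apply: appr_tuple_bound => //; rewrite e0.
- move=> i x; rewrite ele.
  have H1 := appr_near (halpha i) (L0 i) e20 (FL i) x.
  have H2 := appr_near (halpha i) (L0 i) e0 (FL i) x.
  have H3 : L i * (e / 2) `^ alpha i <= L i * e `^ alpha i.
    by rewrite ler_wpM2l//; apply: powR_le_base => //; exact: ltW.
  by move: H1 H2 H3; rewrite /appr_tuple !ler_norml; lra.
rewrite -mulrA ler_wpM2l// /prod_weight /appr_error /l.
rewrite !big_split /= !prodr_const !card_ord !prod_powR// !sumrB !sumr_const !card_ord.
set p := \sum_i alpha i; set P := \prod_i L i; set P' := \prod_(i < n) _.
have E1 : e * e `^ (p - 1 *+ n.+1) = e `^ (p - n%:R).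
  rewrite -{1}(powRr1 (ltW e0)) -powRD ?(gt_eqF e0) ?implybT//; congr (_ `^ _).
  by rewrite -natr1; ring.
have E2 : e * e `^ (tail_sum - 1 *+ n) = e `^ (tail_sum - (n%:R - 1)).
  rewrite -{1}(powRr1 (ltW e0)) -powRD ?(gt_eqF e0) ?implybT//; congr (_ `^ _).
  by ring.
rewrite -/tail_sum -E1 -E2 mulrDr [leRHS]mulrDr; apply: lerD.
  by rewrite le_eqVlt; apply/orP; left; apply/eqP; ring.
have -> : e * (M' * (B + L ord0) * (2 ^+ n * (P' * e `^ (tail_sum - 1 *+ n)))) =
  2 ^+ n * (M' * (B + L ord0) * P' * (e * e `^ (tail_sum - 1 *+ n))) by ring.
rewrite ler_wpM2r ?mulr_ge0 ?addr_ge0 ?prodr_ge0 ?powR_ge0 ?(ltW e0)//.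
by rewrite exprS ler_peMl ?exprn_ge0// ler1n.
Qed.

(** The first halving is split off and the rest starts at [e / 2]. The bound reproduces itself
    because [C r + (n+1) 2^(n+1) = C] for the ratio [r] and [C] the geometric constant. *)
Lemma appr_tuple_halving e j : 0 < e <= 1 ->
  `|T (appr_tuple L (e / 2 ^+ j) F) - T (appr_tuple L e F)| <=
    ext_const * appr_error M M' B L e.
Proof.
elim: j e => [|j IH] e e01.
  by rewrite expr0 divr1 subrr normr0 mulr_ge0 ?ext_const_ge0 ?appr_error_ge0.
have /andP[e0 e1] := e01.
have e20 : 0 < e / 2 <= 1.
  by rewrite divr_gt0//= ler_pdivrMr// mul1r (le_trans e1)// ler1n.
have -> : e / 2 ^+ j.+1 = (e / 2) / 2 ^+ j by rewrite exprS invfM mulrA.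
set u := T (appr_tuple L (e / 2) F).
have -> : T (appr_tuple L (e / 2 / 2 ^+ j) F) - T (appr_tuple L e F) =
  (T (appr_tuple L (e / 2 / 2 ^+ j) F) - u) + (u - T (appr_tuple L e F)) by ring.
apply: le_trans (ler_normD _ _) _; apply: le_trans (lerD (IH _ e20) (halving e01)) _.
have H := ler_wpM2l ext_const_ge0 (appr_error_half M0 M'0 B0 L0 e0).
apply: le_trans (lerD H (lexx _)) _; rewrite mulrA -mulrDl.
suff -> : ext_const * 2^-1 `^ (gamma - n%:R) + n.+1%:R * 2 ^+ n.+1 = ext_const by [].
rewrite /ext_const; set r := 2^-1 `^ _; have r1 : 1 - r != 0.
  by rewrite gt_eqF// subr_gt0.
by field.
Qed.

Lemma appr_tuple_lip_dist e : lips F -> 0 < e <= 1 ->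
  `|T F - T (appr_tuple L e F)| <= ext_const * appr_error M M' B L e.
Proof.
move=> HF e01; have /andP[e0 e1] := e01.
have [L' L'0 FL'] := (holder_tupleP l01 F).1 HF.
apply: (@cvg_dist_le _ (fun j => T (appr_tuple L (e / 2 ^+ j) F))); last first.
  by move=> j; apply: appr_tuple_halving.
have ej j : 0 < e / 2 ^+ j by rewrite divr_gt0 ?exprn_gt0.
apply: (current_cvg l01 hT L'0 HF) => [i d d0|k i].
  have := halving_near e0 (appr_tuple_near L0 FL d0).
  by apply: filterS => j; apply.
(* Either the slope is at least [L'] and the approximant is [F i] itself, or it is below [L']. In
   both cases [L'] is a common Lipschitz constant, so the continuity of [T] as a metric current
   applies. *)
have [Ls|Ls] := leP L' (L i * (e / 2 ^+ k) `^ (alpha i - 1)).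
  by rewrite /appr_tuple (appr_id (halpha i) (L0 i) (ej k) (FL i) (FL' i) Ls).
by apply: hold_le (appr_lip (halpha i) (L0 i) (ej k) (FL i)); apply: ltW.
Qed.

End Estimates.

(** The uniform bound concerns the Hoelder constants; the Lipschitz constants may blow up.
    Convergence of [T] along such a sequence is therefore not an instance of its continuity. *)
Definition approximates (Fk : nat -> 'I_n.+1 -> X -> R) F :=
  [/\ forall k, lips (Fk k),
      (exists2 L, 0 <= L & forall k, tuple_hold (fun=> L) (Fk k)) &
      forall i, uconv (fun k => Fk k i) (F i)].

Lemma uconv_harmonic (fk : nat -> X -> R) f :
  (forall k x, `|fk k x - f x| <= k.+1%:R^-1) -> uconv fk f.
Proof. by move=> H; apply: (@uconv_near _ _ _ _ 1) => k x; rewrite mulr1. Qed.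

Lemma lip_approximation L F d : (forall i, 0 <= L i) -> tuple_hold L F -> 0 < d ->
  exists G, [/\ lips G, tuple_hold (fun i => 3 * L i) G &
    forall i x, `|G i x - F i x| <= d].
Proof.
move=> L0 FL d0.
have : \forall e \near 0^'+, 0 < e /\ forall i x, `|appr_tuple L e F i x - F i x| <= d.
  by near=> e; split; near: e; [apply: nbhs_right_gt|apply: appr_tuple_near].
move=> /filter_ex[e [e0 He]]; exists (appr_tuple L e F); split=> //.
- exact: appr_tuple_lip.
- exact: appr_tuple_hold.
Unshelve. all: by end_near. Qed.

Lemma approximates_harmonic F : holder_tuple alpha F -> exists (L : R) Fk,
  [/\ 0 <= L, forall k, lips (Fk k), forall k, tuple_hold (fun=> L) (Fk k) &
      forall k i x, `|Fk k i x - F i x| <= k.+1%:R^-1].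
Proof.
move=> /(holder_tupleP halpha)[L L0 FL].
have H (k : nat) : exists G, [/\ lips G, tuple_hold (fun i => 3 * L) G &
    forall i x, `|G i x - F i x| <= k.+1%:R^-1].
  by apply: (@lip_approximation (fun=> L)) => //; rewrite invr_gt0.
have [Fk HFk] := choice H; exists (3 * L), Fk; split.
- by rewrite mulr_ge0.
- by move=> k; have [] := HFk k.
- by move=> k; have [] := HFk k.
- by move=> k; have [] := HFk k.
Qed.

Lemma approximates_exists F : holder_tuple alpha F -> exists Fk, approximates Fk F.
Proof.
move=> /approximates_harmonic[L [Fk [L0 Fl FL FF]]]; exists Fk; split=> //; first by exists L.
by move=> i; apply: uconv_harmonic.
Qed.

Lemma uconv_hold a (L : R) (fk : nat -> X -> R) f : (forall k, hold a L (fk k)) -> uconv fk f ->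
  hold a L f.
Proof.
move=> fL ff x y; apply/ler_addgt0Pr => e e0.
have /filter_ex[k Hk] := ff (e / 2) (divr_gt0 e0 (ltr0n _ 2)).
have := Hk x; have := Hk y; have := fL k x y.
rewrite !ler_norml; lra.
Qed.

(* All admissible approximations are eventually close to the value at one fixed
   scale, so the limit depends neither on the sequence nor on its constants. *)
Let approx_value (L : R) F : 0 <= L -> holder_tuple alpha F ->
  forall d, 0 < d -> exists c, forall Fk, (forall k, lips (Fk k)) ->
    (forall k, tuple_hold (fun=> L) (Fk k)) -> (forall i, uconv (fun k => Fk k i) (F i)) ->
    \forall k \near \oo, `|T (Fk k) - c| <= d.
Proof.
move=> L0 HF d d0; have [L1 L10 FL1] := (holder_tupleP halpha F).1 HF.
have [B B0 FB] := hold_bounded_compact (alpha0 ord0) L10 (FL1 ord0) cK.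
have Lc (i : 'I_n.+1) : 0 <= (fun=> L) i by [].
have B10 : 0 <= B + 1 by rewrite addr_ge0.
have d2 : 0 < d / 2 by rewrite divr_gt0.
have C0 : 0 < ext_const + 1 by rewrite ltr_wpDl// ext_const_ge0.
have : \forall e \near 0^'+, 0 < e <= 1 /\ appr_error M M' (B + 1) (fun=> L) e <= d / 2 / (ext_const + 1).
  near=> e; split; last by near: e; apply: appr_error_small; rewrite ?divr_gt0.
  by apply/andP; split; near: e; [apply: nbhs_right_gt|apply: nbhs_right_le].
move=> /filter_ex[e [e01 He]]; have /andP[e0 e1] := e01.
have {}He : ext_const * appr_error M M' (B + 1) (fun=> L) e <= d / 2.
  apply: le_trans (ler_wpM2l ext_const_ge0 He) _.
  rewrite mulrA ler_pdivrMr// mulrC ler_pM2l// lerDl//.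
exists (T (appr_tuple (fun=> L) e F)) => Fk Fl FL Fu.
have FL' : tuple_hold (fun=> L) F by move=> i; apply: (uconv_hold (fun k => FL k i) (Fu i)).
(* At the fixed scale [e] the smoothing is nonexpansive and its slope is fixed, so the continuity of
   the metric current applies to the smoothed sequence. *)
have /cvgrPdist_le/(_ _ d2) : (fun k => T (appr_tuple (fun=> L) e (Fk k))) @ \oo --> T (appr_tuple (fun=> L) e F).
  apply: (@current_cvg _ _ _ _ _ l01 hT _ _ (\sum_i L * e `^ (alpha i - 1))).
  - by apply: sumr_ge0 => i _; rewrite mulr_ge0 ?powR_ge0.
  - exact: appr_tuple_lip.
  - move=> i a a0'; apply: filterS (Fu i a a0') => k Hk.
    exact: (appr_dist (halpha i) L0 e0 (FL' i) (FL k i) Hk).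
  move=> k i; apply: hold_le (appr_lip (halpha i) L0 e0 (FL k i)).
  by rewrite (bigD1 i)//= lerDl; apply: sumr_ge0 => j _; rewrite mulr_ge0 ?powR_ge0.
apply: filter_app; have := Fu ord0 1 ltr01; apply: filterS => k FkB Hk.
have FkB' x : K x -> `|Fk k ord0 x| <= B + 1.
  move=> Kx; rewrite -[Fk k ord0 x](subrK (F ord0 x)) addrC.
  by rewrite (le_trans (ler_normD _ _))// lerD ?FB.
rewrite (splitr d) (le_trans (ler_distD (T (appr_tuple (fun=> L) e (Fk k))) _ _))//.
rewrite lerD//; last by rewrite distrC.
exact: le_trans (appr_tuple_lip_dist Lc (FL k) B10 FkB' (Fl k) e01) He.
Unshelve. all: by end_near. Qed.

(** A limit along some admissible sequence; for Hoelder tuples [ext_cvg] shows that it exists and is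
    the same for all of them. The default 0 is the value when there is no such limit. *)
Definition ext F : R :=
  xget 0 [set v | exists2 Fk, approximates Fk F & (fun k => T (Fk k)) @ \oo --> v].

(** For every tolerance, all sequences with a common Hoelder constant end near one number. For one
    sequence this is the Cauchy property; for two, with the larger of their constants, it is the
    equality of the limits. *)
Lemma ext_cvg Fk F : holder_tuple alpha F -> approximates Fk F ->
  (fun k => T (Fk k)) @ \oo --> ext F.
Proof.
move=> HF HFk.
have cv Gk : approximates Gk F -> cvgn (fun k => T (Gk k)).
  move=> [Gl [L L0 GL] Gu]; apply/cauchy_cvgP/cauchyP => d d0.
  have [|c Hc] := approx_value L0 HF (_ : 0 < d / 2); first by rewrite divr_gt0.
  exists c; apply: filterS (Hc _ Gl GL Gu) => k Hk; rewrite /ball/= distrC.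
  by apply: le_lt_trans Hk _; rewrite ltr_pdivrMr// ltr_pMr// ltr1n.
rewrite /ext; case: xgetP => [v _ [Gk HGk Gv]|/(_ (limn (fun k => T (Fk k))))]; last first.
  by move=> H; exfalso; apply: H; exists Fk => //; apply: cv.
have /cvg_ex[/= w Fw] := cv _ HFk.
suff <- : w = v by [].
apply/eqP; rewrite -subr_eq0 -normr_le0; apply/ler_addgt0Pr => d d0; rewrite add0r.
have [Fl [L L0 FL] Fu] := HFk; have [Gl [L' L'0 GL] Gu] := HGk.
have d4 : 0 < d / 4 by rewrite divr_gt0.
have [|c Hc] := @approx_value (Num.max L L') F _ HF (d / 4) d4.
  by rewrite le_max L0.
have F1 := Hc Fk Fl (fun k i => hold_le (_ : L <= Num.max L L') (FL k i)) Fu.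
have G1 := Hc Gk Gl (fun k i => hold_le (_ : L' <= Num.max L L') (GL k i)) Gu.
have {}F1 := F1 (ltac:(by rewrite le_max lexx)).
have {}G1 := G1 (ltac:(by rewrite le_max lexx orbT)).
have /cvgrPdist_le/(_ _ d4) Fw' := Fw; have /cvgrPdist_le/(_ _ d4) Gv' := Gv.
near \oo => k.
have H1 : `|T (Fk k) - c| <= d / 4 by near: k.
have H2 : `|T (Gk k) - c| <= d / 4 by near: k.
have H3 : `|w - T (Fk k)| <= d / 4 by near: k.
have H4 : `|v - T (Gk k)| <= d / 4 by near: k.
by move: H1 H2 H3 H4; rewrite !ler_norml; lra.
Unshelve. all: by end_near. Qed.

Lemma ext_cst F : holder_tuple alpha F -> lips F -> ext F = T F.
Proof.
move=> HF Fl; have [L L0 FL] := (holder_tupleP halpha F).1 HF.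
have A : approximates (fun=> F) F.
  by split=> //; [exists L|move=> i; apply: uconv_cst].
by have /cvg_lim <- // := ext_cvg HF A; apply: lim_cst.
Qed.

Lemma ext_dist L F B e : (forall i, 0 <= L i) -> tuple_hold L F -> 0 <= B ->
  (forall x, K x -> `|F ord0 x| <= B) -> 0 < e <= 1 ->
  `|ext F - T (appr_tuple L e F)| <= ext_const * appr_error M M' B L e.
Proof.
move=> L0 FL B0 FB e01; have /andP[e0 _] := e01.
have ej j : 0 < e / 2 ^+ j by rewrite divr_gt0 ?exprn_gt0.
apply: (@cvg_dist_le _ (fun j => T (appr_tuple L (e / 2 ^+ j) F))); last first.
  by move=> j; apply: appr_tuple_halving.
apply: ext_cvg; first by move=> i; apply: (hold_holder (alpha0 i) (L0 i)).
split=> [k||i d d0]; first exact: appr_tuple_lip.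
  exists (\sum_i 3 * L i); first by apply: sumr_ge0 => i _; rewrite mulr_ge0.
  move=> k i; apply: hold_le (appr_tuple_hold L0 FL (ej k) i).
  by rewrite (bigD1 i)//= lerDl; apply: sumr_ge0 => j _; rewrite mulr_ge0.
have := halving_near e0 (appr_tuple_near L0 FL d0).
by apply: filterS => j; apply.
Qed.

Let approximates_with Fk F i gk g (L : R) : approximates Fk F -> 0 <= L ->
  (forall k, holder 1 (gk k)) -> (forall k, hold (alpha i) L (gk k)) -> uconv gk g ->
  approximates (fun k => dfwith (Fk k) i (gk k)) (dfwith F i g).
Proof.
move=> [Fl [L' L'0 FL] Fu] L0 gl gL gu; split.
- by move=> k; apply: holder_tuple_with.
- exists (L' + L); first exact: addr_ge0.
  move=> k j; case: dfwithP => [|j' _]; first by apply: hold_le (gL k); rewrite lerDr.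
  by apply: hold_le (FL k _); rewrite lerDl.
- exact: uconv_dfwith.
Qed.

Let approx_slot a f : 0 < a <= 1 -> holder a f -> exists (L : R) (gk : nat -> X -> R),
  [/\ 0 <= L, forall k, holder 1 (gk k), forall k, hold a L (gk k) &
      forall k x, `|gk k x - f x| <= k.+1%:R^-1].
Proof.
move=> a01 Hf; have /andP[a0 a1] := a01; have [L L0 fL] := (holderP _ a0).1 Hf.
have H (k : nat) : exists g, [/\ holder 1 g, hold a (3 * L) g & forall x, `|g x - f x| <= k.+1%:R^-1].
  have : \forall e \near 0^'+, 0 < e /\ L * e `^ a <= k.+1%:R^-1.
    near=> e; split; near: e; first exact: nbhs_right_gt.
    by apply: powR_small; rewrite ?invr_gt0.
  move=> /filter_ex[e [e0 He]]; exists (appr (L * e `^ (a - 1)) f); split.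
  - by apply: (hold_holder ltr01 _ (appr_lip a01 L0 e0 fL)); rewrite mulr_ge0 ?powR_ge0.
  - exact: appr_hold.
  - by move=> x; apply: le_trans (appr_near a01 L0 e0 fL x) He.
have [gk Hgk] := choice H; exists (3 * L), gk; split.
- by rewrite mulr_ge0.
- by move=> k; have [] := Hgk k.
- by move=> k; have [] := Hgk k.
- by move=> k; have [] := Hgk k.
Unshelve. all: by end_near. Qed.

(* Shrinking the approximants by their distance to f makes them constant
   wherever f is, so that the support conditions pass to them. *)
Let approx_slot_flat a f (c : R) : 0 < a <= 1 -> holder a f -> exists (L : R) (gk : nat -> X -> R),
  [/\ 0 <= L, forall k, holder 1 (gk k), forall k, hold a L (gk k), uconv gk f &
      forall k x, f x = c -> gk k x = c].
Proof.
move=> a01 Hf; have [L [gk [L0 gl gL gf]]] := approx_slot a01 Hf.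
have e0 (k : nat) : 0 <= k.+1%:R^-1 :> R by rewrite invr_ge0.
exists L, (fun k x => soft_thr k.+1%:R^-1 (gk k x - c) + c); split=> //.
- move=> k; have [L' L'0 H] := (holderP _ ltr01).1 (gl k).
  exact: (hold_holder ltr01 L'0 (hold_thr _ (e0 k) H)).
- by move=> k; apply: hold_thr.
- apply: (@uconv_near _ _ _ _ 2) => k x.
  have -> : soft_thr k.+1%:R^-1 (gk k x - c) + c - f x =
    (soft_thr k.+1%:R^-1 (gk k x - c) - (gk k x - c)) + (gk k x - f x) by ring.
  rewrite (le_trans (ler_normD _ _))// mulr2n mulrDr mulr1 lerD//.
  exact: soft_thr_near.
by move=> k x <-; rewrite soft_thr_eq0 ?add0r.
Qed.

Lemma ext_vanishes_off : vanishes_off alpha ext K.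
Proof.
move=> F HF FK; have [Fk AF] := approximates_exists HF.
have [L [gk [L0 gl gL gu gf]]] := approx_slot_flat 0 (halpha ord0) (HF ord0).
have AF' := approximates_with AF L0 gl gL gu; rewrite dfwith_id in AF'.
have := ext_cvg HF AF'; have [Fl _ _] := AF'.
have E k : T (dfwith (Fk k) ord0 (gk k)) = 0.
  apply: voff => //; rewrite dfwithin; apply/seteqP; split=> x //= [Sx Kx].
  suff : (fun_spt (F ord0) `&` K) x by rewrite FK.
  split=> //; apply: closure_subset Sx => y /=.
  by apply: contra => /eqP /gf ->.
by under eq_fun do rewrite E; move=> /cvg_lim <- //; apply: lim_cst.
Qed.

Lemma ext_current : holder_current alpha ext.
Proof.
have [ml lo _ _] := hT; split.
- move=> F i g h c HF Hg Hh; have [Fk AF] := approximates_exists HF.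
  have [L [gk [L0 gl gL gg]]] := approx_slot (halpha i) Hg.
  have [L' [hk [L'0 hl hL hh]]] := approx_slot (halpha i) Hh.
  have Hs a (f : X -> R) : 0 < a -> holder a f -> holder a (fun x => c * f x).
    move=> a0 /(holderP _ a0)[B B0 fB].
    by apply: (hold_holder a0 _ (hold_scale c fB)); apply: mulr_ge0.
  have Ha a (f f' : X -> R) : 0 < a -> holder a f -> holder a f' -> holder a (fun x => f x + f' x).
    move=> a0 /(holderP _ a0)[B B0 fB] /(holderP _ a0)[B' B'0 fB'].
    by apply: (hold_holder a0 _ (hold_add fB fB')); apply: addr_ge0.
  have Ag := approximates_with AF L0 gl gL (uconv_harmonic gg).
  have Ah := approximates_with AF L'0 hl hL (uconv_harmonic hh).
  have Agh : approximates (fun k => dfwith (Fk k) i (fun x => c * gk k x + hk k x))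
      (dfwith F i (fun x => c * g x + h x)).
    apply: (@approximates_with _ _ _ _ _ (`|c| * L + L')) => //.
    - by rewrite addr_ge0// mulr_ge0.
    - by move=> k; apply: Ha => //; apply: Hs.
    - by move=> k; apply: hold_add => //; apply: hold_scale.
    apply: (@uconv_near _ _ _ _ (`|c| + 1)) => k x.
    have -> : c * gk k x + hk k x - (c * g x + h x) = c * (gk k x - g x) + (hk k x - h x) by ring.
    have -> : k.+1%:R^-1 * (`|c| + 1) = `|c| * k.+1%:R^-1 + k.+1%:R^-1 by ring.
    by rewrite (le_trans (ler_normD _ _))// lerD// normrM ler_wpM2l.
  have Cg := ext_cvg (holder_tuple_with HF Hg) Ag; have Ch := ext_cvg (holder_tuple_with HF Hh) Ah.
  have Hgh : holder (alpha i) (fun x => c * g x + h x) by apply: Ha => //; apply: Hs.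
  have Cgh := ext_cvg (holder_tuple_with HF Hgh) Agh.
  have [Fl _ _] := AF.
  have C : (fun k => T (dfwith (Fk k) i (fun x => c * gk k x + hk k x))) @ \oo -->
      c * ext (dfwith F i g) + ext (dfwith F i h).
    have -> : (fun k => T (dfwith (Fk k) i (fun x => c * gk k x + hk k x))) =
      (fun k => c * T (dfwith (Fk k) i (gk k)) + T (dfwith (Fk k) i (hk k))).
      by apply/funext => k; apply: ml.
    by apply: cvgD => //; apply: cvgMr.
  by rewrite -(cvg_lim _ Cgh)// (cvg_lim _ C).
- move=> F HF [i [c Fc]]; have [Fk AF] := approximates_exists HF.
  have [L [fk [L0 fl fL fu ff]]] := approx_slot_flat 0 (halpha ord0) (HF ord0).
  have [L' [gk [L'0 gl gL gu gg]]] := approx_slot_flat c (halpha (lift ord0 i)) (HF (lift ord0 i)).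
  have AF1 := approximates_with AF L0 fl fL fu.
  have AF2 := approximates_with AF1 L'0 gl gL gu; rewrite !dfwith_id in AF2.
  have := ext_cvg HF AF2; have [Fl _ _] := AF2.
  have E k : T (dfwith (dfwith (Fk k) ord0 (fk k)) (lift ord0 i) (gk k)) = 0.
    apply: lo => //; exists i, c; rewrite dfwithout 1?eq_sym ?neq_lift// !dfwithin.
    move=> x Sx; have /Fc : fun_spt (F ord0) x.
      apply: closure_subset Sx => y /=.
      by apply: contra => /eqP /ff ->.
    by apply: filterS => y /= /gg.
  by under eq_fun do rewrite E; move=> /cvg_lim <- //; apply: lim_cst.
- by exists K => //; apply: ext_vanishes_off.
apply: seq_continuousP => // Fk F L L0 HF Fu FL.
have HFk k : holder_tuple alpha (Fk k) by apply/(holder_tupleP halpha); exists L.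
(* Diagonal choice: a Lipschitz tuple close to [Fk k] on which [T] is close to [ext (Fk k)]. These
   tuples approximate [F], which reduces continuity to [ext_cvg]. *)
have H (k : nat) : exists G, [/\ lips G, tuple_hold (fun i => 3 * L) G,
    forall i x, `|G i x - Fk k i x| <= k.+1%:R^-1 & `|T G - ext (Fk k)| <= k.+1%:R^-1].
  have G0 (m : nat) : exists G, [/\ lips G, tuple_hold (fun i => 3 * L) G &
      forall i x, `|G i x - Fk k i x| <= m.+1%:R^-1].
    by apply: (@lip_approximation (fun=> L)) => //; rewrite ?invr_gt0//; apply: FL.
  have [Gm HGm] := choice G0.
  have /cvgrPdist_le : (fun m => T (Gm m)) @ \oo --> ext (Fk k).
    apply: ext_cvg => //; split.
    - by move=> m; have [] := HGm m.
    - by exists (3 * L); [rewrite mulr_ge0|move=> m; have [] := HGm m].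
    - by move=> i; apply: uconv_harmonic => m x; have [_ _] := HGm m; apply.
  move=> /(_ k.+1%:R^-1); rewrite invr_gt0 => /(_ (ltr0n _ _)) Hm.
  near \oo => m; exists (Gm m); have [Gl GL GF] := HGm m; split=> //.
    move=> i x; apply: le_trans (GF i x) _; rewrite lef_pV2 ?posrE// ler_nat ltnS.
    by near: m; apply: nbhs_infty_ge.
  by rewrite distrC; near: m.
have [Gk HGk] := choice H.
have A : approximates Gk F.
  split.
  - by move=> k; have [] := HGk k.
  - by exists (3 * L); [rewrite mulr_ge0|move=> k; have [] := HGk k].
  move=> i e e0; have e2 : 0 < e / 2 by rewrite divr_gt0.
  near=> k => x; rewrite (splitr e) (le_trans (ler_distD (Fk k i x) _ _))// lerD//.
    have [_ _ GF _] := HGk k; apply: le_trans (GF i x) _.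
    by apply: ltW; near: k; apply: (near_infty_natSinv_lt (PosNum e2)).
  by move: x; near: k; apply: Fu.
have := ext_cvg HF A => CG.
have D : (fun k => ext (Fk k) - T (Gk k)) @ \oo --> 0.
  apply/cvgr0Pnorm_le => e e0; near=> k.
  have [_ _ _ GF] := HGk k; rewrite distrC; apply: le_trans GF _.
  by apply: ltW; near: k; apply: (near_infty_natSinv_lt (PosNum e0)).
have -> : (fun k => ext (Fk k)) = (fun k => (ext (Fk k) - T (Gk k)) + T (Gk k)).
  by apply/funext => k; rewrite subrK.
by rewrite -[X in _ --> X]add0r; exact: (cvgD D CG).
Unshelve. all: by end_near. Qed.

(** The Lipschitz tuple [F] may fail to be Hoelder. Clamped at its bounds on [K] it belongs to both
    classes, and both currents see only its restriction to [K]. *)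
Lemma ext_eq F G : lips F -> holder_tuple alpha G ->
  (forall i x, K x -> F i x = G i x) -> ext G = T F.
Proof.
move=> HF HG FG; have [L L0 FL] := (holder_tupleP l01 F).1 HF.
have H (i : 'I_n.+1) := @hold_bounded_compact _ _ 1 L (F i) K ltr01 L0 (FL i) cK.
have H' i : exists F' : X -> R, [/\ holder 1 F', holder (alpha i) F' & forall x, K x -> F' x = F i x].
  have [B B0 FB] := H i; exists (fun x => clamp B (F i x)).
  have h1 : hold 1 (1 * L) (fun x => clamp B (F i x)).
    exact: (hold_comp ler01 (fun s t => clamp_lip s t B0) (FL i)).
  rewrite mul1r in h1; split; first exact: (hold_holder ltr01 L0 h1).
    apply: (hold_holder (alpha0 i) _ (hold_bounded (halpha i) L0 B0 _ h1)) => //.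
      by rewrite le_max L0.
    by move=> x; apply: clamp_norm.
  by move=> x Kx; rewrite clamp_id// FB.
have [F' HF'] := choice H'.
have F'l : lips F' by move=> i; have [] := HF' i.
have F'h : holder_tuple alpha F' by move=> i; have [] := HF' i.
rewrite (@current_eq_on_compact _ _ _ _ _ halpha ext_current K ext_vanishes_off cK G F')//.
  rewrite ext_cst//; apply: (current_eq_on_compact l01 hT voff cK) => // i x Kx.
  by have [_ _] := HF' i; apply.
by move=> i x Kx; have [_ _ ->] := HF' i => //; rewrite FG.
Qed.

End Normal.

End Extension.

(** * Fractal currents *)

Section Series.
Context {R : realType}.
Implicit Types (u b : nat -> R).

Lemma cvg_series_dominated u b : (forall k, `|u k| <= b k) -> cvgn (series b) ->
  cvgn (series u).
Proof.
move=> ub cb; apply: normed_cvg; apply: series_le_cvg cb => k //=.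
exact: le_trans (ub k).
Qed.

Lemma series_tail_le u b N : (forall k, `|u k| <= b k) -> cvgn (series b) ->
  `|limn (series u) - series u N| <= limn (series b) - series b N.
Proof.
move=> ub cb; have cu := cvg_series_dominated ub cb.
have b0 k : 0 <= b k by apply: le_trans (ub k).
have nb : {homo series b : n m / (n <= m)%N >-> n <= m}.
  by apply: nondecreasing_series => k _ _.
have H : (fun m => `|series u m - series u N|) @ \oo --> `|limn (series u) - series u N|.
  by apply: cvg_norm; apply: cvgB => //; apply: cvg_cst.
rewrite -(cvg_lim _ H)//; apply: limr_le; first by apply/cvg_ex; eexists; exact: H.
near=> m; have Nm : (N <= m)%N by near: m; apply: nbhs_infty_ge.
rewrite sub_series_geq// (le_trans (ler_norm_sum _ _ _))//.
apply: (@le_trans _ _ (\sum_(N <= k < m) b k)); first exact: ler_sum.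
by rewrite -sub_series_geq// lerD2r nondecreasing_cvgn_le.
Unshelve. all: by end_near. Qed.

(* Tannery's theorem. *)
Lemma cvg_series_dominated_lim (a : nat -> nat -> R) c b :
  cvgn (series b) -> (\forall m \near \oo, forall k, `|a m k| <= b k) ->
  (forall k, `|c k| <= b k) -> (forall k, (fun m => a m k) @ \oo --> c k) ->
  (fun m => limn (series (a m))) @ \oo --> limn (series c).
Proof.
move=> cb ab cB ac; apply/cvgrPdist_le => e e0.
have e3 : 0 < e / 3 by rewrite divr_gt0.
have /filter_ex[N HN] : \forall N \near \oo, `|limn (series b) - series b N| <= e / 3.
  by move: (cb) => /cvgrPdist_le/(_ _ e3).
have /cvgrPdist_le/(_ _ e3) : (fun m => series (a m) N) @ \oo --> series c N.
  rewrite /series/=; elim: N {HN} => [|N IH].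
    by rewrite big_geq//; under eq_fun do rewrite big_geq//; apply: cvg_cst.
  by rewrite big_nat_recr//=; under eq_fun do rewrite big_nat_recr//=; apply: cvgD.
apply: filter_app; apply: filterS ab => m am H.
have H1 := series_tail_le N am cb; have H2 := series_tail_le N cB cb.
have := ler_norm (limn (series b) - series b N).
by move: H HN H1 H2; rewrite !ler_norml; lra.
Unshelve. all: by end_near. Qed.

Lemma cvg_seriesM c u : cvgn (series u) ->
  series (fun k => c * u k) @ \oo --> c * limn (series u).
Proof.
move=> cu; have -> : series (fun k => c * u k) = fun m => c * series u m.
  by apply/funext => m; rewrite /series/= mulr_sumr.
exact: cvgMr.
Qed.

Lemma is_cvg_series_add u b : cvgn (series u) -> cvgn (series b) ->
  cvgn (series (fun k => u k + b k)).
Proof. exact: is_cvg_seriesD. Qed.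

Lemma lim_series_lin c u b : cvgn (series u) -> cvgn (series b) ->
  limn (series (fun k => c * u k + b k)) = c * limn (series u) + limn (series b).
Proof.
move=> cu cb; apply: cvg_lim => //.
have -> : series (fun k => c * u k + b k) = fun m => c * series u m + series b m.
  by apply/funext => m; rewrite /series/= big_split/= mulr_sumr.
by apply: cvgD => //; apply: cvgMr.
Qed.

Lemma eseries_fin u : (forall k, 0 <= u k) -> (\sum_(0 <= k <oo) (u k)%:E < +oo)%E ->
  cvgn (series u) /\ (\sum_(0 <= k <oo) (u k)%:E)%E = (limn (series u))%:E.
Proof.
move=> u0 uoo; set s := (\sum_(0 <= k <oo) (u k)%:E)%E in uoo *.
have s0 : (0 <= s)%E by apply: nneseries_ge0 => k _ _; rewrite lee_fin.
have sfin : s = (fine s)%:E by rewrite fineK// ge0_fin_numE.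
have cu : cvgn (series u).
  apply: nondecreasing_is_cvgn; first exact: nondecreasing_series.
  exists (fine s) => _ [m _ <-]; rewrite -lee_fin -sfin /series/= -sumEFin.
  by apply: nneseries_lim_ge => k _ _; rewrite lee_fin.
split=> //; rewrite -EFin_lim//; congr (limn _); apply/funext => m.
by rewrite /series/= sumEFin.
Qed.

End Series.

Section Uniqueness.
Context {R : realType} {X : metricType R}.
Variables (n : nat) (alpha : 'I_n.+1 -> R).
Hypothesis halpha : forall i, 0 < alpha i <= 1.

(** A Hoelder tuple has approximants that are Lipschitz and uniformly Hoelder; both extensions take
    the value of [T] on them, and continuity concludes. *)
Lemma holder_extension_unique (T T1 T2 : functional X n) :
  holder_extension alpha T T1 -> holder_extension alpha T T2 ->
  forall F, holder_tuple alpha F -> T1 F = T2 F.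
Proof.
move=> [h1 [K1 [_ _ _ E1]]] [h2 [K2 [_ _ _ E2]]] F HF.
have [L [Fk [L0 Fl FL FF]]] := approximates_harmonic halpha HF.
have Fu i : uconv (fun k => Fk k i) (F i) by apply: uconv_harmonic.
have HFk k : holder_tuple alpha (Fk k) by apply/(holder_tupleP halpha); exists L => // i; apply: FL.
have C1 := current_cvg halpha h1 L0 HF Fu FL; have C2 := current_cvg halpha h2 L0 HF Fu FL.
have E : (fun k => T1 (Fk k)) = (fun k => T2 (Fk k)).
  by apply/funext => k; rewrite (E1 (Fk k) (Fk k))// (E2 (Fk k) (Fk k)).
by rewrite -(cvg_lim _ C1)// E (cvg_lim _ C2).
Qed.

End Uniqueness.

(** * Bounds for extensions of normal currents at a prescribed scale *)

Section NormalExtension.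
Context {R : realType} {X : metricType R}.
Variables (n : nat) (gamma : R) (alpha : 'I_n.+1 -> R).
Hypotheses (hgamma : n%:R < gamma) (halpha : forall i, 0 < alpha i <= 1)
  (hsum : gamma <= \sum_(i < n.+1) alpha i).

Local Notation lips := (holder_tuple (@lip_exp R n.+1)).
Local Notation l01 := (@lip_exp01 R n.+1).

Section OneCurrent.
Variables (T : functional X n) (K : set X) (M M' : R).
Hypotheses (hT : metric_current T) (cK : compact K) (voff : vanishes_off (@lip_exp R n.+1) T K).
Hypotheses (TM : (mass T <= M%:E)%E) (TM' : (boundary_mass T <= M'%:E)%E).

Let M0 : 0 <= M. Proof. by rewrite -lee_fin (le_trans (mass_ge0 T)). Qed.
Let M'0 : 0 <= M'. Proof. by rewrite -lee_fin (le_trans (boundary_mass_ge0 T)). Qed.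

Lemma ext_extension : holder_extension alpha T (ext alpha T).
Proof.
have clK : closed K by apply: compact_closed => //; apply: metric_hausdorff.
split; first exact: (ext_current hgamma halpha hsum hT cK voff TM TM').
exists K; split=> //.
- by move=> x; apply; split.
- by move=> x; apply; split=> //; exact: (ext_vanishes_off hgamma halpha hsum hT cK voff TM TM').
- by move=> F G HF HG FG; exact: (ext_eq hgamma halpha hsum hT cK voff TM TM').
Qed.

(** [hext] selects an unspecified extension; existence makes the selection meaningful and uniqueness
    identifies it with the constructed one. *)
Lemma hextE F : holder_tuple alpha F -> hext alpha T F = ext alpha T F.
Proof.
apply: (holder_extension_unique halpha (T := T)); last exact: ext_extension.
by apply: (@getPex (functional X n)); exists (ext alpha T); exact: ext_extension.
Qed.

Lemma mass_bound_compact B (l : 'I_n -> R) F : lips F ->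
  0 <= B -> (forall x, K x -> `|F ord0 x| <= B) -> (forall i, 0 <= l i) ->
  (forall i, hold 1 (l i) (F (lift ord0 i))) ->
  `|T F| <= M * B * \prod_i l i.
Proof.
move=> HF B0 FB l0 Fl; pose f x := clamp B (F ord0 x).
have Hf : holder 1 f.
  have [L L0 FL] := (holderP _ ltr01).1 (HF ord0).
  apply: (hold_holder ltr01 _ (hold_comp ler01 (fun s t => clamp_lip s t B0) FL)).
  by rewrite mul1r.
rewrite -(dfwith_id F ord0) (current_slot0_eq l01 hT voff HF (HF ord0) Hf); last first.
  by move=> x Kx; rewrite /f clamp_id// FB.
apply: (mass_bound hT cK voff TM) => //.
- exact: holder_tuple_with.
- by move=> x; rewrite dfwithin clamp_norm.
- by move=> i; rewrite dfwithout ?neq_lift.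
Qed.

End OneCurrent.

Let alpha0 i : 0 < alpha i. Proof. by have /andP[] := halpha i. Qed.

Let prod_slopes e (L : 'I_n.+1 -> R) : 0 < e ->
  \prod_(i < n) (L (lift ord0 i) * e `^ (alpha (lift ord0 i) - 1)) =
  \prod_(i < n) L (lift ord0 i) * e `^ (tail_sum alpha - n%:R).
Proof.
move=> e0; rewrite big_split/= prod_powR// sumrB sumr_const card_ord.
by rewrite /tail_sum.
Qed.

Variable delta : R.
Hypotheses (htail : delta <= tail_sum alpha).

Lemma powRN_nat (rho : R) (k : nat) p : 1 < rho -> (rho `^ (- k%:R)) `^ p = rho `^ (k%:R * - p).
Proof. by move=> r1; rewrite -powRrM mulNr mulrN. Qed.

(** With [e = rho^-k] the two weights are [e^(delta - n)] and [e^(delta - (n - 1))]. The mass bounds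
    the value at scale [e] by the n tail slopes, of order [e^(tail - n)], and [delta <= tail] with
    [e <= 1] gives the first weight. [ext_dist] accounts for the rest, whence [1 + ext_const]. *)
Lemma ext_bound_R (T : functional X n) K M M' rho (k : nat) (L : 'I_n.+1 -> R) B F :
  metric_current T -> compact K -> vanishes_off (@lip_exp R n.+1) T K ->
  (mass T <= M%:E)%E -> (boundary_mass T <= M'%:E)%E -> 1 < rho ->
  (forall i, 0 <= L i) -> tuple_hold alpha L F -> 0 <= B -> (forall x, K x -> `|F ord0 x| <= B) ->
  `|ext alpha T F| <= (1 + ext_const n gamma) * (B + L ord0) *
     \prod_(i < n) L (lift ord0 i) *
     (M * rho `^ (k%:R * (n%:R - delta)) + M' * rho `^ (k%:R * (n%:R - 1 - delta))).
Proof.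
move=> hT cK voff TM TM' rho1 L0 FL B0 FB.
have M0 : 0 <= M by rewrite -lee_fin (le_trans (mass_ge0 T)).
have M'0 : 0 <= M' by rewrite -lee_fin (le_trans (boundary_mass_ge0 T)).
pose e := rho `^ (- k%:R); have r0 : 0 < rho := lt_trans ltr01 rho1.
have e0 : 0 < e by rewrite powR_gt0.
have e1 : e <= 1.
  rewrite /e powRN invf_le1 ?powR_gt0// -[leLHS](powRr0 rho).
  by rewrite ler_powR// ltW.
have e01 : 0 < e <= 1 by rewrite e0.
pose P := \prod_(i < n) L (lift ord0 i); have P0 : 0 <= P by apply: prodr_ge0.
have E1 : rho `^ (k%:R * (n%:R - delta)) = e `^ (delta - n%:R).
  by rewrite /e powRN_nat// opprB.
have E2 : rho `^ (k%:R * (n%:R - 1 - delta)) = e `^ (delta - (n%:R - 1)).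
  by rewrite /e powRN_nat// opprB.
rewrite E1 E2 -/P; set x1 := e `^ _; set x2 := e `^ _.
have x10 : 0 <= x1 by apply: powR_ge0.
have x20 : 0 <= x2 by apply: powR_ge0.
have BL0 : 0 <= B + L ord0 by apply: addr_ge0.
have C0 := ext_const_ge0 hgamma.
have A1 : `|T (appr_tuple alpha L e F)| <= M * (B + L ord0) * (P * x1).
  apply: le_trans (mass_bound_compact hT cK voff TM (B := B + L ord0)
    (l := fun i => L (lift ord0 i) * e `^ (alpha (lift ord0 i) - 1)) _ _ _ _ _) _ => //.
  - exact: appr_tuple_lip.
  - by move=> x Kx; apply: (appr_tuple_bound halpha L0 FL FB).
  - by move=> i; rewrite mulr_ge0 ?powR_ge0.
  - by move=> i; apply: (appr_lip (halpha _) (L0 _) e0 (FL _)).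
  rewrite prod_slopes// ler_wpM2l ?mulr_ge0// ler_wpM2l//.
  by apply: powR_le_exp => //; apply: lerB.
have A2 := ext_dist hgamma halpha hsum hT cK voff TM TM' L0 FL B0 FB e01.
(* The full product contains [L ord0], absorbed by [B + L ord0]; its exponent [sum - n] exceeds
   [tail - n], hence also [delta - n]. *)
have A3 : appr_error alpha M M' B L e <= (B + L ord0) * P * (M * x1 + M' * x2).
  rewrite /appr_error big_ord_recl -/P.
  have -> : (B + L ord0) * P * (M * x1 + M' * x2) =
    M * ((B + L ord0) * P) * x1 + M' * (B + L ord0) * P * x2 by ring.
  apply: lerD; last first.
    rewrite ler_wpM2l ?mulr_ge0//; apply: powR_le_exp => //.
    exact: lerB.
  apply: ler_pM; rewrite ?mulr_ge0 ?powR_ge0//.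
    by rewrite ler_wpM2l// ler_wpM2r// lerDr.
  apply: powR_le_exp => //; apply: lerB => //; apply: le_trans htail _.
  by rewrite big_ord_recl /tail_sum lerDr ltW.
have -> : (1 + ext_const n gamma) * (B + L ord0) * P * (M * x1 + M' * x2) =
  (B + L ord0) * P * (M * x1 + M' * x2) + ext_const n gamma * ((B + L ord0) * P * (M * x1 + M' * x2)) by ring.
have -> : ext alpha T F = T (appr_tuple alpha L e F) + (ext alpha T F - T (appr_tuple alpha L e F)).
  by rewrite addrC subrK.
rewrite (le_trans (ler_normD _ _))// lerD//.
  apply: le_trans A1 _; rewrite [leRHS]mulrDr -[leLHS]addr0; apply: lerD.
    by rewrite le_eqVlt; apply/orP; left; apply/eqP; ring.
  by rewrite !mulr_ge0.
by apply: le_trans A2 _; rewrite ler_wpM2l.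
Qed.

(** With [e = sigma^-k] the starting value is S(1, ...): a first slot bounded by 1 and n+1 slopes
    give the order [e^(sum - (n+1))]. The boundary has boundary mass 0, which removes the sup-norm
    term from the error. *)
Lemma ext_bound_S (S : functional X n.+1) K M M' sigma (k : nat) (L : 'I_n.+1 -> R) B F :
  metric_current S -> compact K -> vanishes_off (@lip_exp R n.+2) S K ->
  (mass S <= M%:E)%E -> (mass (boundary S) <= M'%:E)%E -> 1 < sigma ->
  (boundary_mass (boundary S) <= 0)%E ->
  (forall i, 0 <= L i) -> tuple_hold alpha L F -> 0 <= B -> (forall x, K x -> `|F ord0 x| <= B) ->
  `|ext alpha (boundary S) F| <= (1 + ext_const n gamma) * \prod_i L i *
     (M * sigma `^ (k%:R * (n.+1%:R - gamma)) + M' * sigma `^ (k%:R * (n%:R - gamma))).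
Proof.
move=> hS cK voffS SM TM sigma1 TM' L0 FL B0 FB.
have hT := boundary_current hS cK voffS; have voff := boundary_vanishes_off hS cK voffS.
set T := boundary S in hT voff TM TM' *.
have M0 : 0 <= M by rewrite -lee_fin (le_trans (mass_ge0 S)).
have M'0 : 0 <= M' by rewrite -lee_fin (le_trans (mass_ge0 T)).
pose e := sigma `^ (- k%:R); have r0 : 0 < sigma := lt_trans ltr01 sigma1.
have e0 : 0 < e by rewrite powR_gt0.
have e1 : e <= 1.
  rewrite /e powRN invf_le1 ?powR_gt0// -[leLHS](powRr0 sigma).
  by rewrite ler_powR// ltW.
have e01 : 0 < e <= 1 by rewrite e0.
pose P := \prod_i L i; have P0 : 0 <= P by apply: prodr_ge0.
have E1 : sigma `^ (k%:R * (n.+1%:R - gamma)) = e `^ (gamma - n.+1%:R).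
  by rewrite /e powRN_nat// opprB.
have E2 : sigma `^ (k%:R * (n%:R - gamma)) = e `^ (gamma - n%:R).
  by rewrite /e powRN_nat// opprB.
rewrite E1 E2 -/P; set x1 := e `^ _; set x2 := e `^ _.
have x10 : 0 <= x1 by apply: powR_ge0.
have x20 : 0 <= x2 by apply: powR_ge0.
have C0 := ext_const_ge0 hgamma.
have Al := appr_tuple_lip halpha L0 FL e0.
have A1 : `|T (appr_tuple alpha L e F)| <= M * (P * x1).
  rewrite /T boundaryE -[M]mulr1.
  apply: le_trans (mass_bound hS cK voffS SM (B := 1)
    (l := fun i => L i * e `^ (alpha i - 1)) _ _ _ _ _) _ => //.
  - exact: cone_lip.
  - by move=> x; rewrite cone0 /cst normr1.
  - by move=> i; rewrite mulr_ge0 ?powR_ge0.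
  - by move=> i; rewrite coneS; apply: (appr_lip (halpha _) (L0 _) e0 (FL _)).
  rewrite ler_wpM2l ?mulr1// big_split/= prod_powR// sumrB sumr_const card_ord.
  by rewrite ler_wpM2l//; apply: powR_le_exp => //; apply: lerB.
have A2 := ext_dist hgamma halpha hsum hT cK voff TM TM' L0 FL B0 FB e01.
have A3 : appr_error alpha M' 0 B L e <= P * M' * x2.
  rewrite /appr_error !mul0r addr0 [P * _]mulrC ler_wpM2l ?mulr_ge0//.
  by apply: powR_le_exp => //; apply: lerB.
have -> : (1 + ext_const n gamma) * P * (M * x1 + M' * x2) =
  (P * (M * x1 + M' * x2)) + ext_const n gamma * (P * (M * x1 + M' * x2)) by ring.
have -> : ext alpha T F = T (appr_tuple alpha L e F) + (ext alpha T F - T (appr_tuple alpha L e F)).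
  by rewrite addrC subrK.
rewrite (le_trans (ler_normD _ _))// lerD//.
  apply: le_trans A1 _; rewrite [leRHS]mulrDr -[leLHS]addr0; apply: lerD.
    by rewrite le_eqVlt; apply/orP; left; apply/eqP; ring.
  by rewrite !mulr_ge0.
apply: le_trans A2 _; rewrite ler_wpM2l//; apply: le_trans A3 _.
by rewrite -mulrA ler_wpM2l// lerDr mulr_ge0.
Qed.

End NormalExtension.

(** * Summation over an approximating sequence *)

Section Fractal.
Context {R : realType} {X : metricType R}.
Variables (n : nat) (gamma delta : R) (alpha : 'I_n.+1 -> R).
Hypotheses (hgamma : n%:R < gamma) (halpha : forall i, 0 < alpha i <= 1)
  (hsum : gamma <= \sum_(i < n.+1) alpha i) (htail : delta <= tail_sum alpha).

Let alpha0 i : 0 < alpha i. Proof. by have /andP[] := halpha i. Qed.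

Local Notation lips := (holder_tuple (@lip_exp R n.+1)).
Local Notation l01 := (@lip_exp01 R).

Variables (Rk : nat -> functional X n) (Sk : nat -> functional X n.+1)
  (sigma rho : R) (K : set X).
Hypotheses (sigma1 : 1 < sigma) (rho1 : 1 < rho)
  (hR : forall k, normal_current (Rk k)) (hS : forall k, normal_current (Sk k))
  (cK : compact K) (RK : forall k, spt (Rk k) `<=` K) (SK : forall k, spt (Sk k) `<=` K).
Hypotheses
  (fS : (\sum_(0 <= k <oo)
     mass (Sk k) * (sigma `^ (k%:R * (n.+1%:R - gamma)))%:E < +oo)%E)
  (fS' : (\sum_(0 <= k <oo)
     mass (boundary (Sk k)) * (sigma `^ (k%:R * (n%:R - gamma)))%:E < +oo)%E)
  (fR : (\sum_(0 <= k <oo)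
     mass (Rk k) * (rho `^ (k%:R * (n%:R - delta)))%:E < +oo)%E)
  (fR' : (\sum_(0 <= k <oo)
     boundary_mass (Rk k) * (rho `^ (k%:R * (n%:R - 1 - delta)))%:E < +oo)%E).

Let vR k : vanishes_off (@lip_exp R n.+1) (Rk k) K.
Proof. by apply: (spt_vanishes_off (l01 (n:=n.+1)) (hR k).1 cK); apply: RK. Qed.

Let vS k : vanishes_off (@lip_exp R n.+2) (Sk k) K.
Proof. by apply: (spt_vanishes_off (l01 (n:=n.+2)) (hS k).1 cK); apply: SK. Qed.

Let mR k := fine (mass (Rk k)).
Let mR' k := fine (boundary_mass (Rk k)).
Let mS k := fine (mass (Sk k)).
Let mS' k := fine (mass (boundary (Sk k))).

Let fin_add (x y : \bar R) : (0 <= x)%E -> (0 <= y)%E -> (x + y < +oo)%E ->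
  x = (fine x)%:E /\ y = (fine y)%:E.
Proof.
move=> x0 y0 xy; split; rewrite fineK// ge0_fin_numE//; apply: le_lt_trans xy.
  exact: leeDl.
exact: leeDr.
Qed.

Let mRE k : mass (Rk k) = (mR k)%:E.
Proof. exact: (fin_add (mass_ge0 _) (boundary_mass_ge0 _) (hR k).2).1. Qed.
Let mR'E k : boundary_mass (Rk k) = (mR' k)%:E.
Proof. exact: (fin_add (mass_ge0 _) (boundary_mass_ge0 _) (hR k).2).2. Qed.
Let mSE k : mass (Sk k) = (mS k)%:E.
Proof. exact: (fin_add (mass_ge0 _) (boundary_mass_ge0 _) (hS k).2).1. Qed.
Let mS'E k : mass (boundary (Sk k)) = (mS' k)%:E.
Proof. exact: (fin_add (mass_ge0 _) (boundary_mass_ge0 _) (hS k).2).2. Qed.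

Let mR0 k : 0 <= mR k. Proof. by rewrite -lee_fin -mRE mass_ge0. Qed.
Let mR'0 k : 0 <= mR' k. Proof. by rewrite -lee_fin -mR'E boundary_mass_ge0. Qed.
Let mS0 k : 0 <= mS k. Proof. by rewrite -lee_fin -mSE mass_ge0. Qed.
Let mS'0 k : 0 <= mS' k. Proof. by rewrite -lee_fin -mS'E mass_ge0. Qed.

Let bS k := boundary_current (hS k).1 cK (vS k).
Let vbS k : vanishes_off (@lip_exp R n.+1) (boundary (Sk k)) K.
Proof. exact: boundary_vanishes_off (hS k).1 cK (vS k). Qed.

(** For [n = 0] this is the convention on boundaries; otherwise every competitor for the mass has
    value 0. *)
Let bbS k : (boundary_mass (boundary (Sk k)) <= 0%:E)%E.
Proof.
have := (hS k).1; move: (Sk k); case: (n) => [//|m] S hS0 /=.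
apply: ge_ereal_sup => _ [p [F [HF _ _ ->]]].
rewrite lee_fin big1// => i _; exact: boundary_boundary.
Qed.

Let r k := mR k * rho `^ (k%:R * (n%:R - delta)) + mR' k * rho `^ (k%:R * (n%:R - 1 - delta)).
Let s k := mS k * sigma `^ (k%:R * (n.+1%:R - gamma)) + mS' k * sigma `^ (k%:R * (n%:R - gamma)).

Let r0 k : 0 <= r k. Proof. by rewrite addr_ge0// mulr_ge0 ?powR_ge0. Qed.
Let s0 k : 0 <= s k. Proof. by rewrite addr_ge0// mulr_ge0 ?powR_ge0. Qed.

Lemma fractal_R_sumE : cvgn (series r) /\ fractal_R_sum delta rho Rk = (limn (series r))%:E.
Proof.
have E : fractal_R_sum delta rho Rk = (\sum_(0 <= k <oo) (r k)%:E)%E.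
  by apply: eq_eseriesr => k _; rewrite mRE mR'E.
rewrite E; apply: eseries_fin => //; rewrite -E /fractal_R_sum nneseriesD.
- exact: (lte_add_pinfty fR fR').
- by move=> k _ _; rewrite mule_ge0 ?mass_ge0// lee_fin powR_ge0.
- by move=> k _ _; rewrite mule_ge0 ?boundary_mass_ge0// lee_fin powR_ge0.
Qed.

Lemma fractal_S_sumE : cvgn (series s) /\ fractal_S_sum gamma sigma Sk = (limn (series s))%:E.
Proof.
have E : fractal_S_sum gamma sigma Sk = (\sum_(0 <= k <oo) (s k)%:E)%E.
  by apply: eq_eseriesr => k _; rewrite mSE mS'E.
rewrite E; apply: eseries_fin => //; rewrite -E /fractal_S_sum nneseriesD.
- exact: (lte_add_pinfty fS fS').
- by move=> k _ _; rewrite mule_ge0 ?mass_ge0// lee_fin powR_ge0.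
- by move=> k _ _; rewrite mule_ge0 ?mass_ge0// lee_fin powR_ge0.
Qed.

Definition fractal_const := 1 + ext_const n gamma.

Lemma fractal_const_gt0 : 0 < fractal_const.
Proof. by rewrite ltr_pwDl// ext_const_ge0. Qed.

Let tR k F := ext alpha (Rk k) F.
Let tS k F := ext alpha (boundary (Sk k)) F.

Let lexE (x : R) (y : \bar R) : y = x%:E -> (y <= x%:E)%E.
Proof. by move=> ->. Qed.

Section OneTuple.
Variables (L : 'I_n.+1 -> R) (B : R) (F : 'I_n.+1 -> X -> R).
Hypotheses (L0 : forall i, 0 <= L i) (FL : tuple_hold alpha L F) (B0 : 0 <= B)
  (FB : forall x, K x -> `|F ord0 x| <= B).

Let cR := fractal_const * (B + L ord0) * \prod_(i < n) L (lift ord0 i).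
Let cS := fractal_const * \prod_i L i.

Let tR_le k : `|tR k F| <= cR * r k.
Proof.
exact: (ext_bound_R hgamma halpha hsum htail k (hR k).1 cK (vR k) (lexE (mRE k)) (lexE (mR'E k)) rho1 L0 FL B0 FB).
Qed.

Let tS_le k : `|tS k F| <= cS * s k.
Proof.
exact: (ext_bound_S hgamma halpha hsum k (hS k).1 cK (vS k) (lexE (mSE k)) (lexE (mS'E k)) sigma1 (bbS k) L0 FL B0 FB).
Qed.

Let cvgM (c : R) (u : nat -> R) : cvgn (series u) -> cvgn (series (fun k => c * u k)) /\
  limn (series (fun k => c * u k)) = c * limn (series u).
Proof.
move=> cu; have H := cvg_seriesM (c := c) cu; split; last exact: cvg_lim.
by apply/cvg_ex; exists (c * limn (series u)).
Qed.

Let lim_le (u b : nat -> R) : (forall k, `|u k| <= b k) -> cvgn (series b) ->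
  `|limn (series u)| <= limn (series b).
Proof.
move=> ub cb; have := series_tail_le 0 ub cb.
by rewrite /series/= !big_geq// !subr0.
Qed.

Lemma series_R_cvg : cvgn (series (fun k => tR k F)).
Proof. by apply: cvg_series_dominated tR_le _; apply: (cvgM _ fractal_R_sumE.1).1. Qed.

Lemma series_S_cvg : cvgn (series (fun k => tS k F)).
Proof. by apply: cvg_series_dominated tS_le _; apply: (cvgM _ fractal_S_sumE.1).1. Qed.

Lemma series_R_le : `|limn (series (fun k => tR k F))| <= cR * limn (series r).
Proof.
have [c1 <-] := cvgM cR fractal_R_sumE.1.
exact: lim_le tR_le c1.
Qed.

Lemma series_S_le : `|limn (series (fun k => tS k F))| <= cS * limn (series s).
Proof.
have [c1 <-] := cvgM cS fractal_S_sumE.1.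
exact: lim_le tS_le c1.
Qed.

Lemma fractal_dominated k : `|tR k F + tS k F| <= cR * r k + cS * s k.
Proof. by rewrite (le_trans (ler_normD _ _))// lerD. Qed.

Lemma fractal_dominated_cvg : cvgn (series (fun k => cR * r k + cS * s k)).
Proof.
exact: (is_cvg_series_add (cvgM cR fractal_R_sumE.1).1 (cvgM cS fractal_S_sumE.1).1).
Qed.

End OneTuple.

Definition fractal_ext : functional X n := fun F => limn (series (fun k => tR k F + tS k F)).

Let bounds F : holder_tuple alpha F -> exists L B : R, [/\ 0 <= L, 0 <= B,
  tuple_hold alpha (fun=> L) F & forall x, K x -> `|F ord0 x| <= B].
Proof.
move=> /(holder_tupleP halpha)[L L0 FL].
have [B B0 FB] := hold_bounded_compact (alpha0 ord0) L0 (FL ord0) cK.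
by exists L, B.
Qed.

Let fractal_cvg F : holder_tuple alpha F -> cvgn (series (fun k => tR k F + tS k F)).
Proof.
move=> /bounds[L [B [L0 B0 FL FB]]].
have Lc (i : 'I_n.+1) : 0 <= (fun=> L) i by [].
apply: cvg_series_dominated (fractal_dominated Lc FL B0 FB) _.
exact: fractal_dominated_cvg.
Qed.

Let cR_current k : holder_current alpha (tR k).
Proof. exact: (ext_current hgamma halpha hsum (hR k).1 cK (vR k) (lexE (mRE k)) (lexE (mR'E k))). Qed.

Let cS_current k : holder_current alpha (tS k).
Proof. exact: (ext_current hgamma halpha hsum (bS k) cK (vbS k) (lexE (mS'E k)) (bbS k)). Qed.

Let series0 (u : nat -> R) : (forall k, u k = 0) -> limn (series u) = 0.
Proof.
move=> u0; have -> : series u = fun=> 0.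
  by apply/funext => m; rewrite /series/= big1.
exact: lim_cst.
Qed.

Lemma fractal_ext_vanishes_off : vanishes_off alpha fractal_ext K.
Proof.
move=> F HF FK; apply: series0 => k; rewrite /tR /tS.
rewrite (ext_vanishes_off hgamma halpha hsum (hR k).1 cK (vR k) (lexE (mRE k)) (lexE (mR'E k)))//.
by rewrite (ext_vanishes_off hgamma halpha hsum (bS k) cK (vbS k) (lexE (mS'E k)) (bbS k))// addr0.
Qed.

Lemma fractal_ext_current : holder_current alpha fractal_ext.
Proof.
split.
- move=> F i g h c HF Hg Hh; rewrite /fractal_ext.
  have Hgh : holder (alpha i) (fun x => c * g x + h x).
    have [G G0 gG] := (holderP _ (alpha0 i)).1 Hg; have [H H0 hH] := (holderP _ (alpha0 i)).1 Hh.
    apply: (hold_holder (alpha0 i) _ (hold_add (hold_scale c gG) hH)).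
    by rewrite addr_ge0// mulr_ge0.
  have cg := fractal_cvg (holder_tuple_with HF Hg); have ch := fractal_cvg (holder_tuple_with HF Hh).
  set G := fun k => tR k (dfwith F i g) + tS k (dfwith F i g) in cg *.
  set H := fun k => tR k (dfwith F i h) + tS k (dfwith F i h) in ch *.
  rewrite -lim_series_lin//; congr (limn (series _)); apply/funext => k.
  have [mR1 _ _ _] := cR_current k; have [mS1 _ _ _] := cS_current k.
  by rewrite mR1// mS1// /G /H; ring.
- move=> F HF Fc; apply: series0 => k.
  have [_ lR _ _] := cR_current k; have [_ lS _ _] := cS_current k.
  by rewrite lR// lS// addr0.
- by exists K => //; apply: fractal_ext_vanishes_off.
apply: seq_continuousP => // Fk F L L0 HF Fu FL.
have FL' : tuple_hold alpha (fun=> L) F by move=> i; apply: (uconv_hold (fun k => FL k i) (Fu i)).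
have [B B0 FB] := hold_bounded_compact (alpha0 ord0) L0 (FL' ord0) cK.
have B10 : 0 <= B + 1 by rewrite addr_ge0.
have Lc (i : 'I_n.+1) : 0 <= (fun=> L) i by [].
have HB := @fractal_dominated_cvg (fun=> L) (B + 1).
(* The dominating series must not depend on [m]: eventually [Fk m] is within 1 of [F], so [B + 1]
   bounds its first slot on [K]. *)
have H1 : \forall m \near \oo, forall k, `|tR k (Fk m) + tS k (Fk m)| <=
    fractal_const * (B + 1 + L) * \prod_(i < n) L * r k + fractal_const * \prod_(i < n.+1) L * s k.
  apply: filterS (Fu ord0 1 ltr01) => m Hm k; apply: (fractal_dominated Lc (FL m) B10).
  move=> x Kx; rewrite -[Fk m ord0 x](subrK (F ord0 x)) addrC.
  by rewrite (le_trans (ler_normD _ _))// lerD ?FB.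
have FB1 x : K x -> `|F ord0 x| <= B + 1.
  by move=> Kx; rewrite (le_trans (FB x Kx))// lerDl.
have H3 k : (fun m => tR k (Fk m) + tS k (Fk m)) @ \oo --> tR k F + tS k F.
  apply: cvgD; first exact: (current_cvg halpha (cR_current k) L0 HF Fu FL).
  exact: (current_cvg halpha (cS_current k) L0 HF Fu FL).
exact: (cvg_series_dominated_lim HB H1 (fractal_dominated Lc FL' B10 FB1) H3).
Qed.

Variable T : functional X n.
Hypothesis wT : forall F, lips F ->
  (fun m => \sum_(0 <= k < m) (Rk k F + boundary (Sk k) F)) @ \oo --> T F.

Lemma fractal_ext_extension : holder_extension alpha T fractal_ext.
Proof.
have clK : closed K by apply: compact_closed => //; apply: metric_hausdorff.
have vT : vanishes_off (@lip_exp R n.+1) T K.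
  move=> F HF FK; rewrite -(cvg_lim _ (wT HF))//.
  have -> : (fun m => \sum_(0 <= k < m) (Rk k F + boundary (Sk k) F)) = fun=> 0.
    by apply/funext => m; rewrite big1// => k _; rewrite vR// vbS// addr0.
  exact: lim_cst.
split; first exact: fractal_ext_current.
exists K; split=> //.
- by move=> x; apply; split.
- by move=> x; apply; split=> //; exact: fractal_ext_vanishes_off.
move=> F G HF HG FG; rewrite /fractal_ext -(cvg_lim _ (wT HF))//.
congr (limn _); apply/funext => m; rewrite /series/=; apply: eq_bigr => k _.
rewrite /tR /tS (ext_eq hgamma halpha hsum (hR k).1 cK (vR k) (lexE (mRE k)) (lexE (mR'E k)) HF)//.
by rewrite (ext_eq hgamma halpha hsum (bS k) cK (vbS k) (lexE (mS'E k)) (bbS k) HF).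
Qed.

Lemma hext_R k F : holder_tuple alpha F -> hext alpha (Rk k) F = tR k F.
Proof. exact: (hextE hgamma halpha hsum (hR k).1 cK (vR k) (lexE (mRE k)) (lexE (mR'E k))). Qed.

Lemma hext_S k F : holder_tuple alpha F -> hext alpha (boundary (Sk k)) F = tS k F.
Proof. exact: (hextE hgamma halpha hsum (bS k) cK (vbS k) (lexE (mS'E k)) (bbS k)). Qed.

Lemma fractal_estimates F : holder_tuple alpha F ->
  [/\ cvgn (series (fun k => hext alpha (Rk k) F)),
      cvgn (series (fun k => hext alpha (boundary (Sk k)) F)),
      (`|limn (series (fun k => hext alpha (Rk k) F))|%:E <=
         fractal_const%:E * holder_norm (alpha ord0) (F ord0) * holder_prod alpha F *
         fractal_R_sum delta rho Rk)%E &
      (`|limn (series (fun k => hext alpha (boundary (Sk k)) F))|%:E <=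
         fractal_const%:E * (holder_prod alpha F *
                 holder_const (alpha ord0) (F ord0)) *
         fractal_S_sum gamma sigma Sk)%E].
Proof.
move=> HF.
have -> : (fun k => hext alpha (Rk k) F) = (fun k => tR k F).
  by apply/funext => k; rewrite hext_R.
have -> : (fun k => hext alpha (boundary (Sk k)) F) = (fun k => tS k F).
  by apply/funext => k; rewrite hext_S.
pose L i := fine (holder_const (alpha i) (F i)).
have LE i : holder_const (alpha i) (F i) = (L i)%:E by rewrite [LHS]holder_constK.
have L0 i : 0 <= L i by rewrite -lee_fin -LE holder_const_ge0.
have FL : tuple_hold alpha L F by move=> i; apply: holder_hold.
have [B B0 FB] := hold_bounded_compact (alpha0 ord0) (L0 ord0) (FL ord0) cK.
have PE : holder_prod alpha F = (\prod_(i < n) L (lift ord0 i))%:E.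
  by rewrite /holder_prod -prodEFin; apply: eq_bigr => i _; rewrite LE.
have [_ RE] := fractal_R_sumE; have [_ SE] := fractal_S_sumE.
have C0 := fractal_const_gt0.
split.
- exact: (series_R_cvg L0 FL B0 FB).
- exact: (series_S_cvg L0 FL B0 FB).
- rewrite RE PE /holder_norm LE; set P := \prod_(i < n) _; set lr := limn (series r).
  have P0 : 0 <= P by apply: prodr_ge0.
  have lr0 : 0 <= lr.
    by apply: limr_ge; [exact: fractal_R_sumE.1|apply: nearW => m; apply: sumr_ge0].
  have sup0 : (0 <= sup_norm (F ord0))%E by apply: ereal_sup_ubound; left.
  (* The sup norm may be infinite. If the remaining factor is 0, the bound [B] on [K] already makes
     the left side 0; otherwise an infinite norm makes the right side infinite, and a finite one can
     take the place of [B]. *)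
  have [Plr|Plr] := eqVneq (P * lr) 0.
    apply: (@le_trans _ _ 0%E); last first.
      by rewrite !mule_ge0 ?adde_ge0 ?lee_fin// ltW.
    rewrite lee_fin; apply: le_trans (series_R_le L0 FL B0 FB) _.
    by rewrite -/P -/lr -mulrA Plr mulr0.
  have Pp : 0 < P * lr by rewrite lt_neqAle eq_sym Plr mulr_ge0.
  have supB b : sup_norm (F ord0) = b%:E -> forall x, `|F ord0 x| <= b.
    by move=> E x; rewrite -lee_fin -E; apply: ereal_sup_ubound; right; exists x.
  case E : (sup_norm (F ord0)) sup0 => [b| |//] sup0.
    rewrite -EFinD -!EFinM lee_fin.
    apply: (series_R_le L0 FL) => [|x _]; first by rewrite -lee_fin.
    exact: supB.
  by rewrite addye// gt0_muley ?lte_fin// -muleA -EFinM gt0_mulye ?lte_fin// leey.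
- rewrite SE PE LE -!EFinM lee_fin; have := series_S_le L0 FL B0 FB.
  by rewrite big_ord_recl [L ord0 * _]mulrC.
Qed.

End Fractal.

Theorem theorem4p5 (R : realType) (n : nat) (gamma delta : R)
    (hgamma : n%:R < gamma < n.+1%:R) (hdelta : n%:R - 1 < delta < n%:R) :
  exists C : R, 0 <= C /\
  forall (X : metricType R) (T : functional X n) (alpha : 'I_n.+1 -> R),
    fractal_current gamma delta T ->
    (forall i, 0 < alpha i <= 1) ->
    gamma <= \sum_(i < n.+1) alpha i ->
    ((0 < n)%N -> delta <= \sum_(i < n) alpha (lift ord0 i)) ->
    unique_holder_extension alpha T /\
    forall (Rk : nat -> functional X n) (Sk : nat -> functional X n.+1)
        (sigma rho : R),
      fractal_approx gamma delta T Rk Sk sigma rho ->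
      forall F : 'I_n.+1 -> X -> R, holder_tuple alpha F ->
        [/\ cvgn (series (fun k => hext alpha (Rk k) F)),
            cvgn (series (fun k => hext alpha (boundary (Sk k)) F)),
            (`|limn (series (fun k => hext alpha (Rk k) F))|%:E <=
               C%:E * holder_norm (alpha ord0) (F ord0) * holder_prod alpha F *
               fractal_R_sum delta rho Rk)%E &
            (`|limn (series (fun k => hext alpha (boundary (Sk k)) F))|%:E <=
               C%:E * (holder_prod alpha F *
                       holder_const (alpha ord0) (F ord0)) *
               fractal_S_sum gamma sigma Sk)%E].
Proof.
have /andP[g1 _] := hgamma; exists (fractal_const n gamma).
split; first exact: ltW (fractal_const_gt0 g1).
move=> X T alpha [_ [Rk [Sk [sigma [rho HT]]]]] halpha hsum htail0.
(* In dimension 0 the tail sum is empty and [delta < 0], so the inequality holds there as well. *)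
have htail : delta <= tail_sum alpha.
  case: n hdelta alpha htail0 {hgamma g1 T Rk Sk HT halpha hsum} => [|m] hd alpha htail0.
    by rewrite /tail_sum big_ord0; move: hd => /andP[_ /ltW].
  exact: htail0.
split; last first.
  move=> {Rk Sk sigma rho HT} Rk Sk sigma rho.
  move=> [[s1 r1 hR hS] [K cK sK] _ [fS fS' fR fR'] _] F HF.
  exact: (fractal_estimates g1 halpha hsum htail s1 r1 hR hS cK (fun k => (sK k).1)
    (fun k => (sK k).2) fS fS' fR fR' HF).
move: HT => [[s1 r1 hR hS] [K cK sK] [_ wT] [fS fS' fR fR'] _].
have E := fractal_ext_extension g1 halpha hsum htail s1 r1 hR hS cK (fun k => (sK k).1)
    (fun k => (sK k).2) fS fS' fR fR' wT.
by eexists; split; [exact: E|move=> T' ET' F HF; exact: (holder_extension_unique halpha ET' E)].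
Qed.
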